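(* Let $b_0,\dots,b_m:\mathbb{R}\times\mathbb{R}^n\to\mathbb{R}^n$ and $u_1,\dots,u_m:\mathbb{R}\times\mathbb{R}\to\mathbb{R}$ satisfy Assumptions A1--A4 listed in the context. For $\omega\in(0,\infty)$ consider the input-affine system $$\dot x=b_0(t,x)+\sum_{i=1}^m b_i(t,x)\sqrt{\omega}\,u_i(t,\omega t)\qquad(\mathrm{IA}_\omega)$$ and its Lie bracket system $$\dot z=b_0(t,z)+\sum_{i=1}^m\sum_{j=i+1}^m[b_i,b_j](t,z)\,\nu_{ji}(t),\qquad \nu_{ji}(t)=\frac1T\int_0^T u_j(t,\theta)\int_0^\theta u_i(t,\tau)\,d\tau\,d\theta.\qquad(\mathrm{LB})$$ Suppose that a compact set $\mathcal{S}\subseteq\mathbb{R}^n$ is locally uniformly asymptotically stable for (LB). Then $\mathcal{S}$ is locally practically uniformly asymptotically stable for $(\mathrm{IA}_\omega)$ (with respect to the parameter $\omega$).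
   Context: $|\cdot|$ is the Euclidean norm (with a corresponding norm for matrices). For vector fields $f,g:\mathbb{R}\times\mathbb{R}^n\to\mathbb{R}^n$ that are $C^1$ in $x$, the Lie bracket is $[f,g](t,x):=\frac{\partial g(t,x)}{\partial x}f(t,x)-\frac{\partial f(t,x)}{\partial x}g(t,x)$. Measurable means Lebesgue-measurable. A solution of $\dot x=f(t,x)$ through $x(t_0)=x_0$ is an absolutely continuous function with $x(t)=x_0+\int_{t_0}^t f(\tau,x(\tau))\,d\tau$ on the interval considered. For $\mathcal{S}\subseteq\mathbb{R}^n$ and $a\in(0,\infty)$, $\mathcal{U}_a^{\mathcal{S}}:=\{x\in\mathbb{R}^n:\inf_{y\in\mathcal{S}}|x-y|<a\}$. Assumptions: A1: $b_i\in C^2(\mathbb{R}\times\mathbb{R}^n;\mathbb{R}^n)$, $i=0,\dots,m$. A2: For every compact set $\mathcal{C}\subseteq\mathbb{R}^n$ there exist $A_1,\dots,A_6\in[0,\infty)$ such that $|b_i(t,x)|\le A_1$, $|\frac{\partial b_i(t,x)}{\partial t}|\le A_2$, $|\frac{\partial b_i(t,x)}{\partial x}|\le A_3$, $|\frac{\partial^2 b_j(t,x)}{\partial t\,\partial x}|\le A_4$, $|\frac{\partial[b_j,b_k](t,x)}{\partial x}|\le A_5$, $|\frac{\partial[b_j,b_k](t,x)}{\partial t}|\le A_6$ for all $x\in\mathcal{C}$, $t\in\mathbb{R}$, $i=0,\dots,m$, $j=1,\dots,m$, $k=j,\dots,m$. A3: $u_i:\mathbb{R}\times\mathbb{R}\to\mathbb{R}$,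 $i=1,\dots,m$, are measurable, and for every $i$ there exist $L_i,M_i\in(0,\infty)$ with $|u_i(t_1,\theta)-u_i(t_2,\theta)|\le L_i|t_1-t_2|$ for all $t_1,t_2,\theta\in\mathbb{R}$ and $\sup_{t,\theta\in\mathbb{R}}|u_i(t,\theta)|\le M_i$. A4: There is $T\in(0,\infty)$ such that for all $i=1,\dots,m$ and $t,\theta\in\mathbb{R}$: $u_i(t,\theta+T)=u_i(t,\theta)$ and $\int_0^T u_i(t,\tau)\,d\tau=0$. Stability notions for a family $\dot x=f_\omega(t,x)$, $\omega\in(0,\infty)$, and a compact set $\mathcal{S}\subseteq\mathbb{R}^n$: - $\mathcal{S}$ is practically uniformly stable if for every $\epsilon\in(0,\infty)$ there exist $\delta\in(0,\infty)$ and $\omega_0\in(0,\infty)$ such that for all $t_0\in\mathbb{R}$ and all $\omega\in(\omega_0,\infty)$: $x(t_0)\in\mathcal{U}_\delta^{\mathcal{S}}\Rightarrow x(t)\in\mathcal{U}_\epsilon^{\mathcal{S}}$ for $t\in[t_0,\infty)$. - For $\delta\in(0,\infty)$, $\mathcal{S}$ is $\delta$-practically uniformly attractive if for every $\epsilon\in(0,\infty)$ there exist $t_f\in[0,\infty)$ and $\omega_0\in(0,\infty)$ such that for all $t_0\in\mathbb{R}$ and all $\omega\in(\omega_0,\infty)$: $x(t_0)\in\mathcal{U}_\delta^{\mathcal{S}}\Rightarrow x(t)\in\mathcal{U}_\epsilon^{\mathcal{S}}$ for $t\in[t_0+t_f,\infty)$. - $\mathcal{S}$ is locally practically uniformly asymptotically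 stable if it is practically uniformly stable and there exists $\delta\in(0,\infty)$ such that it is $\delta$-practically uniformly attractive. For a system independent of $\omega$ (such as (LB)), the word ''practically'' is dropped and the same definitions are used without $\omega$ and $\omega_0$. *)

(* Defs.v *)
From HB Require Import structures.
From mathcomp Require Import all_boot all_order all_algebra.
From mathcomp Require Import all_classical all_reals all_analysis.
From mathcomp Require Import measurable_realfun.

Set Implicit Arguments.
Unset Strict Implicit.
Unset Printing Implicit Defensive.

Import Order.TTheory GRing.Theory Num.Theory.
Import numFieldNormedType.Exports.

Local Open Scope classical_set_scope.
Local Open Scope ring_scope.

(* Points of R^n are row vectors ['rV[R]_n], and [jacobian f x] acts on them
   from the right: [v *m jacobian f x] is (df/dx)(x) v.  The canonical norm
   [`| _ |] of the library on matrices is the sup norm; it induces the usual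
   topology, hence the usual notions of compactness, continuity and
   differentiability, but it is not the Euclidean norm. *)

Section Norms.
Context {R : realType}.

Definition enorm n (v : 'rV[R]_n) : R := Num.sqrt (\sum_(i < n) v 0 i ^+ 2).

(* Operator norm induced by [enorm]; transposition does not change it. *)
Definition opnorm n (M : 'M[R]_n) : R :=
  sup [set enorm (v *m M) | v in [set v : 'rV[R]_n | enorm v <= 1]].

(* The infimum is taken in the extended reals: it is +oo when S is empty. *)
Definition Unbhd n (S : set 'rV[R]_n) (a : R) : set 'rV[R]_n :=
  [set x | (ereal_inf [set (enorm (x - y))%:E | y in S] < a%:E)%E].

End Norms.

Section Smoothness.
Context {R : realType}.

(* In finite dimension the continuity (differentiability) of the derivative
   x |-> 'd f x is that of x |-> 'd f x v for every fixed v. *)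
Fixpoint Ck (k : nat) (V W : normedModType R) (f : V -> W) : Prop :=
  if k is k'.+1 then
    (forall x, differentiable f x) /\ (forall v, Ck k' (fun x => 'd f x v))
  else continuous f.

Definition lie_bracket n (f g : R -> 'rV[R]_n -> 'rV[R]_n)
    (t : R) (x : 'rV[R]_n) : 'rV[R]_n :=
  f t x *m jacobian (g t) x - g t x *m jacobian (f t) x.

End Smoothness.

Section Solutions.
Context {R : realType}.

(* Lebesgue measurability on the plane: preimages of Borel sets belong to the
   completion (Borel sets united with null sets) of the product measure. *)
Definition lebesgue_measurable2 (f : R * R -> R) : Prop :=
  forall B : set R, measurable B ->
    completed_algebra_gen
      ((@lebesgue_measure R) \x (@lebesgue_measure R))%E (f @^-1` B).

Definition abs_continuous n (a b : R) (x : R -> 'rV[R]_n) : Prop :=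
  forall e : R, 0 < e -> exists2 d : R, 0 < d &
    forall (k : nat) (l r : 'I_k -> R),
      (forall i, a <= l i /\ l i <= r i /\ r i <= b) ->
      trivIset setT (fun i => `]l i, r i[%classic : set R) ->
      \sum_(i < k) (r i - l i) < d ->
      \sum_(i < k) enorm (x (r i) - x (l i)) < e.

(* Integral over [a, b], for a <= b. *)
Definition leb_int (a b : R) (f : R -> R) : R :=
  \int[@completed_lebesgue_measure R]_(s in `[a, b]%classic) f s.

(* Solution on [t0, +oo[ of x' = f(t, x) with x(t0) = x0; the values of x
   before t0 are irrelevant.  Integrability is with respect to the completed
   Lebesgue measure because f need not be Borel measurable in t. *)
Definition is_solution n (f : R -> 'rV[R]_n -> 'rV[R]_n)
    (t0 : R) (x0 : 'rV[R]_n) (x : R -> 'rV[R]_n) : Prop :=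
  forall t : R, t0 <= t ->
    [/\ abs_continuous t0 t x,
        forall k : 'I_n, (@completed_lebesgue_measure R).-integrable
          `[t0, t]%classic (fun s => (f s (x s) 0 k)%:E) &
        x t = x0 + \row_(k < n) leb_int t0 t (fun s => f s (x s) 0 k)].

End Solutions.

Section Stability.
Context {R : realType} {n : nat}.
Implicit Types (f : R -> 'rV[R]_n -> 'rV[R]_n)
  (F : R -> R -> 'rV[R]_n -> 'rV[R]_n) (S : set 'rV[R]_n).

(* "x(t0) in U_delta => x(t) in U_eps for t in [t1, +oo[" includes the
   assertion that x(t) exists for all t >= t0. *)
Definition carries f S (t0 delta t1 eps : R) : Prop :=
  forall x0, Unbhd S delta x0 ->
    (exists x, is_solution f t0 x0 x) /\
    (forall x, is_solution f t0 x0 x ->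
       forall t, t1 <= t -> Unbhd S eps (x t)).

Definition uniformly_stable f S : Prop :=
  forall eps : R, 0 < eps -> exists2 delta : R, 0 < delta &
    forall t0 : R, carries f S t0 delta t0 eps.

Definition uniformly_attractive (delta : R) f S : Prop :=
  forall eps : R, 0 < eps -> exists2 tf : R, 0 <= tf &
    forall t0 : R, carries f S t0 delta (t0 + tf) eps.

Definition locally_uniformly_asymptotically_stable f S : Prop :=
  uniformly_stable f S /\
  exists2 delta : R, 0 < delta & uniformly_attractive delta f S.

Definition practically_uniformly_stable F S : Prop :=
  forall eps : R, 0 < eps -> exists delta omega0 : R,
    [/\ 0 < delta, 0 < omega0 &
        forall t0 omega : R, omega0 < omega ->
          carries (F omega) S t0 delta t0 eps].

Definition practically_uniformly_attractive (delta : R) F S : Prop :=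
  forall eps : R, 0 < eps -> exists tf omega0 : R,
    [/\ 0 <= tf, 0 < omega0 &
        forall t0 omega : R, omega0 < omega ->
          carries (F omega) S t0 delta (t0 + tf) eps].

Definition locally_practically_uniformly_asymptotically_stable F S : Prop :=
  practically_uniformly_stable F S /\
  exists2 delta : R, 0 < delta & practically_uniformly_attractive delta F S.

End Stability.

(* The fields b_0, ..., b_m are indexed by ['I_m.+1] and the inputs
   u_1, ..., u_m by ['I_m]: [u i] goes with the field [inp b i]. *)
Section Systems.
Context {R : realType} {n m : nat}.
Implicit Types (b : 'I_m.+1 -> R -> 'rV[R]_n -> 'rV[R]_n)
  (u : 'I_m -> R -> R -> R).

Definition inp b (i : 'I_m) : R -> 'rV[R]_n -> 'rV[R]_n := b (lift ord0 i).

Definition assumption1 b : Prop :=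
  forall i, Ck 2 (fun p : R * 'rV[R]_n => b i p.1 p.2).

Definition assumption2 b : Prop :=
  forall C : set 'rV[R]_n, compact C ->
  exists A1 A2 A3 A4 A5 A6 : R,
  [/\ 0 <= A1, 0 <= A2 & 0 <= A3] /\ [/\ 0 <= A4, 0 <= A5 & 0 <= A6] /\
  forall (x : 'rV[R]_n) (t : R), C x ->
  [/\ forall i : 'I_m.+1, enorm (b i t x) <= A1,
      forall i : 'I_m.+1, enorm (derive1 (fun s => b i s x) t) <= A2 &
      forall i : 'I_m.+1, opnorm (jacobian (b i t) x) <= A3] /\
  [/\ forall j : 'I_m,
        opnorm (derive1 (fun s => jacobian (inp b j s) x) t) <= A4,
      forall j k : 'I_m, (j <= k)%N ->
        opnorm (jacobian (lie_bracket (inp b j) (inp b k) t) x) <= A5 &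
      forall j k : 'I_m, (j <= k)%N ->
        enorm (derive1 (fun s => lie_bracket (inp b j) (inp b k) s x) t) <= A6].

Definition assumption3 u : Prop :=
  forall i : 'I_m,
    lebesgue_measurable2 (fun p => u i p.1 p.2) /\
    exists L M : R,
    [/\ 0 < L, 0 < M,
        forall t1 t2 theta : R,
          `|u i t1 theta - u i t2 theta| <= L * `|t1 - t2| &
        forall t theta : R, `|u i t theta| <= M].

Definition assumption4 (T : R) u : Prop :=
  0 < T /\
  forall (i : 'I_m) (t theta : R),
    u i t (theta + T) = u i t theta /\
    leb_int 0 T (u i t) = 0.

Definition input_affine b u (omega : R) (t : R) (x : 'rV[R]_n) : 'rV[R]_n :=
  b ord0 t x +
  \sum_(i < m) (Num.sqrt omega * u i t (omega * t)) *: inp b i t x.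

Definition nu (T : R) u (j i : 'I_m) (t : R) : R :=
  T^-1 * leb_int 0 T (fun theta => u j t theta * leb_int 0 theta (u i t)).

Definition lie_bracket_system (T : R) b u (t : R) (z : 'rV[R]_n) : 'rV[R]_n :=
  b ord0 t z +
  \sum_(i < m) \sum_(j < m | (i < j)%N)
    nu T u j i t *: lie_bracket (inp b i) (inp b j) t z.

End Systems.

(* Main.v *)
(** A solution x of (IA_omega) is compared with the Euler scheme of (LB) on a
    grid of step [T / omega].  After rescaling one period to [0, T] and
    freezing the slow time, x follows the loop w' = e sum_i v_i b_i(w) up to
    O(e^3), with e = 1 / sqrt omega.  Differentiate this loop with respect to
    its amplitude p: with U_i the primitive of v_i, the derivative of w is
    y + r with y = sum_i U_i b_i(w), and inserting y in the variational
    equation leaves for r a linear equation whose source is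
    p sum_(i,l) v_i U_l (Db_i b_l - Db_l b_i), that is, brackets only.  As y
    vanishes at both ends of the period, integrating r(T) over p in [0, e]
    gives the displacement e^2 T sum_(i<j) nu_ji [b_i, b_j] + O(e^3).  Its
    constants depend only on the bounds of b_i and Db_i and on the Lipschitz
    constants of the brackets: A2 does not bound the second derivatives of the
    b_i uniformly in time, so the usual double integration by parts is not
    available.

    Summing over the periods, x - z = O(e) on windows of fixed length,
    uniformly in t0.  If every solution of (LB) issued from U_delta is in
    U_(delta/2) after the time tf, then x is back in U_delta at the end of each
    window of length tf, which transfers stability and attractivity. *)

Require Import Defs.
From mathcomp Require Import all_boot all_order all_algebra.
From mathcomp Require Import all_classical all_reals all_analysis.
From mathcomp Require Import measurable_realfun.
From mathcomp Require Import ring lra.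

Set Implicit Arguments.
Unset Strict Implicit.
Unset Printing Implicit Defensive.

Import Order.TTheory GRing.Theory Num.Theory.
Import numFieldNormedType.Exports.

Local Open Scope classical_set_scope.
Local Open Scope ring_scope.

(** * Integration for the completed Lebesgue measure *)

(** Two obstacles shape the details. The inputs are only Lebesgue measurable in the pair of times,
    while the system reads them along the line [theta = omega * t], a null set of the plane; their
    Lipschitz continuity in the first time restores measurability there. And nothing is
    differentiated in the fast time or in the amplitude: each differential identity becomes a bound
    on increments with an error quadratic in the length, and such errors vanish when the interval is
    subdivided. This is how second derivatives of the fields leave the final constants: compactness
    bounds them at one frozen time only, and they enter the estimates only through quadratic errors.

    The orders in [e] are dictated by the number of periods: a window of fixed length contains O(1 /
    e^2) of them, so an error O(e^3) per period adds up to O(e). Finally, the conclusion asserts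
    that solutions exist for all later times; they come from Picard iteration for a field whose
    state is clamped to a box, and the estimates show that the clamp never acts. *)

Section LebInt.
Context {R : realType}.
Implicit Types (a b c t : R) (f g : R -> R).

Local Notation cR := (caratheodory_type ((wlength (@idfun R))^*)%mu).
Local Notation cmu := (@completed_lebesgue_measure R).

Lemma borel_completed_measurable (A : set R) :
  measurable A -> measurable (A : set cR).
Proof. by move=> mA; exact (@sub_caratheodory _ _ _ (wlength (@idfun R)) A mA). Qed.

Lemma borel_completed_measurable_fun (A : set R) f :
  measurable A -> measurable_fun A f ->
  measurable_fun (A : set cR) (f : cR -> R).
Proof.
by move=> mA mf _ Y mY; apply: borel_completed_measurable; apply: mf.
Qed.

(** Unlike integrability, this condition is stable under products, and it still gives integrability
    on the bounded interval. *)
Definition bmeas a b f :=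
  measurable_fun (`[a, b]%classic : set cR) (f : cR -> R) /\
  exists M, forall t, a <= t <= b -> `|f t| <= M.

Lemma measurable_citv a b : measurable (`[a, b]%classic : set cR).
Proof. exact/borel_completed_measurable. Qed.
#[local] Hint Resolve measurable_citv : core.

Lemma cmu_itv a b : a <= b -> cmu `[a, b]%classic = (b - a)%:E.
Proof.
move=> ab; transitivity (lebesgue_measure `[a, b]%classic); first by [].
rewrite lebesgue_measure_itv/= lte_fin.
case: ltgtP ab => // -> _; by rewrite subrr.
Qed.

Lemma bmeas_int a b f : bmeas a b f -> cmu.-integrable `[a, b]%classic (EFin \o f).
Proof.
move=> [mf [M fM]]; have [ab|ba] := leP a b.
  apply: measurable_bounded_integrable => //.
    by rewrite [X in (X < _)%E]cmu_itv// ltry.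
  exists M; split; first exact: num_real.
  move=> y My t /=; rewrite in_itv/= => tab; apply: le_trans (ltW My).
  exact: fM.
rewrite set_itv_ge -?leNgt ?bnd_simp -?ltNge//.
exact: integrable_set0.
Qed.
#[local] Hint Resolve bmeas_int : core.

Lemma bmeasD a b f g : bmeas a b f -> bmeas a b g ->
  bmeas a b (fun t => f t + g t).
Proof.
move=> [mf [M fM]] [mg [N gN]]; split; first exact: measurable_funD.
exists (M + N) => t tab; rewrite (le_trans (ler_normD _ _))// lerD ?fM ?gN//.
Qed.

Lemma bmeasM a b f g : bmeas a b f -> bmeas a b g ->
  bmeas a b (fun t => f t * g t).
Proof.
move=> [mf [M fM]] [mg [N gN]]; split; first exact: measurable_funM.
by exists (M * N) => t tab; rewrite normrM ler_pM ?fM ?gN.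
Qed.

Lemma bmeas_cst a b c : bmeas a b (fun=> c).
Proof. by split; [exact: measurable_cst | exists `|c|]. Qed.

Lemma bmeasB a b f g : bmeas a b f -> bmeas a b g ->
  bmeas a b (fun t => f t - g t).
Proof.
move=> mf mg; apply: (bmeasD mf).
rewrite (_ : (fun t => - g t) = (fun t => -1 * g t)); last first.
  by apply/funext => t; rewrite mulN1r.
by apply: bmeasM => //; exact: bmeas_cst.
Qed.

Lemma bmeas_sum a b (I : Type) (r : seq I) (P : pred I) (F : I -> R -> R) :
  (forall i, bmeas a b (F i)) ->
  bmeas a b (fun t => \sum_(i <- r | P i) F i t).
Proof.
move=> mF; elim: r => [|i r IH].
  rewrite (_ : (fun _ => _) = (fun=> 0)); first exact: bmeas_cst.
  by apply/funext => t; rewrite big_nil.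
rewrite (_ : (fun _ => _) =
  (fun t => (if P i then F i t else 0) + \sum_(i <- r | P i) F i t)).
  by apply: (bmeasD _ IH); case: (P i); [exact: mF|exact: bmeas_cst].
by apply/funext => t; rewrite big_cons; case: ifP => //; rewrite add0r.
Qed.

Lemma bmeas_sub a b a' b' f : a <= a' -> b' <= b ->
  bmeas a b f -> bmeas a' b' f.
Proof.
move=> aa' bb' [mf [M fM]]; split.
  apply: measurable_funS mf => //; apply: subset_itv; by rewrite bnd_simp.
by exists M => t /andP[a't tb']; rewrite fM// (le_trans aa')//= (le_trans tb').
Qed.

Lemma bmeas_eq a b f g : (forall t, a <= t <= b -> f t = g t) ->
  bmeas a b f -> bmeas a b g.
Proof.
move=> fg [mf [M fM]]; split.
  by apply: eq_measurable_fun mf => t; rewrite inE/= in_itv/= => /fg.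
by exists M => t tab; rewrite -fg// fM.
Qed.

(** Composing [f] with the retraction [cl] of the line onto [[a, b]] gives a continuous, hence
    Borel, function on the whole line that agrees with [f] on the interval. *)
Lemma bmeas_lip a b f (L : R) :
  (forall s t, a <= s -> s <= t -> t <= b -> `|f t - f s| <= L * (t - s)) ->
  bmeas a b f.
Proof.
move=> fL; have [ab|ba] := leP a b; last first.
  split; last by exists 0 => t /andP[at_ tb]; have := le_lt_trans tb ba; rewrite ltNge at_.
  by rewrite set_itv_ge -?leNgt ?bnd_simp -?ltNge//; exact: measurable_fun_set0.
have fL' s t : a <= s <= b -> a <= t <= b -> `|f t - f s| <= `|L| * `|t - s|.
  move=> /andP[as_ sb] /andP[at_ tb]; have [st|/ltW ts] := leP s t.
    rewrite (le_trans (fL _ _ as_ st tb))//.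
    by rewrite [leRHS]mulrC [leLHS]mulrC ger0_norm ?subr_ge0// ler_wpM2l ?subr_ge0// ler_norm.
  rewrite distrC (distrC t) (le_trans (fL _ _ at_ ts sb))//.
  by rewrite [leRHS]mulrC [leLHS]mulrC ger0_norm ?subr_ge0// ler_wpM2l ?subr_ge0// ler_norm.
have fb : exists M, forall t, a <= t <= b -> `|f t| <= M.
  exists (`|f a| + `|L| * (b - a)) => t /andP[at_ tb].
  rewrite -[f t](subrK (f a)) addrC (le_trans (ler_normD _ _))// lerD2l.
  rewrite (le_trans (fL' _ _ _ _)) ?lexx ?ab ?at_ ?tb//.
  by rewrite (@ger0_norm _ (t - a)) ?subr_ge0//; apply: ler_wpM2l; rewrite ?lerD2r.
split => //; apply: borel_completed_measurable_fun => //.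
pose cl t := Num.max a (Num.min t b).
have clab t : a <= cl t <= b by rewrite /cl le_max lexx/= ge_max ab ge_min lexx orbT.
have clL s t : `|cl t - cl s| <= `|t - s|.
  have clm x y : x <= y -> 0 <= cl y - cl x /\ cl y - cl x <= y - x.
    rewrite /cl => xy.
    by case: (leP x b) => ?; case: (leP y b) => ?;
      case: (leP a x) => ?; case: (leP a y) => ?; case: (leP a b) => ?;
      split; lra.
  have [st|/ltW ts] := leP s t.
    by have [? ?] := clm _ _ st; rewrite !ger0_norm // subr_ge0.
  by have [? ?] := clm _ _ ts; rewrite distrC (distrC t) !ger0_norm // subr_ge0.
have cf : continuous (f \o cl).
  move=> t; apply/cvgrPdist_le => /= e e0; near=> s.
  rewrite (le_trans (fL' _ _ _ _))// (@le_trans _ _ ((`|L| + 1) * `|t - s|))//.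
    by rewrite ler_pM// lerDl.
  rewrite -ler_pdivlMl; last by rewrite ltr_wpDl.
  near: s; apply: cvgr_dist_le; first exact: cvg_id.
  by rewrite mulr_gt0// invr_gt0 ltr_wpDl.
have mfcl := measurable_funTS (continuous_measurable_fun cf) (D := `[a, b]%classic).
apply: (eq_measurable_fun (f \o cl)); last exact: mfcl.
move=> t; rewrite inE/= in_itv/= => /andP[at_ tb].
by rewrite /cl (min_idPl tb) (max_idPr at_).
Unshelve. all: by end_near. Qed.

Lemma eq_leb_int a b f g : (forall t, a <= t <= b -> f t = g t) ->
  leb_int a b f = leb_int a b g.
Proof.
move=> fg; apply: eq_Rintegral => t; rewrite inE/= in_itv/=; exact: fg.
Qed.

Lemma leb_intD a b f g : bmeas a b f -> bmeas a b g ->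
  leb_int a b (fun t => f t + g t) = leb_int a b f + leb_int a b g.
Proof. by move=> mf mg; apply: RintegralD => //; exact: bmeas_int. Qed.

Lemma leb_intB a b f g : bmeas a b f -> bmeas a b g ->
  leb_int a b (fun t => f t - g t) = leb_int a b f - leb_int a b g.
Proof. by move=> mf mg; apply: RintegralB => //; exact: bmeas_int. Qed.

Lemma leb_intZ a b c f : bmeas a b f ->
  leb_int a b (fun t => c * f t) = c * leb_int a b f.
Proof. by move=> mf; apply: RintegralZl => //; exact: bmeas_int. Qed.

Lemma leb_int_cst a b c : a <= b -> leb_int a b (fun=> c) = c * (b - a).
Proof.
move=> ab; rewrite /leb_int Rintegral_cst//=; congr (_ * _).
by rewrite [X in fine X]cmu_itv.
Qed.

Lemma leb_int_sum a b (I : Type) (r : seq I) (P : pred I) (F : I -> R -> R) :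
  a <= b -> (forall i, bmeas a b (F i)) ->
  leb_int a b (fun t => \sum_(i <- r | P i) F i t) =
  \sum_(i <- r | P i) leb_int a b (F i).
Proof.
move=> ab mF; elim: r => [|i r IH].
  rewrite big_nil -[RHS](mul0r (b - a)) -leb_int_cst//.
  by apply: eq_leb_int => t _; rewrite big_nil.
rewrite big_cons; case: ifPn => Pi; rewrite -IH.
  rewrite -leb_intD; [|exact: mF|exact: bmeas_sum].
  by apply: eq_leb_int => t _; rewrite big_cons Pi.
by apply: eq_leb_int => t _; rewrite big_cons (negbTE Pi).
Qed.

Lemma leb_int_point a f : leb_int a a f = 0.
Proof.
transitivity (leb_int a a (fun=> f a)).
  by apply: eq_leb_int => t /andP[*]; congr f; apply/eqP; rewrite eq_le; apply/andP.
by rewrite leb_int_cst// subrr mulr0.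
Qed.

Lemma le_leb_int a b f g : bmeas a b f -> bmeas a b g ->
  (forall t, a <= t <= b -> f t <= g t) -> leb_int a b f <= leb_int a b g.
Proof.
move=> mf mg fg; by apply: le_Rintegral; [|exact: bmeas_int|exact: bmeas_int|
  move=> t /=; rewrite in_itv/=; exact: fg].
Qed.

Lemma norm_leb_int_le a b f g : bmeas a b f -> bmeas a b g ->
  (forall t, a <= t <= b -> `|f t| <= g t) -> `|leb_int a b f| <= leb_int a b g.
Proof.
move=> mf mg fg; rewrite ler_norml; apply/andP; split; last first.
  by apply: le_leb_int => // t /fg; apply: le_trans; rewrite ler_norm.
rewrite -mulN1r -(leb_intZ _ mg); apply: le_leb_int; [|exact: mf|].
  by apply: bmeasM => //; exact: bmeas_cst.
by move=> t /fg; rewrite mulN1r ler_norml => /andP[].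
Qed.

Lemma norm_leb_int_cst a b f M : a <= b -> bmeas a b f ->
  (forall t, a <= t <= b -> `|f t| <= M) -> `|leb_int a b f| <= M * (b - a).
Proof.
move=> ab mf fM; rewrite -leb_int_cst//.
by apply: norm_leb_int_le => //; exact: bmeas_cst.
Qed.

Lemma leb_int_chasles a c b f : a <= c -> c <= b -> bmeas a b f ->
  leb_int a b f = leb_int a c f + leb_int c b f.
Proof.
move=> ac cb mf.
have mf1 : bmeas a c f by apply: bmeas_sub mf.
have mf2 : bmeas c b f by apply: bmeas_sub mf.
rewrite /leb_int (@itv_bndbnd_setU _ _ (BLeft a) (BLeft c) (BRight b)) ?bnd_simp//.
rewrite Rintegral_setU//=; last 3 first.
- exact: borel_completed_measurable.
- rewrite -itv_bndbnd_setU ?bnd_simp//; exact: bmeas_int.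
- apply/disj_setPS => y [/=]; rewrite 2!in_itv/= => /andP[_ yx] /andP[].
  by rewrite leNgt yx.
congr (_ + _).
(* The closed intervals overlap at [c], so [[a, c]] is cut in turn into [[a, c[] and the point [c],
   whose integral is zero. *)
rewrite [in RHS](@itv_bndbnd_setU _ _ (BLeft a) (BLeft c) (BRight c)) ?bnd_simp//.
rewrite Rintegral_setU//=; last 3 first.
- exact: borel_completed_measurable.
- rewrite -itv_bndbnd_setU ?bnd_simp//; exact: bmeas_int.
- apply/disj_setPS => y [/=]; rewrite 2!in_itv/= => /andP[_ yx] /andP[].
  by rewrite leNgt yx.
rewrite -[LHS]addr0; congr (_ + _); apply/esym.
by have := leb_int_point c f.
Qed.

Section AffineChange.
Variables (s c : R).
Hypothesis c0 : 0 < c.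
Let phi (t : R) : R := s + c * t.
Let cnn : {nonneg R} := NngNum (ltW c0).

Let phi_itv (a b : R) (x y : bool) :
  phi @^-1` [set` Interval (BSide x (phi a)) (BSide y (phi b))] =
  [set` Interval (BSide x a) (BSide y b)].
Proof.
apply/seteqP; split => t /=; rewrite !in_itv/= /phi;
  by case: x; case: y; rewrite /= ?(lerD2l, ltrD2l, ler_pM2l, ltr_pM2l).
Qed.

Let phiK t : phi (c^-1 * (t - s)) = t.
Proof. by rewrite /phi mulrA divff ?gt_eqF// mul1r addrC subrK. Qed.

Let phi_borel : measurable_fun setT (phi : measurableTypeR R -> measurableTypeR R).
Proof.
apply: measurable_funD; first exact: measurable_cst.
apply: measurable_funM; [exact: measurable_cst|exact: measurable_id].
Qed.

(** Both sides are measures in [A] that agree on half-open intervals, so uniqueness of Lebesgue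
    measure applies. *)
Let lebesgue_phi (A : set R) : measurable A ->
  lebesgue_measure A = (c%:E * lebesgue_measure (phi @^-1` A))%E.
Proof.
pose pm : {measure set (measurableTypeR R) -> \bar R} :=
  measure_function_pushforward__canonical__measure_function_Measure lebesgue_measure phi_borel.
pose mm : {measure set (measurableTypeR R) -> \bar R} := mscale cnn pm.
move=> mA; have -> : (c%:E * lebesgue_measure (phi @^-1` A))%E = mm A by [].
have E (X : set R) : ocitv X -> lebesgue_measure X = mm X; last first.
  exact: (lebesgue_measure_unique E).
move=> [[a b]] _ <-.
rewrite /mm /= /mscale /= /pm /= /pushforward -{2}(phiK a) -{2}(phiK b) [phi @^-1` _]phi_itv.
rewrite !lebesgue_measure_itv/= !lte_fin ltr_pM2l ?invr_gt0// ltrD2r.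
case: ifP => _; last by rewrite mule0.
by rewrite -!EFinB -EFinM; congr EFin; field; rewrite gt_eqF.
Qed.

Let phi_negligible (N : set R) : (@lebesgue_measure R).-negligible N ->
  (@lebesgue_measure R).-negligible (phi @^-1` N).
Proof.
move=> [M [mM M0 NM]]; exists (phi @^-1` M); split => //.
- by rewrite -[X in measurable X]setTI; exact: phi_borel.
- apply/eqP; have := lebesgue_phi mM; rewrite M0 => /esym/eqP.
  by rewrite mule_eq0 eqe gt_eqF.
- by move=> t /NM.
Qed.

Lemma completed_measurableP (A : set R) : measurable (A : set cR) <->
  exists2 B : set R, measurable B &
  exists2 N : set R, (@lebesgue_measure R).-negligible N & B `|` N = A.
Proof.
suff -> : measurable (A : set cR) = completed_algebra_gen (@lebesgue_measure R) A by [].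
by rewrite -g_sigma_completed_algebra_genE completed_caratheodory_measurable.
Qed.

(** Borel measurability is not enough between completed spaces: preimages of null sets must be null
    too, and the scaling of the measure by [c > 0] gives this. *)
Lemma affine_completed_measurable : measurable_fun setT (phi : cR -> cR).
Proof.
move=> _ A /completed_measurableP[B mB [N N0 <-]]; rewrite setTI; apply/completed_measurableP.
exists (phi @^-1` B); first by rewrite -[X in measurable X]setTI; exact: phi_borel.
by exists (phi @^-1` N) => //; exact: phi_negligible.
Qed.

Let cmuE (B N : set R) : measurable B -> (@lebesgue_measure R).-negligible N ->
  cmu (B `|` N) = lebesgue_measure B.
Proof.
move=> mB [M [mM M0 NM]].
have mN : measurable (N : set cR).
  apply/completed_measurableP; exists set0 => //; exists N; last by rewrite set0U.
  by exists M.
rewrite measureU0//; first exact: borel_completed_measurable.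
apply: (@subset_measure0 _ _ _ cmu N M) => //.
exact: borel_completed_measurable.
Qed.

Let cmu_phi (A : set cR) : measurable A -> cmu A = (c%:E * cmu (phi @^-1` A))%E.
Proof.
move=> /completed_measurableP[B mB [N N0 <-]].
rewrite preimage_setU !cmuE//; first exact: lebesgue_phi.
- by rewrite -[X in measurable X]setTI; exact: phi_borel.
- exact: phi_negligible.
Qed.

Lemma bmeas_affine a b f : bmeas (phi a) (phi b) f ->
  bmeas a b (fun t => f (s + c * t)).
Proof.
move=> [mf [M fM]]; split; last first.
  exists M => t /andP[at_ tb]; apply: fM.
  by rewrite !lerD2l !ler_pM2l// at_.
rewrite -(phi_itv a b true false).
apply: (@measurable_comp _ _ _ cR cR _ `[phi a, phi b]%classic).
- exact: measurable_citv.
- move=> _ [t tab <-]; exact: tab.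
- exact: mf.
- exact: measurable_funTS affine_completed_measurable.
Qed.

Let ge0_leb_int_affine a b f : (forall t, 0 <= f t) -> bmeas (phi a) (phi b) f ->
  leb_int (phi a) (phi b) f = c * leb_int a b (fun t => f (s + c * t)).
Proof.
move=> f0 mf; pose pm : {measure set cR -> \bar R} :=
  measure_function_pushforward__canonical__measure_function_Measure cmu affine_completed_measurable.
rewrite /leb_int /Rintegral.
rewrite (@eq_measure_integral _ _ _ _ (mscale cnn pm)); last first.
  by move=> A mA _; exact: cmu_phi.
rewrite ge0_integral_mscale//=; last 2 first.
- by apply/measurable_EFinP; case: mf.
- by move=> t _; rewrite lee_fin.
rewrite ge0_integral_pushforward//; last 2 first.
- by apply/measurable_EFinP; case: mf.
- by move=> t _; rewrite lee_fin.
rewrite [phi @^-1` _](phi_itv a b true false) fineM//.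
apply: integrable_fin_num; first exact: measurable_citv.
  exact: (bmeas_int (bmeas_affine mf)).
all: by [exact: measurable_citv | exact: affine_completed_measurable].
Qed.

Lemma leb_int_affine a b f : a <= b -> bmeas (s + c * a) (s + c * b) f ->
  leb_int (s + c * a) (s + c * b) f = c * leb_int a b (fun t => f (s + c * t)).
Proof.
move=> ab mf.
(* The nonnegative case asks for a sign on the whole line. Truncation from below does not change [f]
   on the interval and makes it bounded below everywhere; adding a constant then makes it
   nonnegative. *)
wlog f0 : f mf / exists M, forall t, - M <= f t.
  have [_ [M fM]] := mf; pose g := fun t => Num.max (- M) (f t).
  have fg t : s + c * a <= t <= s + c * b -> f t = g t.
    move=> /fM; rewrite /g ler_norml => /andP[h _]; by rewrite (max_idPr h).
  move=> h; rewrite (eq_leb_int (g := g))// h//.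
  - congr (_ * _); apply: eq_leb_int => t /andP[h1 h2]; rewrite -fg//.
    by rewrite !lerD2l !ler_pM2l// h1.
  - exact: bmeas_eq mf.
  - by exists M => t; rewrite le_max lexx.
case: f0 => M fM.
have ab' : s + c * a <= s + c * b by rewrite lerD2l ler_pM2l.
have := @ge0_leb_int_affine a b (fun t => f t + M).
rewrite leb_intD//; last exact: bmeas_cst.
rewrite leb_intD; [|exact: bmeas_affine|exact: bmeas_cst].
rewrite !leb_int_cst// => /(_ _ _) E.
apply: (@addIr _ (M * ((s + c * b) - (s + c * a)))); rewrite [LHS]E.
- ring.
- by move=> t; rewrite -lerBlDr sub0r.
- by apply: bmeasD => //; exact: bmeas_cst.
Qed.
End AffineChange.
End LebInt.

(** * Measurability of the inputs at a fixed slow time and along the oscillation *)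

Section Slices.
Context {R : realType}.
Local Notation cR := (caratheodory_type ((wlength (@idfun R))^*)%mu).
Local Notation leb := (@lebesgue_measure R).

Lemma completed_measurableU (B N : set R) :
  measurable B -> leb.-negligible N -> measurable (B `|` N : set cR).
Proof. by move=> mB N0; apply/completed_measurableP; exists B => //; exists N. Qed.

(** Each rational superlevel set is a Borel set united with a null set, and all these null sets lie
    in one Borel null set [M]. By Fubini almost every section of [M] is null; at such [s] the
    superlevel sets of the slice are again Borel up to null sets. *)
Lemma ae_slice_measurable (f : R * R -> R) : lebesgue_measurable2 f ->
  exists2 Z : set R, leb.-negligible Z &
    forall s, ~ Z s -> measurable_fun (setT : set cR) (fun t => f (s, t) : R).
Proof.
move=> mf.
have /(_ _)/cid2-/all_sig2[A mA /(_ _)/cid2-/all_sig2[N N0 AN]] (q : rat) :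
    completed_algebra_gen (leb \x leb)%E (f @^-1` `]ratr q, +oo[%classic).
  by apply: mf; exact: measurable_itv.
have [M [mM M0 NM]] : (leb \x leb)%E.-negligible
    (\bigcup_k (if unpickle k is Some q then N q else set0)).
  apply: negligible_bigcup => k; case: unpickle => [q|]; first exact: N0.
  exact: negligible_set0.
have NqM q : N q `<=` M.
  move=> x Nx; apply: NM; exists (pickle q); first exact: I.
  rewrite pickleK; exact: Nx.
have mx : measurable_fun setT (leb \o xsection M).
  exact: (@measurable_fun_xsection _ _ _ _ _ leb).
have /(ae_eq_integral_abs leb measurableT mx) [Z [mZ Z0 hZ]] :
    (\int[leb]_(x in setT) `|(leb \o xsection M) x|)%E = 0%E.
  rewrite -[RHS]M0; apply: eq_integral => x _ /=.
  by rewrite gee0_abs.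
exists Z; first by exists Z; split.
move=> s Zs; have xM0 : leb (xsection M s) = 0%E.
  by apply: contrapT => h; apply: Zs; apply: hZ => /= /(_ I).
have ray (r : R) : measurable ([set t | r < f (s, t)] : set cR).
  have -> : [set t | r < f (s, t)] =
      \bigcup_(q in [set: rat]) (if r < ratr q then [set t | ratr q < f (s, t)] else set0).
    apply/seteqP; split => [t /= /rat_in_itvoo[q]|t [q _]] /=.
      by rewrite in_itv/= => /andP[rq qf]; exists q => //; rewrite rq.
    by case: ifP => // rq /= /(lt_trans rq).
  apply: bigcupT_measurable_rat => q; case: ifP => // _.
  have -> : [set t | ratr q < f (s, t)] = xsection (A q) s `|` xsection (N q) s.
    have ANt t : (A q `|` N q) (s, t) <-> ratr q < f (s, t).
      by rewrite AN /= in_itv/= andbT.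
    by apply/seteqP; split => t /=; rewrite /xsection/= !inE => /ANt.
  apply: completed_measurableU.
    by apply: measurable_xsection; exact: mA.
  exists (xsection M s); split; [exact: measurable_xsection|exact: xM0|].
  by move=> t; rewrite /xsection/= !inE => /NqM.
apply: (measurability _ (RGenOInfty.measurableE R)).
move=> _ [_ [r ->] <-]; rewrite setTI.
rewrite (_ : _ @^-1` _ = [set t | r < f (s, t)]); first exact: ray.
by apply/seteqP; split => t /=; rewrite in_itv/= andbT.
Qed.

Lemma negligible_dense (Z : set R) (a b : R) : leb.-negligible Z -> a < b ->
  exists2 s, a < s < b & ~ Z s.
Proof.
move=> [M [mM M0 ZM]] ab; apply: contrapT => h.
have : (leb `]a, b[%classic <= leb M)%E.
  have mI : measurable (`]a, b[%classic : set R) by exact: measurable_itv.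
  apply: le_measure; [exact/mem_set|exact/mem_set|].
  move=> s /=; rewrite in_itv/= => sab; apply: contrapT => Ms; apply: h.
  by exists s => // /ZM.
rewrite M0 lebesgue_measure_itv/= lte_fin ab -EFinB lee_fin.
by rewrite leNgt subr_gt0 ab.
Qed.

Variable u : R -> R -> R.
Variables L M : R.
Hypothesis mu : lebesgue_measurable2 (fun p => u p.1 p.2).
Hypothesis uL : forall t1 t2 theta : R, `|u t1 theta - u t2 theta| <= L * `|t1 - t2|.
Hypothesis uM : forall t theta : R, `|u t theta| <= M.

Let cvg_lip (x : R) (y : nat -> R) theta : (forall k, `|y k - x| <= k.+1%:R^-1) ->
  u (y k) theta @[k --> \oo] --> u x theta.
Proof.
move=> yx; have Lyx k : `|u (y k) theta - u x theta| <= `|L| * k.+1%:R^-1.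
  rewrite (le_trans (uL _ _ _))// (@le_trans _ _ (`|L| * `|y k - x|))//.
    by rewrite ler_wpM2r// ler_norm.
  by rewrite ler_wpM2l.
apply/cvgrPdist_le => /= e e0; near=> k.
rewrite distrC (le_trans (Lyx k))// (@le_trans _ _ ((`|L| + 1) * k.+1%:R^-1))//.
  by rewrite ler_wpM2r ?invr_ge0// lerDl.
rewrite -ler_pdivlMl; last by rewrite ltr_wpDl.
near: k; have e'0 : 0 < (`|L| + 1)^-1 * e by rewrite mulr_gt0 ?invr_gt0// ltr_wpDl.
have := near_infty_natSinv_lt (PosNum e'0).
by apply: filterS => k /ltW.
Unshelve. all: by end_near. Qed.

(** The exceptional parameters form a null set, so good ones accumulate at every [s]; by the
    Lipschitz bound the slice at [s] is the pointwise limit of good slices. *)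
Lemma slice_measurable s : measurable_fun (setT : set cR) (u s : cR -> R).
Proof.
have [Z Z0 hZ] := ae_slice_measurable mu.
have /(_ _)/cid2-/all_sig2[y sy Zy] (k : nat) : exists2 s', s < s' < s + k.+1%:R^-1 & ~ Z s'.
  by apply: negligible_dense => //; rewrite ltrDl invr_gt0.
apply: (@measurable_fun_cvg _ cR R setT (fun k t => u (y k) t) (u s)).
  by move=> k; exact: hZ.
move=> t _; apply: cvg_lip => k; have /andP[h1 h2] := sy k.
by rewrite ger0_norm ?subr_ge0 ?(ltW h1)// lerBlDl ltW.
Qed.

Lemma slice_bmeas s a b : bmeas a b (u s).
Proof.
split; first exact/measurable_funTS/slice_measurable.
by exists M => t _.
Qed.

(** Joint measurability says nothing on a line of the plane. Freezing the first time on cells of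
    length [1 / k.+1] gives a countable patchwork of measurable slices, which converges pointwise by
    the Lipschitz bound. *)
Lemma oscillating_slice_bmeas (c : R) a b : 0 < c -> bmeas a b (fun t => u t (c * t)).
Proof.
move=> c0; split; last by exists M => t _.
(* Left end of the cell that contains [t]. *)
pose g k (t : R) := a + (Num.trunc ((t - a) * k.+1%:R))%:R / k.+1%:R.
apply: (@measurable_fun_cvg _ cR R _ (fun k t => u (g k t) (c * t))); last first.
  move=> t /=; rewrite in_itv/= => /andP[at_ tb].
  apply: cvg_lip => k; rewrite /g.
  have k0 : 0 < k.+1%:R :> R by [].
  have /truncn_itv/andP[h1 h2] : 0 <= (t - a) * k.+1%:R by rewrite mulr_ge0// subr_ge0.
  rewrite distrC ger0_norm; last by rewrite subr_ge0 -lerBrDl ler_pdivrMr.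
  move: h2; rewrite -[X in _ < X]natr1 -ltr_pdivlMr// mulrDl mul1r => h2.
  by rewrite opprD addrA lerBlDl ltW.
move=> k; pose E (j : nat) : set R :=
  `[a + j%:R / k.+1%:R, a + j.+1%:R / k.+1%:R[%classic `&` `[a, b]%classic.
have mE j : measurable (E j : set cR).
  by apply: borel_completed_measurable; exact: measurableI.
have k0 : 0 < k.+1%:R :> R by [].
have -> : `[a, b]%classic = \bigcup_j E j.
  apply/seteqP; split => [t /=|t [j _ []]//].
  rewrite in_itv/= => /andP[at_ tb]; exists (Num.trunc ((t - a) * k.+1%:R)) => //.
  have /truncn_itv/andP[h1 h2] : 0 <= (t - a) * k.+1%:R by rewrite mulr_ge0// subr_ge0.
  split; rewrite /= in_itv/= ?at_ ?tb//.
  by rewrite -lerBrDl ler_pdivrMr// h1 -ltrBlDl ltr_pdivlMr.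
apply/(measurable_fun_bigcup _ mE) => j.
have mj : measurable_fun (setT : set cR) (fun t => u (a + j%:R / k.+1%:R) (c * t) : R).
  apply: (measurableT_comp (slice_measurable _)).
  have := affine_completed_measurable 0 c0.
  by under eq_fun do rewrite add0r.
apply: (eq_measurable_fun (fun t : cR => u (a + j%:R / k.+1%:R) (c * t) : R)); last first.
  exact: measurable_funTS mj.
move=> t; rewrite inE => -[/=]; rewrite !in_itv/= => /andP[h1 h2] /andP[at_ tb].
rewrite /g; congr (u (_ + _ / _) _); congr (_%:R); apply/esym/truncn_def.
by rewrite -ler_pdivrMr// lerBrDl h1 -ltr_pdivlMr// ltrBlDl h2.
Qed.
End Slices.

(** * Increment bounds, geometric limits and the exponential weight *)

Section Telescoping.
Context {R : realType}.

(* Only K survives refinement of the subdivision: K' may be arbitrarily large,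
   and below it carries the constants that are not uniform in time. *)
Lemma quadratic_increment_bound (phi : R -> R) (a b K K' : R) : a <= b ->
  (forall p q, a <= p -> p <= q -> q <= b ->
     `|phi q - phi p| <= K * (q - p) + K' * (q - p) ^+ 2) ->
  `|phi b - phi a| <= K * (b - a).
Proof.
move=> ab hphi.
have step N : `|phi b - phi a| <= K * (b - a) + `|K'| * (b - a) ^+ 2 / N.+1%:R.
  pose h := (b - a) / N.+1%:R.
  have N0 : N.+1%:R != 0 :> R by rewrite pnatr_eq0.
  have h0 : 0 <= h by rewrite /h divr_ge0 ?subr_ge0.
  have hb k : (k <= N.+1)%N -> a + h *+ k <= b.
    move=> kN; rewrite -lerBrDl -mulr_natr /h mulrAC ler_pdivrMr ?ltr0n//.
    by rewrite ler_wpM2l ?subr_ge0// ler_nat.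
  have ha k : a <= a + h *+ k by rewrite lerDl mulrn_wge0.
  have H k : (k <= N.+1)%N ->
      `|phi (a + h *+ k) - phi a| <= (K * h + `|K'| * h ^+ 2) *+ k.
    elim: k => [|k IH] kN; first by rewrite mulr0n addr0 subrr normr0.
    have hh : a + h *+ k.+1 - (a + h *+ k) = h by rewrite mulrS; ring.
    have kk : a + h *+ k <= a + h *+ k.+1 by rewrite lerD2l mulrS lerDr.
    have := hphi (a + h *+ k) (a + h *+ k.+1) (ha k) kk (hb _ kN); rewrite hh => h1.
    have h2 : K' * h ^+ 2 <= `|K'| * h ^+ 2 by rewrite ler_wpM2r ?sqr_ge0 ?ler_norm.
    have h3 := IH (ltnW kN).
    have h4 := ler_distD (phi (a + h *+ k)) (phi (a + h *+ k.+1)) (phi a).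
    rewrite [leRHS]mulrSr; lra.
  have := H N.+1 (leqnn _).
  have hN : h *+ N.+1 = b - a by rewrite /h -mulr_natr mulfVK.
  rewrite hN [a + _]addrC subrK mulrnDl -mulrnAr hN => /le_trans; apply.
  by rewrite lerD2l -mulrnAr expr2 -mulrnAr hN /h expr2 !mulrA mulrAC lexx.
apply/ler_addgt0Pr => e e0.
pose C := `|K'| * (b - a) ^+ 2.
have C0 : 0 <= C by rewrite mulr_ge0// sqr_ge0.
have [N hN] : exists N : nat, C / e < N.+1%:R.
  exists (Num.trunc (C / e)).
  by have /truncn_itv/andP[] : 0 <= C / e by rewrite divr_ge0// ltW.
apply: le_trans (step N) _; rewrite lerD2l -/C ler_pdivrMr ?ltr0n// mulrC -ler_pdivrMr//.
exact: ltW.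
Qed.

(** Plays the part of the fact that a function with zero derivative is constant, without a pointwise
    derivative: identities involving integrals of merely measurable functions are checked to second
    order on short intervals. *)
Lemma quadratic_increment_eq (phi : R -> R) (a b K : R) : a <= b ->
  (forall p q, a <= p -> p <= q -> q <= b -> `|phi q - phi p| <= K * (q - p) ^+ 2) ->
  phi b = phi a.
Proof.
move=> ab hphi; apply/eqP; rewrite -subr_eq0 -normr_le0 -(mul0r (b - a)).
apply: (quadratic_increment_bound (K' := K)) => // p q ap pq qb.
by rewrite mul0r add0r hphi.
Qed.

(* Gronwall's lemma for horizons so short that the growth factor is 1/2. *)
Lemma half_sup_bound (a b c B : R) (d : R -> R) :
  (forall t, a <= t <= b -> d t <= B) ->
  (forall S, (forall t, a <= t <= b -> d t <= S) ->
     forall t, a <= t <= b -> d t <= c + S / 2) ->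
  forall t, a <= t <= b -> d t <= 2 * c.
Proof.
move=> dB dS t tab.
pose E := [set d s | s in [set s | a <= s <= b]].
have supE : has_sup E.
  by split; [exists (d t), t | exists B => _ [s sab <-]; exact: dB].
have dsup s : a <= s <= b -> d s <= sup E.
  by move=> sab; apply: ub_le_sup; [exact: supE.2 | exists s].
have : sup E <= c + sup E / 2.
  by apply: ge_sup; [exact: supE.1 | move=> _ [s sab <-]; exact: dS].
have := dsup _ tab; lra.
Qed.

(** The intervals of radius [2 * C / 2 ^+ k] around [v k] are nested, so the supremum of their left
    ends belongs to all of them; this gives the limit together with its rate. *)
Lemma geometric_cauchy (v : nat -> R) (C : R) :
  (forall k, `|v k.+1 - v k| <= C / 2 ^+ k) ->
  exists l, forall k, `|l - v k| <= 2 * C / 2 ^+ k.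
Proof.
move=> hv; have C0 : 0 <= C by have := hv 0; rewrite expr0 divr1; apply: le_trans.
pose lo k := v k - 2 * C / 2 ^+ k; pose hi k := v k + 2 * C / 2 ^+ k.
have half k : 2 * C / 2 ^+ k.+1 = C / 2 ^+ k :> R.
  by rewrite exprS; field; rewrite expf_neq0.
have ge0 k : 0 <= C / 2 ^+ k by rewrite divr_ge0// exprn_ge0.
have lo1 k : lo k <= lo k.+1.
  rewrite /lo half -mulrA; have := hv k; rewrite ler_norml => /andP[]; lra.
have hi1 k : hi k.+1 <= hi k.
  rewrite /hi half -mulrA; have := hv k; rewrite ler_norml => /andP[]; lra.
have lohi k : lo k <= hi k by rewrite /lo /hi -mulrA; have := ge0 k; lra.
have loD k j : lo k <= lo (k + j)%N.
  by elim: j => [|j IH]; rewrite ?addn0// addnS (le_trans IH).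
have hiD k j : hi (k + j)%N <= hi k.
  by elim: j => [|j IH]; rewrite ?addn0// addnS (le_trans _ IH).
have lohi2 j k : lo j <= hi k.
  rewrite (le_trans (loD j k))// (le_trans (lohi _))// addnC; exact: hiD.
exists (sup [set lo k | k in [set: nat]]) => k.
have hs : has_sup [set lo k | k in [set: nat]].
  by split; [exists (lo 0), 0 | exists (hi 0) => _ [j _ <-]].
rewrite ler_distl; apply/andP; split.
  by apply: ub_le_sup; [exact: hs.2|exists k].
by apply: ge_sup; [exact: hs.1|move=> _ [j _ <-]; exact: lohi2].
Qed.

End Telescoping.

Section ExpWeight.
Context {R : realType}.

Lemma expR_lip (x y : R) : x <= y -> expR y - expR x <= expR y * (y - x).
Proof.
move=> xy; have := expR_ge1Dx (x - y); have := expR_gt0 y => y0 h.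
have : expR y * (1 + (x - y)) <= expR y * expR (x - y) by rewrite ler_pM2l.
by rewrite -expRD [y + (x - y)]addrC subrK; lra.
Qed.

(** The factor [1 / c] bounds the integral operator in the norm weighted by this exponential; a
    large [c] makes Picard iteration contract on an unbounded half-line. *)
Lemma leb_int_expR (a c t : R) : 0 < c -> a <= t ->
  leb_int a t (fun s => expR (c * (s - a))) <= expR (c * (t - a)) / c.
Proof.
move=> c0 at_; pose E s := expR (c * (s - a)).
have E0 s : 0 <= E s by exact: expR_ge0.
have mono p q : p <= q -> E p <= E q.
  by move=> pq; rewrite ler_expR ler_wpM2l ?lerD2r// ltW.
have lip p q : p <= q -> E q - E p <= E q * (c * (q - p)).
  move=> pq; have /expR_lip/le_trans : c * (p - a) <= c * (q - a).
    by rewrite ler_wpM2l ?lerD2r// ltW.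
  apply; rewrite /E le_eqVlt; apply/orP; left; apply/eqP; ring.
have lip' p q : p <= q -> expR (c * (p - a)) * (c * (q - p)) <= E q - E p.
  move=> pq; have h := expR_ge1Dx (c * (q - p)).
  have : E p * (1 + c * (q - p)) <= E p * expR (c * (q - p)) by rewrite ler_wpM2l.
  have -> : E p * expR (c * (q - p)) = E q by rewrite -expRD; congr expR; ring.
  rewrite /E; lra.
have mE x y : bmeas x y E.
  apply: (bmeas_lip (L := E y * c)) => p q xp pq qy.
  rewrite ger0_norm ?subr_ge0 ?mono// (le_trans (lip _ _ pq))// -mulrA.
  by rewrite ler_wpM2r ?mono// mulr_ge0 ?subr_ge0// ltW.
pose phi s := E s / c - leb_int a s E.
suff : phi t = phi a.
  rewrite /phi leb_int_point subr0 => h; have : 0 <= E a / c by rewrite divr_ge0// ltW.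
  by move: h; rewrite /E; lra.
apply: (@quadratic_increment_eq _ _ _ _ (E t * c)) => // p q ap pq qt.
rewrite /phi (@leb_int_chasles _ a p q)//.
rewrite [X in `|X|](_ : _ = (E q - E p) / c - leb_int p q E); last by ring.
have h1 : leb_int p q E <= E q * (q - p).
  rewrite -leb_int_cst//; apply: le_leb_int => //; first exact: bmeas_cst.
  by move=> s /andP[_ sq]; rewrite mono.
have h2 : E p * (q - p) <= leb_int p q E.
  rewrite -leb_int_cst//; apply: le_leb_int => //; first exact: bmeas_cst.
  by move=> s /andP[sq _]; rewrite mono.
have h3 : (E q - E p) / c <= E q * (q - p).
  by rewrite ler_pdivrMr// -mulrA [_ * c]mulrC lip.
have h4 : E p * (q - p) <= (E q - E p) / c.
  by rewrite ler_pdivlMr// -mulrA [_ * c]mulrC lip'.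
have h5 : (E q - E p) * (q - p) <= E t * c * (q - p) ^+ 2.
  rewrite expr2 mulrA ler_wpM2r ?subr_ge0// (le_trans (lip _ _ pq))// mulrA.
  by rewrite ler_wpM2r ?subr_ge0// ler_wpM2r ?mono// ltW.
by rewrite ler_norml; apply/andP; split; lra.
Qed.

End ExpWeight.

(** * Vector integrals and Picard iteration *)

Section RowNorm.
Context {R : realType} {n : nat}.
Implicit Types v w : 'rV[R]_n.

Lemma row_norm_le v (c : R) : 0 <= c -> (forall k, `|v 0 k| <= c) -> `|v| <= c.
Proof.
move=> c0 vc; rewrite [leLHS]/Num.Def.normr/= mx_normrE.
by apply: bigmax_le => // -[i k] _ /=; rewrite ord1.
Qed.

Lemma row_entry_norm_le v k : `|v 0 k| <= `|v|.
Proof.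
rewrite [leRHS]/Num.Def.normr/= mx_normrE.
by apply: (le_bigmax _ (fun ij : 'I_1 * 'I_n => `|v ij.1 ij.2|) (0, k)).
Qed.

End RowNorm.

Section VectorIntegral.
Context {R : realType} {n : nat}.
Implicit Types (a b c t : R) (f g : R -> 'rV[R]_n).

Definition vmeas a b f := forall k : 'I_n, bmeas a b (fun s => f s 0 k).
Definition vint a b f : 'rV[R]_n := \row_(k < n) leb_int a b (fun s => f s 0 k).

Lemma vmeasD a b f g : vmeas a b f -> vmeas a b g -> vmeas a b (fun s => f s + g s).
Proof.
move=> mf mg k; apply: (bmeas_eq (f := fun s => f s 0 k + g s 0 k)).
  by move=> t _; rewrite mxE.
by apply: bmeasD; [exact: mf | exact: mg].
Qed.

Lemma vmeasB a b f g : vmeas a b f -> vmeas a b g -> vmeas a b (fun s => f s - g s).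
Proof.
move=> mf mg k; apply: (bmeas_eq (f := fun s => f s 0 k - g s 0 k)).
  by move=> t _; rewrite !mxE.
by apply: bmeasB; [exact: mf | exact: mg].
Qed.

Lemma vmeasZ a b (h : R -> R) f : bmeas a b h -> vmeas a b f ->
  vmeas a b (fun s => h s *: f s).
Proof.
move=> mh mf k; apply: (bmeas_eq (f := fun s => h s * f s 0 k)).
  by move=> t _; rewrite mxE.
by apply: bmeasM; [exact: mh | exact: mf].
Qed.

Lemma vmeas_cst a b v : vmeas a b (fun=> v).
Proof. by move=> k; exact: bmeas_cst. Qed.

Lemma vmeas_sum a b (I : Type) (r : seq I) (P : pred I) (F : I -> R -> 'rV[R]_n) :
  (forall i, vmeas a b (F i)) -> vmeas a b (fun s => \sum_(i <- r | P i) F i s).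
Proof.
move=> mF k; apply: (bmeas_eq (f := fun s => \sum_(i <- r | P i) F i s 0 k)).
  by move=> t _; rewrite summxE.
by apply: bmeas_sum => i; exact: mF.
Qed.

Lemma vmeas_sub a b a' b' f : a <= a' -> b' <= b -> vmeas a b f -> vmeas a' b' f.
Proof. by move=> aa' bb' mf k; apply: bmeas_sub (mf k). Qed.

Lemma vmeas_eq a b f g : (forall t, a <= t <= b -> f t = g t) ->
  vmeas a b f -> vmeas a b g.
Proof. by move=> fg mf k; apply: bmeas_eq (mf k) => t /fg ->. Qed.

Lemma vmeas_lip a b f (L : R) :
  (forall s t, a <= s -> s <= t -> t <= b -> `|f t - f s| <= L * (t - s)) ->
  vmeas a b f.
Proof.
move=> fL k; apply: (bmeas_lip (L := L)) => s t as_ st tb.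
apply: le_trans (fL _ _ as_ st tb).
by have := row_entry_norm_le (f t - f s) k; rewrite !mxE.
Qed.

Lemma eq_vint a b f g : (forall t, a <= t <= b -> f t = g t) ->
  vint a b f = vint a b g.
Proof.
by move=> fg; apply/rowP => k; rewrite !mxE; apply: eq_leb_int => t /fg ->.
Qed.

Lemma vintD a b f g : vmeas a b f -> vmeas a b g ->
  vint a b (fun t => f t + g t) = vint a b f + vint a b g.
Proof.
move=> mf mg; apply/rowP => k; rewrite !mxE.
rewrite -(leb_intD (mf k) (mg k)); by apply: eq_leb_int => t _; rewrite mxE.
Qed.

Lemma vintB a b f g : vmeas a b f -> vmeas a b g ->
  vint a b (fun t => f t - g t) = vint a b f - vint a b g.
Proof.
move=> mf mg; apply/rowP => k; rewrite !mxE.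
rewrite -(leb_intB (mf k) (mg k)); by apply: eq_leb_int => t _; rewrite !mxE.
Qed.

Lemma vintZ a b c f : vmeas a b f -> vint a b (fun t => c *: f t) = c *: vint a b f.
Proof.
move=> mf; apply/rowP => k; rewrite !mxE.
rewrite -(leb_intZ c (mf k)); by apply: eq_leb_int => t _; rewrite !mxE.
Qed.

Lemma vintZl a b (h : R -> R) v : bmeas a b h ->
  vint a b (fun t => h t *: v) = leb_int a b h *: v.
Proof.
move=> mh; apply/rowP => k; rewrite !mxE mulrC.
rewrite -(leb_intZ (v 0 k) mh); by apply: eq_leb_int => t _; rewrite !mxE mulrC.
Qed.

Lemma vint_cst a b v : a <= b -> vint a b (fun=> v) = (b - a) *: v.
Proof.
by move=> ab; apply/rowP => k; rewrite !mxE leb_int_cst// mulrC.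
Qed.

Lemma vint_sum a b (I : Type) (r : seq I) (P : pred I) (F : I -> R -> 'rV[R]_n) :
  a <= b -> (forall i, vmeas a b (F i)) ->
  vint a b (fun t => \sum_(i <- r | P i) F i t) = \sum_(i <- r | P i) vint a b (F i).
Proof.
move=> ab mF; apply/rowP => k; rewrite summxE.
under [RHS]eq_bigr do rewrite mxE.
rewrite -(leb_int_sum _ _ ab); last by move=> i; exact: mF.
by rewrite mxE; apply: eq_leb_int => t _; rewrite summxE.
Qed.

Lemma vint_point a f : vint a a f = 0.
Proof. by apply/rowP => k; rewrite !mxE leb_int_point. Qed.

Lemma vint_chasles a c b f : a <= c -> c <= b -> vmeas a b f ->
  vint a b f = vint a c f + vint c b f.
Proof.
by move=> ac cb mf; apply/rowP => k; rewrite !mxE; exact: leb_int_chasles.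
Qed.

(** For the sup norm of rows the inequality holds coordinate by coordinate, without a dimensional
    constant. *)
Lemma norm_vint_le a b f (G : R -> R) : a <= b -> vmeas a b f -> bmeas a b G ->
  (forall t, a <= t <= b -> `|f t| <= G t) -> `|vint a b f| <= leb_int a b G.
Proof.
move=> ab mf mG fG; apply: row_norm_le.
  have := leb_int_cst 0 ab; rewrite mul0r => <-.
  apply: le_leb_int => //; first exact: bmeas_cst.
  by move=> t /fG; apply: le_trans.
move=> k; rewrite mxE; apply: norm_leb_int_le => // t tab.
by apply: le_trans (fG _ tab); exact: row_entry_norm_le.
Qed.

Lemma norm_vint_cst a b f M : a <= b -> vmeas a b f ->
  (forall t, a <= t <= b -> `|f t| <= M) -> `|vint a b f| <= M * (b - a).
Proof.
move=> ab mf fM; rewrite -leb_int_cst//.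
by apply: norm_vint_le => //; exact: bmeas_cst.
Qed.

Lemma vmeas_affine s c a b f : 0 < c -> vmeas (s + c * a) (s + c * b) f ->
  vmeas a b (fun t => f (s + c * t)).
Proof. by move=> c0 mf k; apply: (bmeas_affine c0 (mf k)). Qed.

Lemma vint_affine s c a b f : 0 < c -> a <= b -> vmeas (s + c * a) (s + c * b) f ->
  vint (s + c * a) (s + c * b) f = c *: vint a b (fun t => f (s + c * t)).
Proof.
by move=> c0 ab mf; apply/rowP => k; rewrite !mxE (leb_int_affine c0 ab (mf k)).
Qed.

End VectorIntegral.

Section Picard.
Context {R : realType} {n : nat}.
Variables (f : R -> 'rV[R]_n -> 'rV[R]_n) (a V L : R).
Hypothesis L0 : 0 < L.
Hypothesis fV : forall t x, `|f t x| <= V.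
Hypothesis fL : forall t x y, `|f t x - f t y| <= L * `|x - y|.
(** Measurability is asked only along [V]-Lipschitz curves: since [V] bounds the field, all the
    iterates and their limit are of this kind. *)
Hypothesis mf : forall (y : R -> 'rV[R]_n) b,
  (forall s t, a <= s -> s <= t -> `|y t - y s| <= V * (t - s)) ->
  vmeas a b (fun s => f s (y s)).
Variable x0 : 'rV[R]_n.

Let V0 : 0 <= V. Proof. exact: le_trans (fV a 0). Qed.

Fixpoint picard_iter (k : nat) (t : R) : 'rV[R]_n :=
  if k is k'.+1 then x0 + vint a t (fun s => f s (picard_iter k' s)) else x0.

Let iter_lip (k : nat) (s t : R) : a <= s -> s <= t ->
  `|picard_iter k t - picard_iter k s| <= V * (t - s).
Proof.
elim: k s t => [|k IH] s t as_ st /=; first by rewrite subrr normr0 mulr_ge0// subr_ge0.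
rewrite (vint_chasles as_ st); last exact: mf.
rewrite [X in `|X|](_ : _ = vint s t (fun s => f s (picard_iter k s))).
  apply: (norm_vint_cst st); last by move=> r _; exact: fV.
  by apply: (vmeas_sub as_ (lexx t)); exact: (mf _ IH).
by rewrite opprD addrACA subrr add0r addrAC subrr add0r.
Qed.

(* In the norm weighted by 1 / W the Picard iteration contracts by 1/2. *)
Let W t := expR (2 * L * (t - a)).

Let W_bmeas x y : bmeas x y W.
Proof.
have L20 : 0 <= 2 * L by rewrite mulr_ge0// ltW.
apply: (bmeas_lip (L := W y * (2 * L))) => p q xp pq qy.
have h : 2 * L * (p - a) <= 2 * L * (q - a) by rewrite ler_wpM2l ?lerD2r.
rewrite ger0_norm ?subr_ge0 ?ler_expR//; apply: le_trans (expR_lip h) _.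
rewrite (_ : 2 * L * (q - a) - 2 * L * (p - a) = 2 * L * (q - p)); last by ring.
rewrite mulrA ler_wpM2r ?subr_ge0// ler_wpM2r// ler_expR ler_wpM2l// lerD2r//.
Qed.

Let iter_step k t : a <= t ->
  `|picard_iter k.+1 t - picard_iter k t| <= V / (2 * L) / 2 ^+ k * W t.
Proof.
have L20 : 0 < 2 * L by rewrite mulr_gt0.
elim: k t => [|k IH] t at_.
  rewrite /= addrC addKr; apply: le_trans (norm_vint_cst at_ (M := V) _ _) _.
  - exact: (mf _ (iter_lip 0)).
  - by move=> s _; exact: fV.
  rewrite expr0 divr1 -mulrA ler_wpM2l// ler_pdivlMl// .
  by have := expR_ge1Dx (2 * L * (t - a)); rewrite /W; lra.
have -> : picard_iter k.+2 t - picard_iter k.+1 t =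
    vint a t (fun s => f s (picard_iter k.+1 s) - f s (picard_iter k s)).
  rewrite vintB; [|exact: (mf _ (iter_lip k.+1))|exact: (mf _ (iter_lip k))].
  by rewrite /= opprD addrACA subrr add0r.
pose c := L * (V / (2 * L) / 2 ^+ k).
have c0 : 0 <= c.
  by apply: mulr_ge0; [exact: ltW|]; apply: divr_ge0; [apply: divr_ge0; [exact: V0|exact: ltW]|exact: exprn_ge0].
have cW : bmeas a t (fun s => c * W s).
  by apply: bmeasM; [exact: bmeas_cst|exact: W_bmeas].
apply: le_trans (norm_vint_le at_ _ cW _) _.
- by apply: vmeasB; [exact: (mf _ (iter_lip k.+1))|exact: (mf _ (iter_lip k))].
- move=> s /andP[as_ _]; apply: le_trans (fL _ _ _) _.
  by rewrite /c -[leRHS]mulrA; apply: ler_wpM2l; [exact: ltW|exact: IH].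
rewrite leb_intZ// (le_trans (ler_wpM2l c0 (leb_int_expR L20 at_)))//.
rewrite /c le_eqVlt; apply/orP; left; apply/eqP; rewrite /W exprS; field.
by rewrite (gt_eqF L0) andbT expf_neq0.
Qed.

Lemma picard : exists2 x : R -> 'rV[R]_n,
  (forall s t, a <= s -> s <= t -> `|x t - x s| <= V * (t - s)) &
  forall t, a <= t -> x t = x0 + vint a t (fun s => f s (x s)).
Proof.
pose C t := V / (2 * L) * W t.
have stepC t k i : a <= t ->
    `|picard_iter k.+1 t 0 i - picard_iter k t 0 i| <= C t / 2 ^+ k.
  move=> at_; apply: le_trans (le_trans (iter_step k at_) _); last by rewrite /C mulrAC.
  by have := row_entry_norm_le (picard_iter k.+1 t - picard_iter k t) i; rewrite !mxE.
(* The bound is conditional on [a <= t] so that a value can be chosen at every time; before [a] it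
   is arbitrary. *)
have lim t i : exists l : R, a <= t -> forall k,
    `|l - picard_iter k t 0 i| <= 2 * C t / 2 ^+ k.
  have [at_|_] := boolP (a <= t); last by exists 0.
  have [l hl] := geometric_cauchy (fun k => stepC t k i at_).
  by exists l.
pose x t : 'rV[R]_n := \row_i projT1 (cid (lim t i)).
have C0 t : 0 <= C t.
  by apply: mulr_ge0; [apply: divr_ge0; [exact: V0|apply: mulr_ge0; [by []|exact: ltW]]|exact: expR_ge0].
have xk t k : a <= t -> `|x t - picard_iter k t| <= 2 * C t / 2 ^+ k.
  move=> at_; apply: row_norm_le.
    by apply: divr_ge0; [exact: mulr_ge0|exact: exprn_ge0].
  by move=> i; rewrite !mxE; case: cid => l /= /(_ at_).
have small (y : R) (B : R) : 0 <= B -> (forall k, y <= B / 2 ^+ k) -> y <= 0.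
  move=> B0 hy; rewrite leNgt; apply/negP => y0.
  pose k := Num.trunc (B / y).
  have /truncn_itv/andP[_ hk] : 0 <= B / y by rewrite divr_ge0// ltW.
  have := hy k.+1; rewrite ler_pdivlMr ?exprn_gt0// leNgt => /negP; apply.
  move: hk; rewrite ltr_pdivrMr// => /lt_trans; apply; rewrite mulrC ltr_pM2l//.
  by rewrite -natrX ltr_nat ltn_expl.
have xlip s t : a <= s -> s <= t -> `|x t - x s| <= V * (t - s).
  move=> as_ st; rewrite -subr_le0.
  apply: (small _ (2 * C t + 2 * C s)); first by rewrite addr_ge0// mulr_ge0.
  move=> k; have h1 := xk t k (le_trans as_ st); have h2 := xk s k as_.
  have h3 := iter_lip k as_ st.
  have -> : x t - x s = (x t - picard_iter k t) + (picard_iter k t - picard_iter k s)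
     - (x s - picard_iter k s) by rewrite addrA subrK opprB addrA subrK.
  rewrite mulrDl; have h4 := ler_normB (x t - picard_iter k t + (picard_iter k t - picard_iter k s)) (x s - picard_iter k s).
  have h5 := ler_normD (x t - picard_iter k t) (picard_iter k t - picard_iter k s).
  lra.
exists x => // t at_; apply/eqP; rewrite -subr_eq0 -normr_le0.
apply: (small _ (2 * C t + L * (2 * C t) * (t - a))).
  apply: addr_ge0; first exact: mulr_ge0.
  apply: mulr_ge0; last by rewrite subr_ge0.
  by apply: mulr_ge0; [exact: ltW|exact: mulr_ge0].
move=> k; have h1 := xk t k.+1 at_.
set I := vint a t _.
have h2 : `|picard_iter k.+1 t - (x0 + I)| <= L * (2 * C t / 2 ^+ k) * (t - a).
  rewrite /= opprD addrACA subrr add0r -vintB; [|exact: (mf _ (iter_lip k))|exact: (mf _ xlip)].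
  apply: (norm_vint_cst at_).
    by apply: vmeasB; [exact: (mf _ (iter_lip k))|exact: (mf _ xlip)].
  move=> s /andP[as_ st]; apply: le_trans (fL _ _ _) _; rewrite ler_wpM2l ?(ltW L0)//.
  rewrite distrC (le_trans (xk _ _ as_))// ler_wpM2r ?invr_ge0 ?exprn_ge0//.
  have V20 : 0 <= V / (2 * L).
    by apply: divr_ge0; [exact: V0|apply: mulr_ge0; [|exact: ltW]].
  apply: ler_wpM2l => //; apply: ler_wpM2l => //; rewrite ler_expR.
  by apply: ler_wpM2l; [apply: mulr_ge0; [|exact: ltW]|rewrite lerD2r].
have h3 := ler_distD (picard_iter k.+1 t) (x t) (x0 + I).
have h4 : 2 * C t / 2 ^+ k.+1 <= 2 * C t / 2 ^+ k.
  apply: ler_wpM2l; first exact: mulr_ge0.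
  by rewrite lef_pV2 ?posrE ?exprn_gt0// ler_weXn2l// ler1n.
have -> : (2 * C t + L * (2 * C t) * (t - a)) / 2 ^+ k =
   2 * C t / 2 ^+ k + L * (2 * C t / 2 ^+ k) * (t - a) by ring.
by apply: le_trans h3 _; apply: lerD; [exact: le_trans h4|].
Qed.

End Picard.

Section VectorIncrements.
Context {R : realType} {n : nat}.

Lemma norm_sum_ord_le m (V : normedModType R) (F : 'I_m -> V) (c : R) :
  (forall i, `|F i| <= c) -> `|\sum_(i < m) F i| <= m%:R * c.
Proof.
move=> Fc; apply: le_trans (ler_norm_sum _ _ _) _.
by apply: le_trans (ler_sum _ (fun i _ => Fc i)) _; rewrite sumr_const card_ord mulr_natl.
Qed.

Lemma vector_increment_bound (phi : R -> 'rV[R]_n) (a b K K' : R) :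
  0 <= K -> a <= b ->
  (forall p q, a <= p -> p <= q -> q <= b ->
     `|phi q - phi p| <= K * (q - p) + K' * (q - p) ^+ 2) ->
  `|phi b - phi a| <= K * (b - a).
Proof.
move=> K0 ab hphi; apply: row_norm_le; first by rewrite mulr_ge0// subr_ge0.
move=> k; rewrite !mxE.
apply: (quadratic_increment_bound (phi := fun t => phi t 0 k) (K' := K')) => // p q ap pq qb.
apply: le_trans (hphi p q ap pq qb).
by have := row_entry_norm_le (phi q - phi p) k; rewrite !mxE.
Qed.

Lemma vector_increment_eq (phi : R -> 'rV[R]_n) (a b K : R) : a <= b ->
  (forall p q, a <= p -> p <= q -> q <= b ->
     `|phi q - phi p| <= K * (q - p) ^+ 2) ->
  phi b = phi a.
Proof.
move=> ab hphi; apply/eqP; rewrite -subr_eq0 -normr_le0 -(mul0r (b - a)).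
apply: (vector_increment_bound (K' := K)) => // p q ap pq qb.
by rewrite mul0r add0r hphi.
Qed.

Lemma linear_row_expand (D : {linear 'rV[R]_n -> 'rV[R]_n}) (v : 'rV[R]_n) :
  D v = \sum_(k < n) v 0 k *: D (delta_mx 0 k).
Proof.
by rewrite {1}(row_sum_delta v) linear_sum; apply: eq_bigr => k _; rewrite linearZ.
Qed.

Lemma vint_linear (D : {linear 'rV[R]_n -> 'rV[R]_n}) (a b : R) (f : R -> 'rV[R]_n) :
  a <= b -> vmeas a b f -> vint a b (fun t => D (f t)) = D (vint a b f).
Proof.
move=> ab mf; rewrite linear_row_expand.
rewrite (eq_vint (g := fun t => \sum_(k < n) f t 0 k *: D (delta_mx 0 k))); last first.
  by move=> t _; rewrite linear_row_expand.
rewrite vint_sum//; last by move=> k; apply: vmeasZ; [exact: mf|exact: vmeas_cst].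
by apply: eq_bigr => k _; rewrite vintZl ?mxE//; exact: mf.
Qed.

(** Coordinatewise retraction onto the sup-norm box. Being 1-Lipschitz, it turns a field that is
    bounded and Lipschitz on the box into one that is so globally. *)
Definition clamp (rho : R) (x : 'rV[R]_n) : 'rV[R]_n :=
  \row_k Num.max (- rho) (Num.min (x 0 k) rho).

Lemma clamp_norm rho x : 0 <= rho -> `|clamp rho x| <= rho.
Proof.
move=> r0; apply: row_norm_le => // k; rewrite mxE ler_norml.
by rewrite le_max lexx/= ge_max ge_min lexx orbT andbT; lra.
Qed.

Lemma clamp_id rho x : `|x| <= rho -> clamp rho x = x.
Proof.
move=> xr; apply/rowP => k; rewrite mxE.
have := le_trans (row_entry_norm_le x k) xr; rewrite ler_norml => /andP[h1 h2].
by rewrite (min_idPl h2) (max_idPr h1).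
Qed.

Lemma clamp_lip rho x y : 0 <= rho -> `|clamp rho x - clamp rho y| <= `|x - y|.
Proof.
move=> r0; apply: row_norm_le => // k; rewrite !mxE.
apply: le_trans (row_entry_norm_le (x - y) k); rewrite !mxE.
wlog xy : x y / x 0 k <= y 0 k.
  move=> h; have [|/ltW] := leP (x 0 k) (y 0 k); first exact: h.
  by move=> /h; rewrite distrC [X in _ <= X -> _]distrC.
rewrite [leRHS]distrC [leLHS]distrC [leRHS]ger0_norm ?subr_ge0// ler_norml.
move: xy; set p := x 0 k; set q := y 0 k => pq.
by case: (leP p rho) => ?; case: (leP q rho) => ?; case: (leP (- rho) p) => ?;
   case: (leP (- rho) q) => ?; case: (leP (- rho) rho) => ?; apply/andP; split; lra.
Qed.

End VectorIncrements.

(** * Displacement of a frozen loop *)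

Section FrozenFlow.
Context {R : realType} {n m : nat}.
Variables (beta : 'I_m -> 'rV[R]_n -> 'rV[R]_n)
  (D : 'I_m -> 'rV[R]_n -> {linear 'rV[R]_n -> 'rV[R]_n})
  (v : 'I_m -> R -> R) (T rho M A A' Ks : R).
Hypotheses (T0 : 0 < T) (M0 : 0 <= M) (A0 : 0 <= A) (A'0 : 0 <= A')
  (Ks0 : 0 <= Ks) (rho1 : 1 <= rho).
Hypothesis v_bmeas : forall i a b, bmeas a b (v i).
Hypothesis v_bound : forall i t, `|v i t| <= M.
Hypothesis v_mean0 : forall i, leb_int 0 T (v i) = 0.
Hypothesis beta_bound : forall i x, `|x| <= rho -> `|beta i x| <= A.
Hypothesis D_bound : forall i x w, `|x| <= rho -> `|D i x w| <= A * `|w|.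
Hypothesis beta_lip : forall i x y, `|x| <= rho -> `|y| <= rho ->
  `|beta i x - beta i y| <= A * `|x - y|.
(* Ks bounds second derivatives at a frozen time; it is absent from the constant
   of [frozen_displacement]. *)
Hypothesis beta_taylor : forall i x y, `|x| <= rho -> `|y| <= rho ->
  `|beta i y - beta i x - D i x (y - x)| <= Ks * `|y - x| ^+ 2.
Hypothesis D_lip : forall i x y w, `|x| <= rho -> `|y| <= rho ->
  `|D i x w - D i y w| <= Ks * `|x - y| * `|w|.

(** The Lie bracket of [beta l] and [beta i], in this order, [D i x] standing for the derivative of
    [beta i] at [x]. *)
Definition frozen_bracket (l i : 'I_m) (x : 'rV[R]_n) : 'rV[R]_n :=
  D i x (beta l x) - D l x (beta i x).

Hypothesis bracket_lip : forall l i x y, `|x| <= rho -> `|y| <= rho ->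
  `|frozen_bracket l i x - frozen_bracket l i y| <= A' * `|x - y|.

Definition frozen_field (t : R) (x : 'rV[R]_n) := \sum_(i < m) v i t *: beta i x.
Definition frozen_primitive (i : 'I_m) (t : R) := leb_int 0 t (v i).

Local Notation F := frozen_field.
Local Notation U := frozen_primitive.
Local Notation N := (m%:R * (M * A)).
(** [Y] is the main part of the derivative of the loop in its amplitude [p], [DF] and [DY] are the
    derivatives of [F] and [Y] in [x], and [p *: G] is the source of the equation for the
    remainder. *)
Let DF t x w := \sum_(i < m) v i t *: D i x w.
Let Y t x := \sum_(i < m) U i t *: beta i x.
Let DY t x w := \sum_(i < m) U i t *: D i x w.
Let G t x := DF t x (Y t x) - DY t x (F t x).

Let N0 : 0 <= N. Proof. by rewrite !mulr_ge0. Qed.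
Let T00 : 0 <= T. Proof. exact: ltW. Qed.

Let sum_scale_le (c : 'I_m -> R) (z : 'I_m -> 'rV[R]_n) (B C : R) :
  0 <= B -> (forall i, `|c i| <= B) -> (forall i, `|z i| <= C) ->
  `|\sum_(i < m) c i *: z i| <= m%:R * (B * C).
Proof.
move=> B0 cB zC; apply: norm_sum_ord_le => i.
by rewrite normrZ ler_pM.
Qed.

Lemma frozen_field_bound t x : `|x| <= rho -> `|F t x| <= N.
Proof. by move=> xr; apply: sum_scale_le => // i; exact: beta_bound. Qed.

Lemma frozen_field_lip t x y : `|x| <= rho -> `|y| <= rho ->
  `|F t x - F t y| <= N * `|x - y|.
Proof.
move=> xr yr; rewrite /F -sumrB -!mulrA.
under eq_bigr do rewrite -scalerBr.
by apply: sum_scale_le => // i; exact: beta_lip.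
Qed.

Let DF_bound t x w : `|x| <= rho -> `|DF t x w| <= N * `|w|.
Proof.
move=> xr; rewrite /DF -!mulrA; apply: sum_scale_le => // i; exact: D_bound.
Qed.

Let F_taylor t x y : `|x| <= rho -> `|y| <= rho ->
  `|F t y - F t x - DF t x (y - x)| <= m%:R * (M * Ks) * `|y - x| ^+ 2.
Proof.
move=> xr yr; rewrite /F /DF -!sumrB -!mulrA.
under eq_bigr do rewrite -!scalerBr.
by apply: sum_scale_le => // i; exact: beta_taylor.
Qed.

Let U_bound i t : 0 <= t <= T -> `|U i t| <= T * M.
Proof.
move=> /andP[t0 tT]; apply: le_trans (norm_leb_int_cst t0 (v_bmeas i 0 t) (M := M) _) _.
  by move=> s _; exact: v_bound.
by rewrite subr0 mulrC ler_wpM2r.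
Qed.

Let TM0 : 0 <= T * M. Proof. exact: mulr_ge0. Qed.

Let TNE : T * N = m%:R * (T * M * A). Proof. ring. Qed.

Let Y_bound t x : 0 <= t <= T -> `|x| <= rho -> `|Y t x| <= T * N.
Proof.
move=> tT xr; rewrite TNE; apply: sum_scale_le => // i.
  exact: U_bound.
exact: beta_bound.
Qed.

Let DY_bound t x w : 0 <= t <= T -> `|x| <= rho -> `|DY t x w| <= T * N * `|w|.
Proof.
move=> tT xr; rewrite TNE -!mulrA (mulrA T); apply: sum_scale_le => // i.
  exact: U_bound.
exact: D_bound.
Qed.

Let G_bound t x : 0 <= t <= T -> `|x| <= rho -> `|G t x| <= 2 * T * N ^+ 2.
Proof.
move=> tT xr; apply: le_trans (ler_normB _ _) _.
have h1 : `|DF t x (Y t x)| <= N * (T * N).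
  by apply: le_trans (DF_bound _ _ xr) _; rewrite ler_wpM2l// Y_bound.
have h2 : `|DY t x (F t x)| <= T * N * N.
  apply: le_trans (DY_bound _ tT xr) _; apply: ler_wpM2l; first exact: mulr_ge0.
  exact: frozen_field_bound.
by apply: le_trans (lerD h1 h2) _; rewrite le_eqVlt; apply/orP; left; apply/eqP; ring.
Qed.

(** Exchanging the indices in the second double sum pairs [D i (beta l)] with [D l (beta i)]. The
    Lipschitz constant of [G] in [x] is then governed by that of the brackets, and [Ks] stays out of
    it. *)
Let G_expand t x :
  G t x = \sum_(i < m) \sum_(l < m) (v i t * U l t) *: frozen_bracket l i x.
Proof.
rewrite /G /DF /Y /DY /F.
have -> : \sum_(i < m) v i t *: D i x (\sum_(l < m) U l t *: beta l x) =
    \sum_(i < m) \sum_(l < m) (v i t * U l t) *: D i x (beta l x).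
  apply: eq_bigr => i _; rewrite linear_sum scaler_sumr; apply: eq_bigr => l _.
  by rewrite linearZ scalerA.
have -> : \sum_(i < m) U i t *: D i x (\sum_(l < m) v l t *: beta l x) =
    \sum_(i < m) \sum_(l < m) (v i t * U l t) *: D l x (beta i x).
  rewrite exchange_big /=; apply: eq_bigr => i _.
  rewrite linear_sum scaler_sumr; apply: eq_bigr => l _.
  by rewrite linearZ scalerA mulrC.
rewrite -sumrB; apply: eq_bigr => i _; rewrite -sumrB; apply: eq_bigr => l _.
by rewrite -scalerBr.
Qed.

Let G_lip t x y : 0 <= t <= T -> `|x| <= rho -> `|y| <= rho ->
  `|G t x - G t y| <= m%:R * (m%:R * (M * (T * M) * (A' * `|x - y|))).
Proof.
move=> tT xr yr; rewrite !G_expand -sumrB.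
apply: norm_sum_ord_le => i; rewrite -sumrB.
under eq_bigr do rewrite -scalerBr.
apply: sum_scale_le => [|l|l]; first exact: mulr_ge0.
- by rewrite normrM ler_pM// U_bound.
- exact: bracket_lip.
Qed.

Let lip_on a b (w : R -> 'rV[R]_n) C :=
  forall s t, a <= s -> s <= t -> t <= b -> `|w t - w s| <= C * (t - s).
Let boxed a b (w : R -> 'rV[R]_n) := forall t, a <= t <= b -> `|w t| <= rho.

Let beta_vmeas i a b w C : boxed a b w -> lip_on a b w C ->
  vmeas a b (fun s => beta i (w s)).
Proof.
move=> wr wC; apply: (vmeas_lip (L := A * C)) => s t as_ st tb.
have h1 := wr s; have h2 := wr t.
apply: le_trans (beta_lip i (h2 _) (h1 _)) _.
- by rewrite tb (le_trans as_).
- by rewrite as_ (le_trans st).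
- by rewrite -mulrA ler_wpM2l// wC.
Qed.

Lemma frozen_field_vmeas a b w C : boxed a b w -> lip_on a b w C ->
  vmeas a b (fun s => F s (w s)).
Proof.
move=> wr wC; apply: vmeas_sum => i; apply: vmeasZ; first exact: v_bmeas.
exact: beta_vmeas wC.
Qed.

Let D_vmeas i a b w C z : boxed a b w -> lip_on a b w C -> vmeas a b z ->
  vmeas a b (fun s => D i (w s) (z s)).
Proof.
move=> wr wC mz.
apply: (vmeas_eq (f := fun s => \sum_(k < n) z s 0 k *: D i (w s) (delta_mx 0 k))).
  by move=> t _; rewrite [RHS]linear_row_expand.
apply: vmeas_sum => k; apply: vmeasZ; first exact: mz.
apply: (vmeas_lip (L := Ks * C * `|delta_mx 0 k : 'rV[R]_n|)) => s t as_ st tb.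
apply: le_trans (D_lip i (delta_mx 0 k) (wr _ _) (wr _ _)) _.
- by rewrite tb (le_trans as_).
- by rewrite as_ (le_trans st).
- rewrite [leRHS]mulrAC ler_wpM2r// -mulrA ler_wpM2l// wC//.
Qed.

Let U_bmeas i a b : 0 <= a -> b <= T -> bmeas a b (U i).
Proof.
move=> a0 bT; apply: (bmeas_lip (L := M)) => s t as_ st tb.
rewrite /U (@leb_int_chasles _ 0 s t _ (le_trans a0 as_) st (v_bmeas i 0 t)).
rewrite addrC addKr; apply: norm_leb_int_cst => //.
Qed.

Let DY_vmeas a b w C z : 0 <= a -> b <= T -> boxed a b w -> lip_on a b w C ->
  vmeas a b z -> vmeas a b (fun s => DY s (w s) (z s)).
Proof.
move=> a0 bT wr wC mz; apply: vmeas_sum => i; apply: vmeasZ; first exact: U_bmeas.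
exact: D_vmeas wC mz.
Qed.

Let U_increment i a b : 0 <= a -> a <= b -> U i b - U i a = leb_int a b (v i).
Proof.
move=> a0 ab; rewrite /U (leb_int_chasles a0 ab (v_bmeas i 0 b)).
by rewrite addrC addKr.
Qed.

Let DY_lip a b x y z : 0 <= a -> a <= b -> b <= T -> `|x| <= rho -> `|y| <= rho ->
  `|DY a x z - DY b y z| <=
  m%:R * (M * (b - a) * (A * `|z|)) + m%:R * (T * M * (Ks * `|x - y| * `|z|)).
Proof.
move=> a0 ab bT xr yr.
have -> : DY a x z - DY b y z = \sum_(i < m) (U i a - U i b) *: D i x z +
    \sum_(i < m) U i b *: (D i x z - D i y z).
  rewrite -big_split -sumrB /=; apply: eq_bigr => i _.
  by rewrite scalerBl scalerBr addrA subrK.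
apply: le_trans (ler_normD _ _) _; apply: lerD; apply: sum_scale_le.
- by apply: mulr_ge0; rewrite ?subr_ge0.
- move=> i; rewrite distrC U_increment//; apply: norm_leb_int_cst => //.
- by move=> i; exact: D_bound.
- exact: TM0.
- by move=> i; apply: U_bound; rewrite bT (le_trans a0).
- by move=> i; exact: D_lip.
Qed.

(** Product and chain rule for [U i t *: beta i (w t)], in integrated form. As [v i] is only
    measurable, it is proved by showing that both sides have the same increments up to second
    order. *)
Let Y_increment p w t : 0 <= p -> 0 <= t -> t <= T -> boxed 0 T w ->
  lip_on 0 T w (p * N) ->
  (forall a b, 0 <= a -> a <= b -> b <= T ->
     w b - w a = vint a b (fun r => p *: F r (w r))) ->
  Y t (w t) = vint 0 t (fun r => F r (w r) + DY r (w r) (p *: F r (w r))).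
Proof.
move=> p0 t0 tT wr wL wint.
have pN0 : 0 <= p * N by exact: mulr_ge0.
have mF a b : 0 <= a -> b <= T -> vmeas a b (fun r => F r (w r)).
  move=> a0 bT; apply: (vmeas_sub a0 bT).
  exact: (frozen_field_vmeas wr wL).
have mpF a b : 0 <= a -> b <= T -> vmeas a b (fun r => p *: F r (w r)).
  by move=> a0 bT; apply: vmeasZ; [exact: bmeas_cst|exact: mF].
have mDY a b : 0 <= a -> b <= T -> vmeas a b (fun r => DY r (w r) (p *: F r (w r))).
  move=> a0 bT; apply: (vmeas_sub a0 bT).
  apply: (DY_vmeas (lexx 0) (lexx T) wr wL); exact: (mpF _ _ (lexx 0) (lexx T)).
pose g r := F r (w r) + DY r (w r) (p *: F r (w r)).
have mg a b : 0 <= a -> b <= T -> vmeas a b g.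
  by move=> a0 bT; apply: vmeasD; [exact: mF|exact: mDY].
pose phi s := Y s (w s) - vint 0 s g.
suff : phi t = phi 0.
  rewrite /phi vint_point subr0 {2}/Y big1 => [/eqP|i _].
    by rewrite subr_eq0 => /eqP.
  by rewrite /U leb_int_point scale0r.
pose K := m%:R * (M * A * (p * N)) + (m%:R * (M * (A * (p * N))) +
   m%:R * (T * M * (Ks * (p * N) * (p * N)))).
pose K2 := m%:R * (T * M * (Ks * (p * N) ^+ 2)).
apply: (vector_increment_eq (K := K + K2)) => // a b a0 ab bt.
have bT := le_trans bt tT; have b0 := le_trans a0 ab; have aT := le_trans ab bT.
have ra : `|w a| <= rho by apply: wr; rewrite a0.
have rb : `|w b| <= rho by apply: wr; rewrite b0.
(* The increment of [phi] is the integral of [E], whose integrand is O(b - a), plus the Taylor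
   remainder [rem]; both are therefore quadratic in [b - a]. *)
pose E r := \sum_(i < m) v i r *: (beta i (w b) - beta i (w r)) +
   (DY a (w a) (p *: F r (w r)) - DY r (w r) (p *: F r (w r))).
pose rem := \sum_(i < m) U i a *: (beta i (w b) - beta i (w a) - D i (w a) (w b - w a)).
have mF1 : vmeas a b (fun r => \sum_(i < m) v i r *: beta i (w b)).
  by apply: vmeas_sum => i; apply: vmeasZ; [exact: v_bmeas|exact: vmeas_cst].
have mD1 i : vmeas a b (fun r => D i (w a) (p *: F r (w r))).
  apply: (@D_vmeas i a b (fun=> w a) 0); last exact: mpF.
    by move=> s _.
  by move=> s r _ _ _; rewrite subrr normr0 mul0r.
have mDa : vmeas a b (fun r => DY a (w a) (p *: F r (w r))).
  by apply: vmeas_sum => i; apply: vmeasZ; [exact: bmeas_cst|exact: mD1].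
have -> : phi b - phi a = vint a b E + rem.
  have -> : vint a b E = vint a b (fun r => \sum_(i < m) v i r *: beta i (w b)) +
      vint a b (fun r => DY a (w a) (p *: F r (w r))) - vint a b g.
    rewrite -(vintD mF1 mDa) -vintB; [|by apply: vmeasD|exact: mg].
    apply: eq_vint => r _; rewrite /E /g /F.
    under eq_bigr do rewrite scalerBr.
    rewrite sumrB opprD !addrA; congr (_ - _); rewrite -!addrA; congr (_ + _).
    by rewrite addrC.
  have -> : vint a b (fun r => \sum_(i < m) v i r *: beta i (w b)) =
      \sum_(i < m) (U i b - U i a) *: beta i (w b).
    rewrite (vint_sum _ _ ab); last first.
      by move=> i; apply: vmeasZ; [exact: v_bmeas|exact: vmeas_cst].
    apply: eq_bigr => i _; rewrite vintZl; last exact: v_bmeas.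
    by rewrite (U_increment _ a0 ab).
  have -> : vint a b (fun r => DY a (w a) (p *: F r (w r))) =
      \sum_(i < m) U i a *: D i (w a) (w b - w a).
    rewrite (vint_sum _ _ ab); last first.
      by move=> i; apply: vmeasZ; [exact: bmeas_cst|exact: mD1].
    apply: eq_bigr => i _; rewrite vintZ; last exact: mD1.
    by rewrite (vint_linear _ ab (mpF _ _ a0 bT)) -(wint _ _ a0 ab bT).
  rewrite /phi (vint_chasles a0 ab (mg _ _ (lexx 0) bT)) opprB opprD.
  rewrite /rem /Y.
  have -> : \sum_(i < m) U i a *: (beta i (w b) - beta i (w a) - D i (w a) (w b - w a)) =
     \sum_(i < m) U i a *: beta i (w b) - \sum_(i < m) U i a *: beta i (w a) -
     \sum_(i < m) U i a *: D i (w a) (w b - w a).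
    by rewrite -!sumrB; apply: eq_bigr => i _; rewrite !scalerBr.
  have -> : \sum_(i < m) (U i b - U i a) *: beta i (w b) =
     \sum_(i < m) U i b *: beta i (w b) - \sum_(i < m) U i a *: beta i (w b).
    by rewrite -!sumrB; apply: eq_bigr => i _; rewrite scalerBl.
  set S1 := \sum_(i < m) U i b *: beta i (w b); set S2 := \sum_(i < m) U i a *: beta i (w a).
  set S3 := \sum_(i < m) _ *: D i _ _; set S4 := \sum_(i < m) _ *: beta i (w b).
  by apply/rowP => k; rewrite !mxE; ring.
have ba0 : 0 <= b - a by rewrite subr_ge0.
have hE : `|vint a b E| <= K * (b - a) * (b - a).
  apply: (norm_vint_cst ab).
    apply: vmeasD.
      apply: vmeas_sum => i; apply: vmeasZ; first exact: v_bmeas.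
      apply: vmeasB; first exact: vmeas_cst.
      by apply: (vmeas_sub a0 bT); exact: (beta_vmeas i wr wL).
    by apply: vmeasB; [exact: mDa|exact: mDY].
  move=> r /andP[ar rb']; have r0 := le_trans a0 ar; have rT := le_trans rb' bT.
  have rr : `|w r| <= rho by apply: wr; rewrite r0.
  have zb : `|p *: F r (w r)| <= p * N.
    by rewrite normrZ ger0_norm// ler_wpM2l// frozen_field_bound.
  have wbr : `|w b - w r| <= p * N * (b - a).
    by apply: le_trans (wL _ _ r0 rb' bT) _; rewrite ler_wpM2l// lerD2l lerN2.
  have war : `|w a - w r| <= p * N * (b - a).
    rewrite distrC; apply: le_trans (wL _ _ a0 ar rT) _.
    by rewrite ler_wpM2l// lerD2r.
  apply: le_trans (ler_normD _ _) _.
  rewrite /K mulrDl; apply: lerD.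
    rewrite -!mulrA; apply: sum_scale_le => // i.
    apply: le_trans (beta_lip i rb rr) _; rewrite ler_wpM2l//.
    by move: wbr; rewrite !mulrA.
  apply: le_trans (DY_lip _ a0 ar rT ra rr) _; rewrite mulrDl.
  have ra0 : 0 <= r - a by rewrite subr_ge0.
  have rab : r - a <= b - a by rewrite lerD2r.
  apply: lerD; rewrite -!mulrA (ler_wpM2l (ler0n _ _))//.
    rewrite ler_wpM2l//; apply: le_trans (_ : (b - a) * (A * (p * N)) <= _).
      by apply: ler_pM => //; [exact: mulr_ge0|rewrite ler_wpM2l].
    by rewrite le_eqVlt; apply/orP; left; apply/eqP; ring.
  rewrite ler_wpM2l// ler_wpM2l//.
  apply: le_trans (_ : Ks * (p * N * (b - a) * (p * N)) <= _).
    by rewrite ler_wpM2l//; apply: ler_pM.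
  by rewrite le_eqVlt; apply/orP; left; apply/eqP; ring.
have hrem : `|rem| <= K2 * (b - a) ^+ 2.
  rewrite /K2 -!mulrA (mulrA T); apply: sum_scale_le => //.
    by move=> i; apply: U_bound; rewrite a0.
  move=> i; apply: le_trans (beta_taylor i ra rb) _; rewrite ler_wpM2l//.
  apply: le_trans (_ : (p * N * (b - a)) ^+ 2 <= _); last first.
    by rewrite le_eqVlt; apply/orP; left; apply/eqP; ring.
  apply: lerXn2r; rewrite ?nnegrE//; last exact: wL.
  exact: mulr_ge0.
apply: le_trans (ler_normD _ _) _; rewrite mulrDl; apply: lerD => //.
by rewrite expr2 mulrA.
Qed.

Variables (x0 : 'rV[R]_n) (e : R).
(** [e_small] serves twice: a loop of amplitude at most [e] moves by at most 1/2 and so stays in the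
    box, and it yields the factor 1/2 needed for [half_sup_bound]. *)
Hypotheses (x0_rho : `|x0| <= rho - 1) (e0 : 0 <= e) (e_small : e * (T * N) <= 2^-1).

Definition frozen_solution p w :=
  [/\ boxed 0 T w, lip_on 0 T w (p * N), w 0 = x0 &
   forall a b, 0 <= a -> a <= b -> b <= T ->
     w b - w a = vint a b (fun r => p *: F r (w r))].

(** Picard iteration for the clamped field. On [[0, T]] its solution stays within distance 1 of
    [x0], hence in the box, where the clamp is the identity. *)
Lemma frozen_solution_exists p : 0 <= p -> p <= e -> exists w, frozen_solution p w.
Proof.
move=> p0 pe.
have rho0 : 0 <= rho by apply: le_trans rho1.
have pN0 : 0 <= p * N by exact: mulr_ge0.
have pTN : p * N * T <= 1.
  have : p * (T * N) <= e * (T * N) by rewrite ler_wpM2r// mulr_ge0.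
  by move: e_small; set k := T * N; rewrite -mulrA (mulrC N) -/k; lra.
pose f t x := p *: F t (clamp rho x).
have fV t x : `|f t x| <= p * N.
  by rewrite normrZ ger0_norm// ler_wpM2l// frozen_field_bound// clamp_norm.
have fL t x y : `|f t x - f t y| <= (p * N + 1) * `|x - y|.
  rewrite -scalerBr normrZ ger0_norm//.
  apply: le_trans (_ : p * N * `|x - y| <= _); last by rewrite ler_wpM2r// lerDl.
  rewrite -mulrA ler_wpM2l//; apply: le_trans (frozen_field_lip _ _ _) _.
  - exact: clamp_norm.
  - exact: clamp_norm.
  - by rewrite ler_wpM2l// clamp_lip.
have mf (y : R -> 'rV[R]_n) b :
    (forall s t, 0 <= s -> s <= t -> `|y t - y s| <= p * N * (t - s)) ->
    vmeas 0 b (fun s => f s (y s)).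
  move=> yL; apply: vmeasZ; first exact: bmeas_cst.
  apply: (@frozen_field_vmeas _ _ (fun s => clamp rho (y s)) (p * N)).
    by move=> s _; exact: clamp_norm.
  by move=> s t s0 st _; apply: le_trans (clamp_lip _ _ rho0) _; exact: yL.
have L0 : 0 < p * N + 1 by rewrite ltr_wpDl.
have [w wL wE] := picard L0 fV fL mf x0.
have w0 : w 0 = x0 by rewrite wE// vint_point addr0.
have wbox t : 0 <= t <= T -> `|w t| <= rho.
  move=> /andP[t0 tT]; have := wL 0 t (lexx _) t0; rewrite w0 subr0.
  have : p * N * t <= p * N * T by rewrite ler_wpM2l.
  have := ler_normD (w t - x0) x0; rewrite subrK; move: x0_rho pTN; lra.
exists w; split => //; first by move=> s t s0 st tT; exact: wL.
move=> a b a0 ab bT; have b0 := le_trans a0 ab.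
rewrite (wE _ a0) (wE _ b0) (vint_chasles a0 ab (mf w b wL)).
rewrite opprD addrACA subrr add0r addrAC subrr add0r.
apply: eq_vint => s /andP[as_ sb]; rewrite /f clamp_id//.
by apply: wbox; rewrite (le_trans a0)//= (le_trans sb).
Qed.

Definition frozen_drift := vint 0 T (fun s => G s x0).

Let DF_sub t x z1 z2 c : DF t x (z1 - c *: z2) = DF t x z1 - c *: DF t x z2.
Proof.
rewrite /DF scaler_sumr -sumrB; apply: eq_bigr => i _.
by rewrite linearB linearZ /= scalerBr !scalerA mulrC.
Qed.

Let DY_scale t x z c : DY t x (c *: z) = c *: DY t x z.
Proof.
rewrite /DY scaler_sumr; apply: eq_bigr => i _.
by rewrite linearZ /= !scalerA mulrC.
Qed.

Let CG := m%:R * (m%:R * (M * (T * M) * A')).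
(** The first term is the variation of [G], of Lipschitz constant [CG], along a loop that moves by
    at most [p * N * T]; the second is the feedback of the remainder through [DF]. Each carries a
    factor [p ^+ 2], bounded by [e ^+ 2]. *)
Let Kfrozen := T * T * N * CG + 2 * T * T * N * (2 * T * N ^+ 2).

Let small_mul (p S : R) : 0 <= p -> p <= e -> 0 <= S -> p * N * S * T <= S / 2.
Proof.
move=> p0 pe S0.
have h : p * (T * N) <= 2^-1.
  by apply: le_trans e_small; rewrite ler_wpM2r// mulr_ge0.
have -> : p * N * S * T = S * (p * (T * N)) by ring.
by rewrite ler_wpM2l.
Qed.

(* With h = q - p, the remainder r = wq - wp - h Y(wp) satisfies
   r = int (p DF r + h p G) + O(h^2), where G is a sum of brackets. *)
Lemma frozen_homotopy : exists K' : R, forall p q wp wq, 0 <= p -> p <= q -> q <= e ->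
  frozen_solution p wp -> frozen_solution q wq ->
  `|wq T - wp T - ((q - p) * p) *: frozen_drift| <=
    (Kfrozen * e ^+ 2) * (q - p) + K' * (q - p) ^+ 2.
Proof.
(* Coefficient of [h ^+ 2] in the linearization error [err]. It contains [Ks], which is harmless
   because it ends up in [K']. *)
pose Ce := 2 * T * N * N + e * (m%:R * (M * Ks)) * (2 * T * N) ^+ 2.
have Ce0 : 0 <= Ce by rewrite !(addr_ge0, mulr_ge0)// sqr_ge0.
exists (2 * T * T * e * N * Ce + T * Ce).
move=> p q wp wq p0 pq qe [pb pL p00 pI] [qb qL q00 qI].
have q0 := le_trans p0 pq; have pe := le_trans pq qe.
pose h := q - p; have h0 : 0 <= h by rewrite subr_ge0.
have rho0 : 0 <= rho by apply: le_trans rho1.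
have mp : vmeas 0 T (fun s => F s (wp s)) by exact: (frozen_field_vmeas pb pL).
have mq : vmeas 0 T (fun s => F s (wq s)) by exact: (frozen_field_vmeas qb qL).
have mqp : vmeas 0 T (fun s => q *: F s (wq s) - p *: F s (wp s)).
  by apply: vmeasB; apply: vmeasZ; [exact: bmeas_cst|exact: mq|exact: bmeas_cst|exact: mp].
have Dint t : 0 <= t -> t <= T ->
    wq t - wp t = vint 0 t (fun s => q *: F s (wq s) - p *: F s (wp s)).
  move=> t0 tT; rewrite vintB.
  - rewrite -(qI 0 t (lexx _) t0 tT) -(pI 0 t (lexx _) t0 tT) q00 p00.
    by rewrite opprB addrA subrK.
  - apply: vmeasZ; [exact: bmeas_cst|exact: (vmeas_sub (lexx 0) tT mq)].
  - apply: vmeasZ; [exact: bmeas_cst|exact: (vmeas_sub (lexx 0) tT mp)].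
have d1 t : 0 <= t <= T -> `|wq t - wp t| <= 2 * (T * N * h).
  apply: (@half_sup_bound _ 0 T _ (rho + rho) (fun t => `|wq t - wp t|)).
    move=> s sT; apply: le_trans (ler_normB _ _) _; apply: lerD; [exact: qb|exact: pb].
  move=> S hS s sT; have S0 : 0 <= S by apply: le_trans (hS _ sT).
  have /andP[s0 s1] := sT; rewrite (Dint _ s0 s1).
  apply: le_trans (_ : (h * N + p * N * S) * (s - 0) <= _).
    apply: (norm_vint_cst s0 (vmeas_sub (lexx 0) s1 mqp)) => r /andP[r0 r1].
    have rT : 0 <= r <= T by rewrite r0 (le_trans r1).
    have -> : q *: F r (wq r) - p *: F r (wp r) =
        h *: F r (wq r) + p *: (F r (wq r) - F r (wp r)).
      by rewrite /h scalerBl scalerBr addrA subrK.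
    apply: le_trans (ler_normD _ _) _; rewrite !normrZ !ger0_norm//; apply: lerD.
      by rewrite ler_wpM2l// frozen_field_bound// qb.
    rewrite -mulrA ler_wpM2l//; apply: le_trans (frozen_field_lip _ (qb _ rT) (pb _ rT)) _.
    by rewrite ler_wpM2l// hS.
  rewrite subr0; apply: le_trans (_ : (h * N + p * N * S) * T <= _).
    by rewrite ler_wpM2l// addr_ge0 ?mulr_ge0.
  rewrite mulrDl; apply: lerD; last exact: small_mul.
  by rewrite le_eqVlt; apply/orP; left; apply/eqP; ring.
pose r t := wq t - wp t - h *: Y t (wp t).
pose Er s := q *: F s (wq s) - p *: F s (wp s) -
   h *: (F s (wp s) + DY s (wp s) (p *: F s (wp s))).
have mYi : vmeas 0 T (fun s => F s (wp s) + DY s (wp s) (p *: F s (wp s))).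
  apply: vmeasD; first exact: mp.
  apply: (DY_vmeas (lexx 0) (lexx T) pb pL).
  by apply: vmeasZ; [exact: bmeas_cst|exact: mp].
have mEr : vmeas 0 T Er.
  by apply: vmeasB; [exact: mqp|apply: vmeasZ; [exact: bmeas_cst|exact: mYi]].
have rint t : 0 <= t -> t <= T -> r t = vint 0 t Er.
  move=> t0 tT; rewrite vintB.
  - rewrite -(Dint _ t0 tT) vintZ; last exact: (vmeas_sub (lexx 0) tT mYi).
    by rewrite -(Y_increment p0 t0 tT pb pL pI).
  - exact: (vmeas_sub (lexx 0) tT mqp).
  - by apply: vmeasZ; [exact: bmeas_cst|exact: (vmeas_sub (lexx 0) tT mYi)].
pose err s := h *: (F s (wq s) - F s (wp s)) +
  p *: (F s (wq s) - F s (wp s) - DF s (wp s) (wq s - wp s)).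
(* Writing [wq - wp] as [r + h *: Y], the multiples of [F] cancel, and [DF] applied to [h *: Y]
   combines with [DY] applied to [F] into [G]. *)
have ErE s : Er s = (h * p) *: G s (wp s) + p *: DF s (wp s) (r s) + err s.
  rewrite /err /r DF_sub /G /Er DY_scale /h.
  set a1 := F s (wq s); set a2 := F s (wp s); set a3 := DF _ _ _; set a4 := DF _ _ _.
  set a5 := DY _ _ _.
  by apply/rowP => k; rewrite !mxE; ring.
have err_le s : 0 <= s <= T -> `|err s| <= Ce * h ^+ 2.
  move=> sT; have D1 := d1 _ sT; apply: le_trans (ler_normD _ _) _.
  rewrite !normrZ !ger0_norm// /Ce [leRHS]mulrDl; apply: lerD.
    apply: le_trans (_ : h * (N * (2 * (T * N * h))) <= _).
      rewrite ler_wpM2l//; apply: le_trans (frozen_field_lip _ (qb _ sT) (pb _ sT)) _.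
      by rewrite ler_wpM2l.
    by rewrite le_eqVlt; apply/orP; left; apply/eqP; ring.
  apply: le_trans (_ : e * (m%:R * (M * Ks) * (2 * (T * N * h)) ^+ 2) <= _).
    apply: ler_pM => //; apply: le_trans (F_taylor _ (pb _ sT) (qb _ sT)) _.
    rewrite ler_wpM2l ?mulr_ge0//; apply: lerXn2r => //; rewrite ?nnegrE//.
    exact: le_trans D1.
  by rewrite le_eqVlt; apply/orP; left; apply/eqP; ring.
pose c2 := T * (h * p * (2 * T * N ^+ 2) + Ce * h ^+ 2).
have d2 t : 0 <= t <= T -> `|r t| <= 2 * c2.
  apply: (@half_sup_bound _ 0 T _ (2 * (T * N * h) + h * (T * N)) (fun t => `|r t|)).
    move=> s sT; apply: le_trans (ler_normB _ _) _; apply: lerD; first exact: d1.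
    by rewrite normrZ ger0_norm// ler_wpM2l// Y_bound// pb.
  move=> S hS s sT; have S0 : 0 <= S by apply: le_trans (hS _ sT).
  have /andP[s0 s1] := sT; rewrite (rint _ s0 s1).
  pose c3 := h * p * (2 * T * N ^+ 2) + Ce * h ^+ 2 + p * N * S.
  have c30 : 0 <= c3.
    rewrite /c3; apply: addr_ge0; last by rewrite !mulr_ge0.
    by apply: addr_ge0; rewrite !mulr_ge0 ?sqr_ge0.
  apply: le_trans (_ : c3 * (s - 0) <= _).
    apply: (norm_vint_cst s0 (vmeas_sub (lexx 0) s1 mEr)) => z /andP[z0 z1].
    have zT : 0 <= z <= T by rewrite z0 (le_trans z1).
    rewrite ErE /c3 [leRHS]addrAC; apply: le_trans (ler_normD _ _) _; apply: lerD.
    - apply: le_trans (ler_normD _ _) _; rewrite !normrZ ?normrM !ger0_norm//; apply: lerD.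
        by apply: ler_wpM2l; [exact: mulr_ge0|apply: G_bound => //; exact: pb].
      rewrite -[leRHS]mulrA ler_wpM2l//; apply: le_trans (DF_bound _ _ (pb _ zT)) _.
      by rewrite ler_wpM2l// hS.
    - exact: err_le.
  rewrite subr0; apply: le_trans (_ : c3 * T <= _); first by rewrite ler_wpM2l.
  rewrite /c3 mulrDl; apply: lerD; last exact: small_mul.
  by rewrite mulrC.
have mG0 : vmeas 0 T (fun s => G s x0).
  apply: (vmeas_eq (f := fun s =>
    \sum_(i < m) \sum_(l < m) (v i s * U l s) *: frozen_bracket l i x0)).
    by move=> t _; rewrite G_expand.
  apply: vmeas_sum => i; apply: vmeas_sum => l; apply: vmeasZ; last exact: vmeas_cst.
  by apply: bmeasM; [exact: v_bmeas|exact: (U_bmeas l (lexx 0) (lexx T))].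
have rT : r T = wq T - wp T.
  by rewrite /r /Y big1 ?scaler0 ?subr0// => i _; rewrite /U v_mean0 scale0r.
have TT : 0 <= T <= T by rewrite T00 lexx.
rewrite -rT (rint _ T00 (lexx T)) /frozen_drift -vintZ// -vintB; last 2 first.
- exact: mEr.
- by apply: vmeasZ; [exact: bmeas_cst|exact: mG0].
pose c4 := h * p * (CG * (p * N * T)) + p * N * (2 * c2) + Ce * h ^+ 2.
apply: le_trans (_ : c4 * (T - 0) <= _).
  apply: (norm_vint_cst T00).
    by apply: vmeasB; [exact: mEr|apply: vmeasZ; [exact: bmeas_cst|exact: mG0]].
  move=> s sT; have /andP[s0 s1] := sT.
  have -> : Er s - ((q - p) * p) *: G s x0 =
      (h * p) *: (G s (wp s) - G s x0) + p *: DF s (wp s) (r s) + err s.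
    rewrite ErE -/h; move: (G s (wp s)) (G s x0) (DF s (wp s) (r s)) (err s) => *.
    by apply/rowP => k; rewrite !mxE; ring.
  apply: le_trans (ler_normD _ _) _; rewrite /c4; apply: lerD; last exact: err_le.
  apply: le_trans (ler_normD _ _) _; rewrite !normrZ ?normrM !ger0_norm//; apply: lerD.
    apply: ler_wpM2l; first exact: mulr_ge0.
    apply: le_trans (G_lip sT (pb _ sT) _) _; first by move: x0_rho; lra.
    rewrite /CG -!mulrA.
    have h7 : `|wp s - x0| <= p * N * T.
      rewrite -p00; apply: le_trans (pL _ _ (lexx 0) s0 s1) _.
      by rewrite subr0 ler_wpM2l// mulr_ge0.
    by do ?[apply: ler_wpM2l => //]; move: h7; rewrite -!mulrA.
  rewrite -[leRHS]mulrA ler_wpM2l//; apply: le_trans (DF_bound _ _ (pb _ sT)) _.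
  by rewrite ler_wpM2l// d2.
rewrite subr0 -/h.
have hp2 : h * (p * p) <= h * e ^+ 2 by rewrite ler_wpM2l// expr2 ler_pM.
have -> : c4 * T = h * (p * p) * Kfrozen + (2 * T * T * p * N * Ce + T * Ce) * h ^+ 2.
  by rewrite /c4 /c2 /Kfrozen; ring.
apply: lerD.
  have K0 : 0 <= Kfrozen.
    by apply: addr_ge0; rewrite !mulr_ge0 ?sqr_ge0.
  rewrite [leLHS]mulrC -[leRHS]mulrA; apply: ler_wpM2l => //.
  by rewrite [leRHS]mulrC.
rewrite ler_wpM2r ?sqr_ge0// lerD2r ler_wpM2r// ler_wpM2r//.
by rewrite ler_wpM2l// mulr_ge0// mulr_ge0.
Qed.

(** The amplitude runs from 0, where the loop is constant, to [e]. Increments in [p] are summed by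
    [vector_increment_bound]; refining the subdivision removes [K'], and with it the bounds on
    second derivatives. *)
Lemma frozen_displacement : exists2 w, frozen_solution e w &
  `|w T - x0 - (e ^+ 2 / 2) *: frozen_drift| <= Kfrozen * e ^+ 3.
Proof.
have [K' hK] := frozen_homotopy.
have ex p : exists w, 0 <= p <= e -> frozen_solution p w.
  have [/andP[p0 pe]|_] := boolP (0 <= p <= e); last by exists (fun=> 0).
  by have [w hw] := frozen_solution_exists p0 pe; exists w.
have [W hW] := choice ex.
have W0 : W 0 T = x0.
  have [_ L0 <- _] : frozen_solution 0 (W 0) by apply: hW; rewrite lexx.
  apply/eqP; rewrite -subr_eq0 -normr_le0; have := L0 0 T (lexx _) T00 (lexx _).
  by rewrite !mul0r.
exists (W e); first by apply: hW; rewrite e0 lexx.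
pose psi p := W p T - (p ^+ 2 / 2) *: frozen_drift.
have -> : W e T - x0 - (e ^+ 2 / 2) *: frozen_drift = psi e - psi 0.
  by rewrite /psi expr0n /= mul0r scale0r subr0 W0 addrAC.
have K0 : 0 <= Kfrozen.
  by apply: addr_ge0; rewrite /CG !mulr_ge0 ?sqr_ge0.
have -> : Kfrozen * e ^+ 3 = Kfrozen * e ^+ 2 * (e - 0) by rewrite subr0 -mulrA -exprSr.
apply: (vector_increment_bound (K' := K' + `|frozen_drift| / 2)) => //.
  by rewrite mulr_ge0// sqr_ge0.
move=> p q p0 pq qe.
have sp : frozen_solution p (W p) by apply: hW; rewrite p0 (le_trans pq).
have sq : frozen_solution q (W q) by apply: hW; rewrite (le_trans p0).
have h1 := hK p q _ _ p0 pq qe sp sq.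
(* [(q ^+ 2 - p ^+ 2) / 2] equals [(q - p) * p] plus [(q - p) ^+ 2 / 2]; the last term joins the
   quadratic error. *)
have -> : psi q - psi p = (W q T - W p T - ((q - p) * p) *: frozen_drift) -
   ((q - p) ^+ 2 / 2) *: frozen_drift.
  by rewrite /psi; move: (W q T) (W p T) frozen_drift => *; apply/rowP => k; rewrite !mxE; field.
apply: le_trans (ler_normB _ _) _.
rewrite (mulrDl K') addrA; apply: lerD => //.
have h2 : 0 <= (q - p) ^+ 2 / 2 by rewrite divr_ge0 ?sqr_ge0.
by rewrite normrZ (ger0_norm h2) le_eqVlt; apply/orP; left; apply/eqP; field.
Qed.

Let cross i l := leb_int 0 T (fun t => v i t * U l t).

Let cross_bmeas i l a b : 0 <= a -> b <= T -> bmeas a b (fun t => v i t * U l t).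
Proof. by move=> a0 bT; apply: bmeasM; [exact: v_bmeas|exact: U_bmeas]. Qed.

(** Integration by parts: [g] is formally the derivative of [U i * U l], which vanishes at both ends
    because the inputs have zero mean. *)
Let cross_anti i l : cross l i = - cross i l.
Proof.
apply/eqP; rewrite -addr_eq0 addrC; apply/eqP.
pose g t := v i t * U l t + v l t * U i t.
have mg a b : 0 <= a -> b <= T -> bmeas a b g.
  by move=> a0 bT; apply: bmeasD; exact: cross_bmeas.
have -> : cross i l + cross l i = leb_int 0 T g.
  by rewrite /g leb_intD; [|exact: (cross_bmeas _ _ (lexx 0) (lexx T))|exact: (cross_bmeas _ _ (lexx 0) (lexx T))].
pose phi t := U i t * U l t - leb_int 0 t g.
suff : phi T = phi 0.
  by rewrite /phi leb_int_point /U !v_mean0 leb_int_point !mul0r !sub0r oppr0 => /eqP; rewrite oppr_eq0 => /eqP.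
apply: (@quadratic_increment_eq _ _ _ _ (M * M + M * M)) => // a b a0 ab bT.
have b0 := le_trans a0 ab; have aT := le_trans ab bT.
(* The product increases by [U l b * (U i b - U i a) + U i a * (U l b - U l a)]; subtracting the
   integral of [g] leaves that of [E1 + E2], whose terms are O(b - a). *)
pose E1 t := v i t * (U l b - U l t); pose E2 t := v l t * (U i a - U i t).
have mE1 : bmeas a b E1.
  by apply: bmeasM; [exact: v_bmeas|apply: bmeasB; [exact: bmeas_cst|exact: U_bmeas]].
have mE2 : bmeas a b E2.
  by apply: bmeasM; [exact: v_bmeas|apply: bmeasB; [exact: bmeas_cst|exact: U_bmeas]].
have -> : phi b - phi a = leb_int a b E1 + leb_int a b E2.
  rewrite -(leb_intD mE1 mE2).
  have -> : leb_int a b (fun t => E1 t + E2 t) =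
      leb_int a b (fun t => U l b * v i t + U i a * v l t - g t).
    by apply: eq_leb_int => t _; rewrite /E1 /E2 /g; ring.
  have mi c j : bmeas a b (fun t => c * v j t).
    by apply: bmeasM; [exact: bmeas_cst|exact: v_bmeas].
  rewrite leb_intB; [|exact: (bmeasD (mi _ _) (mi _ _))|exact: mg].
  rewrite leb_intD; [|exact: mi|exact: mi].
  rewrite !leb_intZ; [|exact: v_bmeas|exact: v_bmeas].
  rewrite -!(U_increment _ a0 ab) /phi (leb_int_chasles a0 ab (mg 0 b (lexx _) bT)).
  ring.
have Ul j s t : a <= s -> s <= t -> t <= b -> `|U j t - U j s| <= M * (b - a).
  move=> as_ st tb; rewrite (U_increment _ (le_trans a0 as_) st).
  apply: le_trans (norm_leb_int_cst st (v_bmeas j s t) (M := M) _) _.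
    by move=> r _; exact: v_bound.
  by rewrite ler_wpM2l//; lra.
have h1 : `|leb_int a b E1| <= M * (M * (b - a)) * (b - a).
  apply: (norm_leb_int_cst ab mE1) => t /andP[at_ tb].
  by rewrite normrM ler_pM// Ul.
have h2 : `|leb_int a b E2| <= M * (M * (b - a)) * (b - a).
  apply: (norm_leb_int_cst ab mE2) => t /andP[at_ tb].
  by rewrite normrM ler_pM// distrC Ul.
apply: le_trans (ler_normD _ _) _; apply: le_trans (lerD h1 h2) _.
by rewrite le_eqVlt; apply/orP; left; apply/eqP; ring.
Qed.

(** Both [cross] and the bracket are antisymmetric, so their product is symmetric and zero on the
    diagonal: the full double sum is twice the sum over [i < j]. *)
Lemma frozen_drift_brackets : 2^-1 *: frozen_drift =
  \sum_(i < m) \sum_(j < m | (i < j)%N)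
    leb_int 0 T (fun t => v j t * leb_int 0 t (v i)) *: frozen_bracket i j x0.
Proof.
have -> : frozen_drift = \sum_(i < m) \sum_(l < m) cross i l *: frozen_bracket l i x0.
  rewrite /frozen_drift (eq_vint (g := fun s =>
    \sum_(i < m) \sum_(l < m) (v i s * U l s) *: frozen_bracket l i x0)); last first.
    by move=> t _; rewrite G_expand.
  have mc i l : vmeas 0 T (fun s => (v i s * U l s) *: frozen_bracket l i x0).
    by apply: vmeasZ; [exact: (cross_bmeas i l (lexx 0) (lexx T))|exact: vmeas_cst].
  rewrite (vint_sum _ _ T00); last by move=> i; apply: vmeas_sum => l; exact: mc.
  apply: eq_bigr => i _; rewrite (vint_sum _ _ T00); last by move=> l; exact: mc.
  apply: eq_bigr => l _; rewrite vintZl; first by [].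
  exact: (cross_bmeas i l (lexx 0) (lexx T)).
pose a i l := cross i l *: frozen_bracket l i x0.
have a_sym i l : a i l = a l i.
  by rewrite /a cross_anti scaleNr -scalerN /frozen_bracket opprB.
have a_diag i : a i i = 0 by rewrite /a /frozen_bracket subrr scaler0.
have split i : \sum_(l < m) a i l =
    \sum_(l < m | (i < l)%N) a i l + \sum_(l < m | (l < i)%N) a i l.
  rewrite (bigID (fun l : 'I_m => (i < l)%N)) /=; congr (_ + _).
  rewrite (bigD1 i) ?ltnn//= a_diag add0r; apply: eq_bigl => l.
  by rewrite -leqNgt ltn_neqAle andbC.
rewrite (eq_bigr (fun i : 'I_m => \sum_(l < m | (i < l)%N) a i l +
   \sum_(l < m | (l < i)%N) a i l)); last by move=> i _; rewrite -split.
rewrite big_split /= [X in _ + X](exchange_big_dep xpredT)//=.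
rewrite [X in _ + X](eq_bigr (fun i : 'I_m => \sum_(l < m | (i < l)%N) a i l)); last first.
  by move=> l _; apply: eq_bigr => i _; exact: a_sym.
have half (z : 'rV[R]_n) : 2^-1 *: (z + z) = z.
  by apply/rowP => k; rewrite !mxE; field.
rewrite half; by apply: eq_bigr => i _; apply: eq_bigr => j _; rewrite a_sym.
Qed.

End FrozenFlow.

(** * Derivatives on boxes *)

Section Calculus.
Context {R : realType} {n : nat}.
Local Notation rV := 'rV[R]_n.

Lemma mean_value_row (f : R -> rV) (a b C : R) : a <= b -> 0 <= C ->
  (forall t, differentiable f t) ->
  (forall t, a <= t <= b -> `|'d f t 1| <= C) -> `|f b - f a| <= C * (b - a).
Proof.
move=> ab C0 df fC; apply: row_norm_le; first by rewrite mulr_ge0// subr_ge0.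
move=> k; rewrite !mxE; pose g t := f t 0 k.
have dg t : differentiable g t.
  exact: (differentiable_comp (df t) (differentiable_coord (f t) 0 k)).
have gE t : 'D_1 g t = ('d f t 1) 0 k.
  by rewrite -(deriveE _ (df t)) derive_mx ?mxE//; exact: diff_derivable.
have [c /[!in_itv]/= cab ->] : exists2 c, c \in `[a, b] & g b - g a = 'D_1 g c * (b - a).
  apply: (MVT_segment (df := fun t => 'D_1 g t)) => //.
    by move=> t _; apply: derivableP; exact: diff_derivable.
  by apply: continuous_subspaceT => t; exact: differentiable_continuous.
rewrite normrM (ger0_norm (x := b - a)) ?subr_ge0// ler_wpM2r ?subr_ge0// gE.
by apply: le_trans (fC _ cab); exact: row_entry_norm_le.
Qed.

Lemma diff_scale_line (z : rV) (s : R) :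
  differentiable (fun r : R => r *: z) s /\ 'd (fun r : R => r *: z) s 1 = z.
Proof.
have d : is_diff s (fun r : R => r *: z) (fun r : R => r *: z) by exact: is_diff_scalel.
by split; [exact: ex_diff|rewrite diff_val scale1r].
Qed.

Lemma diff_affine_line (x z : rV) (s : R) :
  'd (fun r : R => x + r *: z) s 1 = z.
Proof.
have d1 : is_diff s (fun r : R => r *: z) (fun r : R => r *: z) by exact: is_diff_scalel.
have d2 : is_diff s (cst x : R -> rV) 0 by exact: is_diff_cst.
have d3 := is_diffD d2 d1.
have -> : (fun r : R => x + r *: z) = (cst x : R -> rV) + (fun r : R => r *: z) by [].
by rewrite diff_val /GRing.add /= add0r scale1r.
Qed.

Lemma differentiable_line (g : rV -> rV) (x z : rV) (s : R) :
  (forall x, differentiable g x) ->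
  differentiable (fun r : R => g (x + r *: z)) s /\
  'd (fun r : R => g (x + r *: z)) s 1 = 'd g (x + s *: z) z.
Proof.
move=> dg.
have dl : differentiable (fun r : R => x + r *: z) s.
  by apply: differentiableD; [exact: differentiable_cst|exact: differentiableZl].
split; first exact: (differentiable_comp dl (dg _)).
have -> : (fun r : R => g (x + r *: z)) = g \o (fun r : R => x + r *: z) by [].
rewrite (diff_comp dl (dg _)) /=; congr ('d g _ _); exact: diff_affine_line.
Qed.

Lemma segment_norm (rho s : R) (x y : rV) : `|x| <= rho -> `|y| <= rho ->
  0 <= s <= 1 -> `|x + s *: (y - x)| <= rho.
Proof.
move=> xr yr /andP[s0 s1].
have -> : x + s *: (y - x) = (1 - s) *: x + s *: y.
  by apply/rowP => k; rewrite !mxE; ring.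
apply: le_trans (ler_normD _ _) _; rewrite !normrZ !ger0_norm ?subr_ge0//.
have h1 : (1 - s) * `|x| <= (1 - s) * rho by rewrite ler_wpM2l// subr_ge0.
have h2 : s * `|y| <= s * rho by rewrite ler_wpM2l.
lra.
Qed.

Lemma lipschitz_box (g : rV -> rV) (rho C : R) : 0 <= C ->
  (forall x, differentiable g x) ->
  (forall x w, `|x| <= rho -> `|'d g x w| <= C * `|w|) ->
  forall x y, `|x| <= rho -> `|y| <= rho -> `|g x - g y| <= C * `|x - y|.
Proof.
move=> C0 dg gC x y xr yr.
have := @mean_value_row (fun r : R => g (y + r *: (x - y))) 0 1 (C * `|x - y|).
rewrite scale1r scale0r addr0 subr0 mulr1 [y + (x - y)]addrC subrK; apply=> //.
- by rewrite mulr_ge0.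
- by move=> s; have [] := differentiable_line y (x - y) s dg.
- move=> s s01; have [_ ->] := differentiable_line y (x - y) s dg.
  by apply: gC; exact: segment_norm.
Qed.

Lemma compact_box (rho : R) : compact [set x : rV | `|x| <= rho].
Proof.
apply: bounded_closed_compact.
  exists rho; split; first exact: num_real.
  by move=> y ry x /= xr; rewrite (le_trans xr)// ltW.
have -> : [set x : rV | `|x| <= rho] = (fun x => `|x|) @^-1` [set r | r <= rho] by [].
by apply: closed_comp; [move=> x _; exact: norm_continuous|exact: closed_le].
Qed.

(** The extreme value theorem on the compact box, for each basis vector, followed by linearity. *)
Lemma diff_bounded_box (g : rV -> rV) (rho : R) :
  (forall w, continuous (fun x => 'd g x w)) ->
  exists2 C, 0 <= C & forall x w, `|x| <= rho -> `|'d g x w| <= C * `|w|.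
Proof.
move=> cg.
have [r0|r0] := leP 0 rho; last first.
  by exists 0 => // x w /le_lt_trans/(_ r0); rewrite ltNge normr_ge0.
have ck k : exists C, forall x, `|x| <= rho -> `|'d g x (delta_mx 0 k)| <= C.
  have ne : [set x : rV | `|x| <= rho] !=set0 by exists 0; rewrite /= normr0.
  have cf : {within [set x : rV | `|x| <= rho], continuous (fun x => `|'d g x (delta_mx 0 k)|)}.
    apply: continuous_subspaceT => x.
    by apply: continuous_comp; [exact: cg|exact: norm_continuous].
  have [c _ hc] := EVT_max_rV ne (@compact_box rho) cf.
  by exists `|'d g c (delta_mx 0 k)| => x xr; apply: hc; rewrite inE.
have [C hC] := choice ck.
exists (\sum_k `|C k|); first exact: sumr_ge0.
move=> x w xr; rewrite linear_row_expand; apply: le_trans (ler_norm_sum _ _ _) _.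
rewrite mulr_suml; apply: ler_sum => k _; rewrite normrZ mulrC; apply: ler_pM => //.
  by apply: le_trans (hC _ _ xr) _; exact: ler_norm.
exact: row_entry_norm_le.
Qed.

Lemma taylor_box (g : rV -> rV) (rho : R) :
  (forall x, differentiable g x) ->
  (forall w x, differentiable (fun x => 'd g x w) x) ->
  (forall w z, continuous (fun x => 'd (fun x => 'd g x w) x z)) ->
  exists Ks, [/\ 0 <= Ks,
    forall x y, `|x| <= rho -> `|y| <= rho ->
      `|g y - g x - 'd g x (y - x)| <= Ks * `|y - x| ^+ 2 &
    forall x y w, `|x| <= rho -> `|y| <= rho ->
      `|'d g x w - 'd g y w| <= Ks * `|x - y| * `|w| ].
Proof.
move=> dg ddg cddg.
have ck k : exists C, 0 <= C /\ forall x z, `|x| <= rho ->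
    `|'d (fun x => 'd g x (delta_mx 0 k)) x z| <= C * `|z|.
  by have [C C0 hC] := @diff_bounded_box _ rho (cddg (delta_mx 0 k)); exists C.
have [C hC] := choice ck.
have C0 k : 0 <= C k by have [] := hC k.
have S0 : 0 <= \sum_k C k by exact: sumr_ge0.
have DL x y w : `|x| <= rho -> `|y| <= rho ->
    `|'d g x w - 'd g y w| <= (\sum_k C k) * `|x - y| * `|w|.
  move=> xr yr.
  have -> : 'd g x w - 'd g y w =
      \sum_(k < n) w 0 k *: ('d g x (delta_mx 0 k) - 'd g y (delta_mx 0 k)).
    under eq_bigr do rewrite scalerBr.
    rewrite sumrB; congr (_ - _); exact: linear_row_expand.
  apply: le_trans (ler_norm_sum _ _ _) _.
  rewrite -mulrA mulr_suml; apply: ler_sum => k _.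
  rewrite normrZ mulrC mulrA; apply: ler_pM => //; last exact: row_entry_norm_le.
  by apply: (lipschitz_box (C0 k) (ddg _) (hC k).2).
exists (\sum_k C k); split=> // x y xr yr.
pose f (s : R) := g (x + s *: (y - x)) + s *: (- 'd g x (y - x)).
have -> : g y - g x - 'd g x (y - x) = f 1 - f 0.
  by rewrite /f !scale1r !scale0r !addr0 [x + (_ - _)]addrC subrK addrAC.
have df s : differentiable f s /\
    'd f s 1 = 'd g (x + s *: (y - x)) (y - x) - 'd g x (y - x).
  have [d1 e1] := differentiable_line x (y - x) s dg.
  have [d2 e2] := diff_scale_line (- 'd g x (y - x)) s.
  split; first exact: differentiableD.
  have -> : f = (fun r : R => g (x + r *: (y - x))) + (fun r : R => r *: (- 'd g x (y - x))) by [].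
  apply: etrans (congr1 (fun h : R -> rV => h 1) (diffD d1 d2)) _.
  exact: (f_equal2 +%R e1 e2).
have := @mean_value_row f 0 1 ((\sum_k C k) * `|y - x| ^+ 2).
rewrite subr0 mulr1; apply => //.
- by rewrite mulr_ge0// sqr_ge0.
- by move=> s; have [] := df s.
- move=> s s01; have [_ ->] := df s.
  apply: le_trans (DL _ _ _ (segment_norm xr yr s01) xr) _.
  rewrite addrC addKr expr2 mulrA ler_wpM2r// ler_wpM2l// normrZ.
  by have /andP[s0 s1] := s01; rewrite ger0_norm// ler_piMl.
Qed.

Lemma differentiable_mulv (V : normedModType R) (c : V -> R) (F : V -> rV) (p : V) :
  differentiable c p -> differentiable F p -> differentiable (fun q => c q *: F q) p.
Proof.
move=> dc dF.
have -> : (fun q => c q *: F q) =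
    \sum_(k < n) (fun q => (c q * F q 0 k) *: (delta_mx 0 k : rV)).
  apply/funext => q; rewrite fct_sumE {1}(row_sum_delta (F q)) scaler_sumr.
  by apply: eq_bigr => k _; rewrite scalerA.
apply: differentiable_sum => k; apply: differentiableZl; apply: differentiableM => //.
exact: (differentiable_comp dF (differentiable_coord (F p) 0 k)).
Qed.

Section JointSlices.
Variable Phi : R * rV -> rV.
Hypothesis dPhi : forall p, differentiable Phi p.

Lemma differentiable_space_slice t x :
  differentiable (fun y : rV => Phi (t, y)) x /\
  forall w, 'd (fun y : rV => Phi (t, y)) x w = 'd Phi (t, x) (0, w).
Proof.
have d1 : is_diff x (cst t : rV -> R) 0 by exact: is_diff_cst.
have d2 : is_diff x (id : rV -> rV) id by exact: is_diff_id.
have d3 := is_diff_pair d1 d2.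
have dp : differentiable (fun y : rV => (t, y)) x by exact: (@ex_diff _ _ _ _ _ _ _ d3).
split; first exact: (differentiable_comp dp (dPhi _)).
move=> w; have h := diff_comp dp (dPhi (t, x)).
apply: etrans (congr1 (fun h : rV -> rV => h w) h) _.
have e := @diff_val _ _ _ _ _ _ _ d3.
exact: (congr1 ('d Phi (t, x)) (congr1 (fun h : rV -> R * rV => h w) e)).
Qed.

Lemma differentiable_time_slice t x :
  differentiable (fun s : R => Phi (s, x)) t /\
  'd (fun s : R => Phi (s, x)) t 1 = 'd Phi (t, x) (1, 0).
Proof.
have d1 : is_diff t (cst x : R -> rV) 0 by exact: is_diff_cst.
have d2 : is_diff t (id : R -> R) id by exact: is_diff_id.
have d3 := is_diff_pair d2 d1.
have dp : differentiable (fun s : R => (s, x)) t by exact: (@ex_diff _ _ _ _ _ _ _ d3).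
split; first exact: (differentiable_comp dp (dPhi _)).
have h := diff_comp dp (dPhi (t, x)).
apply: etrans (congr1 (fun h : R -> rV => h 1) h) _.
have e := @diff_val _ _ _ _ _ _ _ d3.
exact: (congr1 ('d Phi (t, x)) (congr1 (fun h : R -> R * rV => h 1) e)).
Qed.

End JointSlices.
End Calculus.

(** * Euclidean and operator norms compared with the sup norm *)

Section EuclideanNorm.
Context {R : realType} {n : nat}.
Local Notation rV := 'rV[R]_n.

Lemma norm_le_enorm (v : rV) : `|v| <= enorm v.
Proof.
apply: row_norm_le; first exact: sqrtr_ge0.
move=> k; rewrite -sqrtr_sqr ler_wsqrtr// (bigD1 k)//= lerDl.
by apply: sumr_ge0 => i _; exact: sqr_ge0.
Qed.

Lemma enorm_le_norm (v : rV) : enorm v <= n%:R * `|v|.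
Proof.
have h0 : 0 <= n%:R * `|v| by rewrite mulr_ge0.
rewrite -[leRHS]ger0_norm// -sqrtr_sqr ler_wsqrtr//.
apply: (@le_trans _ _ (\sum_(i < n) `|v| ^+ 2)).
  apply: ler_sum => i _; rewrite -real_normK ?num_real//.
  by apply: lerXn2r; rewrite ?nnegrE// row_entry_norm_le.
rewrite sumr_const card_ord -[leLHS]mulr_natl [leRHS]exprMn ler_wpM2r ?sqr_ge0//.
by rewrite -natrX ler_nat; case: (n) => // k; rewrite expnS leq_pmulr// expn_gt0.
Qed.

Lemma enormZ (c : R) (v : rV) : enorm (c *: v) = `|c| * enorm v.
Proof.
rewrite /enorm -sqrtr_sqr -sqrtrM ?sqr_ge0//; congr Num.sqrt.
by rewrite mulr_sumr; apply: eq_bigr => i _; rewrite mxE exprMn.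
Qed.

(** The supremum is an upper bound only once its set is known to be bounded: [w *m M] combines the
    rows of [M] with coefficients of modulus at most 1. Normalizing [v] then concludes. *)
Lemma enorm_mul_opnorm (M : 'M[R]_n) (v : rV) : enorm (v *m M) <= opnorm M * enorm v.
Proof.
pose E := [set enorm (w *m M) | w in [set w : rV | enorm w <= 1]].
have supE : has_sup E.
  split; first by exists (enorm (0 *m M)); exists 0; rewrite //= -(scale0r 0) enormZ normr0 mul0r.
  exists (n%:R * \sum_k `|row k M|) => _ [w /= w1 <-].
  apply: le_trans (enorm_le_norm _) _; rewrite ler_wpM2l// mulmx_sum_row.
  apply: le_trans (ler_norm_sum _ _ _) _; apply: ler_sum => k _.
  rewrite normrZ ler_piMl// (le_trans (row_entry_norm_le w k))//.
  exact: le_trans (norm_le_enorm w) w1.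
have v0 : 0 <= enorm v by exact: sqrtr_ge0.
have [ve|ve] := eqVneq (enorm v) 0.
  have -> : v = 0 by apply/eqP; rewrite -normr_le0 -ve norm_le_enorm.
  by rewrite mul0mx -(scale0r 0) !enormZ normr0 !mul0r mulr0.
have vp : 0 < enorm v by rewrite lt_def ve.
have -> : v *m M = enorm v *: ((enorm v)^-1 *: v *m M).
  by rewrite -scalemxAl scalerA divff// scale1r.
rewrite enormZ ger0_norm// mulrC ler_wpM2r//.
apply: ub_le_sup; first exact: supE.2.
by exists ((enorm v)^-1 *: v) => //=; rewrite enormZ ger0_norm ?invr_ge0// mulVf.
Qed.

Lemma diff_opnorm_bound (f : rV -> rV) (x w : rV) (C : R) :
  opnorm (jacobian f x) <= C -> `|'d f x w| <= C * n%:R * `|w|.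
Proof.
move=> hC; apply: le_trans (norm_le_enorm _) _.
have -> : 'd f x w = w *m jacobian f x by rewrite /jacobian mul_rV_lin1.
apply: le_trans (enorm_mul_opnorm _ _) _.
have [w0|w0] := eqVneq w 0.
  by rewrite w0 normr0 mulr0 -(scale0r 0) enormZ normr0 mul0r mulr0.
have e0 : 0 < enorm w by apply: lt_le_trans (norm_le_enorm _); rewrite normr_gt0.
have o0 : 0 <= opnorm (jacobian f x).
  have := enorm_mul_opnorm (jacobian f x) w.
  by move=> /(le_trans (sqrtr_ge0 _)); rewrite pmulr_lge0.
rewrite -mulrA; apply: ler_pM => //; first exact: ltW.
exact: enorm_le_norm.
Qed.

End EuclideanNorm.

(** * Bounds on the fields and their brackets, uniform in time *)

Section Regularity.
Context {R : realType} {n m : nat}.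
Local Notation rV := 'rV[R]_n.
Variable b : 'I_m.+1 -> R -> rV -> rV.
Hypotheses (hb1 : assumption1 b) (hb2 : assumption2 b).

Let F (i : 'I_m.+1) (p : R * rV) : rV := b i p.1 p.2.

Let dF i p : differentiable (F i) p. Proof. by have [] := hb1 i. Qed.
Let ddF i v p : differentiable (fun q => 'd (F i) q v) p.
Proof. by have [_ /(_ v) []] := hb1 i. Qed.
Let cddF i v w : continuous (fun p => 'd (fun q => 'd (F i) q v) p w).
Proof. by have [_ /(_ v) [_]] := hb1 i. Qed.

Let d_space i t x w : 'd (b i t) x w = 'd (F i) (t, x) (0, w).
Proof. by have [_ ->] := differentiable_space_slice (dF i) t x. Qed.

Lemma field_differentiable i t x : differentiable (b i t) x.
Proof. by have [] := differentiable_space_slice (dF i) t x. Qed.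

Lemma lie_bracketE (f g : R -> rV -> rV) t x :
  lie_bracket f g t x = 'd (g t) x (f t x) - 'd (f t) x (g t x).
Proof. by rewrite /lie_bracket /jacobian !mul_rV_lin1. Qed.

(** The bracket as a map of the pair [(t, x)]. A2 bounds its [derive1] and its [jacobian], which
    yield Lipschitz estimates only for a differentiable map; differentiability in both variables
    comes from A1 through this joint form. *)
Let Lam (j k : 'I_m) (p : R * rV) : rV :=
  'd (F (lift ord0 k)) p (0, F (lift ord0 j) p) -
  'd (F (lift ord0 j)) p (0, F (lift ord0 k) p).

Let LamE j k t x : lie_bracket (inp b j) (inp b k) t x = Lam j k (t, x).
Proof. by rewrite lie_bracketE; congr (_ - _); exact: d_space. Qed.

Let dLam1 i l p : differentiable (fun q => 'd (F i) q (0, F l q)) p.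
Proof.
have -> : (fun q => 'd (F i) q (0, F l q)) =
    \sum_(k < n) (fun q => F l q 0 k *: 'd (F i) q (0, delta_mx 0 k)).
  apply/funext => q; rewrite fct_sumE.
  have -> : (0, F l q) = \sum_(k < n) F l q 0 k *: (0 : R, delta_mx 0 k : rV).
    rewrite [in LHS](row_sum_delta (F l q)).
    elim/big_rec2 : _ => // k y1 y2 _ <-; congr pair => /=.
    by rewrite scaler0 addr0.
  by rewrite linear_sum; apply: eq_bigr => k _; rewrite linearZ.
apply: differentiable_sum => k; apply: differentiable_mulv; last exact: ddF.
exact: (differentiable_comp (dF l p) (differentiable_coord (F l p) 0 k)).
Qed.

Let dLam j k p : differentiable (Lam j k) p.
Proof. by apply: differentiableB; exact: dLam1. Qed.

Let lie_anti j k t x : lie_bracket (inp b j) (inp b k) t x =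
  - lie_bracket (inp b k) (inp b j) t x.
Proof. by rewrite /lie_bracket opprB. Qed.

(** [Ks] is chosen after [t]: it comes from compactness of the box at this one time. *)
Lemma field_taylor i t rho : exists Ks, [/\ 0 <= Ks,
    forall x y, `|x| <= rho -> `|y| <= rho ->
      `|b i t y - b i t x - 'd (b i t) x (y - x)| <= Ks * `|y - x| ^+ 2 &
    forall x y w, `|x| <= rho -> `|y| <= rho ->
      `|'d (b i t) x w - 'd (b i t) y w| <= Ks * `|x - y| * `|w| ].
Proof.
have dE w : (fun x => 'd (b i t) x w) =
    (fun x => (fun p => 'd (F i) p (0, w)) (t, x)).
  by apply/funext => x; exact: d_space.
apply: taylor_box.
- by move=> x; exact: field_differentiable.
- move=> w x; rewrite dE.
  by have [] := differentiable_space_slice (ddF i (0, w)) t x.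
- move=> w z.
  have E x : 'd (fun x => 'd (b i t) x w) x z =
      'd (fun q => 'd (F i) q (0, w)) (t, x) (0, z).
    have [_ <-] := differentiable_space_slice (ddF i (0, w)) t x.
    exact: (congr1 (fun G : rV -> rV => 'd G x z) (dE w)).
  rewrite (funext E).
  move=> x; have cx : {for x, continuous (fun y : rV => (t, y))}.
    apply: differentiable_continuous.
    by apply: differentiable_pair; [exact: differentiable_cst|exact: ex_diff].
  apply: (@continuous_comp _ _ _ (fun y : rV => (t, y))
    (fun p => 'd (fun q => 'd (F i) q (0, w)) p (0, z)) x cx).
  exact (@cddF i (0, w) (0, z) (t, x)).
Qed.

(** The derivative bounds of A2 are integrated along segments of the box and along time, the passage
    between the norms costing a factor [n] for Jacobians. A2 treats brackets with [j <= k];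
    antisymmetry gives the others. *)
Lemma field_regularity rho : exists A A', [/\ 0 <= A, 0 <= A',
  [/\ forall i t x, `|x| <= rho -> `|b i t x| <= A,
      forall i t s x, `|x| <= rho -> `|b i t x - b i s x| <= A * `|t - s|,
      forall i t x w, `|x| <= rho -> `|'d (b i t) x w| <= A * `|w| &
      forall i t x y, `|x| <= rho -> `|y| <= rho ->
        `|b i t x - b i t y| <= A * `|x - y|],
  forall j k t x y, `|x| <= rho -> `|y| <= rho ->
    `|lie_bracket (inp b j) (inp b k) t x - lie_bracket (inp b j) (inp b k) t y|
      <= A' * `|x - y| &
  forall j k t s x, `|x| <= rho ->
    `|lie_bracket (inp b j) (inp b k) t x - lie_bracket (inp b j) (inp b k) s x|
      <= A' * `|t - s|].
Proof.
have [A1 [A2 [A3 [A4 [A5 [A6 [[A10 A20 A30] [[A40 A50 A60] H]]]]]]]] :=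
  hb2 (@compact_box R n rho).
have n0 : 0 <= n%:R :> R by [].
have A3n : 0 <= A3 * n%:R by exact: mulr_ge0.
have A5n : 0 <= A5 * n%:R by exact: mulr_ge0.
have time_lip (G : R -> rV) (C : R) : 0 <= C -> (forall t, differentiable G t) ->
    (forall t, `|'d G t 1| <= C) -> forall t s, `|G t - G s| <= C * `|t - s|.
  move=> C0 dG GC t s; wlog st : t s / s <= t.
    by move=> h; have [/h//|/ltW/h] := leP s t; rewrite distrC (distrC s).
  by rewrite (ger0_norm (x := t - s)) ?subr_ge0//; exact: mean_value_row.
have D3 i t x w : `|x| <= rho -> `|'d (b i t) x w| <= A3 * n%:R * `|w|.
  move=> xr; apply: diff_opnorm_bound; have [[_ _ h] _] := H x t xr; exact: h.
pose A := A1 + A2 + A3 * n%:R; pose A' := A5 * n%:R + A6.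
have AC (C c : R) : 0 <= c -> C <= A -> C * c <= A * c by move=> *; exact: ler_wpM2r.
have A'C (C c : R) : 0 <= c -> C <= A' -> C * c <= A' * c by move=> *; exact: ler_wpM2r.
exists A, A'; split; [by rewrite !addr_ge0|by rewrite addr_ge0| | |].
- split.
  + move=> i t x xr; have [[h _ _] _] := H x t xr.
    by apply: le_trans (norm_le_enorm _) _; apply: le_trans (h i) _; rewrite /A; lra.
  + move=> i t s x xr; apply: le_trans (_ : A2 * `|t - s| <= _); last by apply: AC => //; rewrite /A; lra.
    have dt r := differentiable_time_slice (dF i) r x.
    apply: (time_lip (fun r => b i r x)) => // r; first by have [] := dt r.
    have [[_ h _] _] := H x r xr; apply: le_trans (h i).
    rewrite derive1E'; last by have [] := dt r.
    exact: norm_le_enorm.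
  + by move=> i t x w xr; apply: le_trans (D3 i t x w xr) _; apply: AC => //; rewrite /A; lra.
  + move=> i t x y xr yr; apply: le_trans (_ : A3 * n%:R * `|x - y| <= _).
      by apply: (lipschitz_box _ (field_differentiable i t)) xr yr => // z w zr; exact: D3.
    by apply: AC => //; rewrite /A; lra.
- have le_case (j k : 'I_m) t x y : (j <= k)%N -> `|x| <= rho -> `|y| <= rho ->
    `|lie_bracket (inp b j) (inp b k) t x - lie_bracket (inp b j) (inp b k) t y|
      <= A' * `|x - y|.
    move=> jk xr yr; apply: le_trans (_ : A5 * n%:R * `|x - y| <= _); last first.
      by apply: A'C => //; rewrite /A'; lra.
    apply: (lipschitz_box (g := lie_bracket (inp b j) (inp b k) t)) xr yr => //.
      move=> z; rewrite (_ : lie_bracket _ _ _ = (fun y => Lam j k (t, y))).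
        by have [] := differentiable_space_slice (dLam j k) t z.
      by apply/funext => z'; exact: LamE.
    move=> z w zr; apply: diff_opnorm_bound.
    by have [_ [_ h _]] := H z t zr; exact: h.
  move=> j k t x y xr yr; have [jk|/ltnW kj] := leqP j k; first exact: le_case.
  by rewrite !(lie_anti j k) -opprD normrN; exact: le_case.
- have le_case (j k : 'I_m) t s x : (j <= k)%N -> `|x| <= rho ->
    `|lie_bracket (inp b j) (inp b k) t x - lie_bracket (inp b j) (inp b k) s x|
      <= A' * `|t - s|.
    move=> jk xr; apply: le_trans (_ : A6 * `|t - s| <= _); last first.
      by apply: A'C => //; rewrite /A'; lra.
    have E : (fun r => lie_bracket (inp b j) (inp b k) r x) = (fun r => Lam j k (r, x)).
      by apply/funext => r; exact: LamE.
    have dt r := differentiable_time_slice (dLam j k) r x.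
    apply: (time_lip (fun r => lie_bracket (inp b j) (inp b k) r x)) => // r.
      by rewrite E; have [] := dt r.
    have [_ [_ _ h]] := H x r xr; apply: le_trans (h _ _ jk).
    rewrite derive1E'; last by rewrite E; have [] := dt r.
    exact: norm_le_enorm.
  move=> j k t s x xr; have [jk|/ltnW kj] := leqP j k; first exact: le_case.
  rewrite !(lie_anti j k) -opprD normrN.
  exact: le_case.
Qed.

End Regularity.

(** * Lie bracket systems and integral paths *)

Section InputBounds.
Context {R : realType} {n m : nat}.
Local Notation rV := 'rV[R]_n.
Variables (b : 'I_m.+1 -> R -> rV -> rV) (u : 'I_m -> R -> R -> R) (T : R).
Hypotheses (hb1 : assumption1 b) (hb2 : assumption2 b) (hu3 : assumption3 u)
  (hu4 : assumption4 T u).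

Lemma input_bounds : exists L M, [/\ 0 <= L, 0 <= M,
  forall i t1 t2 theta, `|u i t1 theta - u i t2 theta| <= L * `|t1 - t2| &
  forall i t theta, `|u i t theta| <= M].
Proof.
have ex i : exists LM : R * R, [/\ 0 < LM.1, 0 < LM.2,
    forall t1 t2 theta, `|u i t1 theta - u i t2 theta| <= LM.1 * `|t1 - t2| &
    forall t theta, `|u i t theta| <= LM.2].
  by have [_ [L [M h]]] := hu3 i; exists (L, M).
have [LM hLM] := choice ex.
have L0 i : 0 <= (LM i).1 by have [/ltW] := hLM i.
have M0 i : 0 <= (LM i).2 by have [_ /ltW] := hLM i.
exists (\sum_i (LM i).1), (\sum_i (LM i).2); split; [exact: sumr_ge0|exact: sumr_ge0| |].
- move=> i t1 t2 theta; have [_ _ h _] := hLM i; apply: le_trans (h _ _ _) _.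
  by rewrite ler_wpM2r// (bigD1 i)//= lerDl sumr_ge0.
- move=> i t theta; have [_ _ _ h] := hLM i; apply: le_trans (h _ _) _.
  by rewrite (bigD1 i)//= lerDl sumr_ge0.
Qed.

Lemma input_slice_bmeas i s x y : bmeas x y (u i s).
Proof.
have [mu [L [M [_ _ hL hM]]]] := hu3 i.
exact: slice_bmeas mu hL hM s x y.
Qed.

Lemma input_oscillating_bmeas i (c x y : R) : 0 < c -> bmeas x y (fun t => u i t (c * t)).
Proof.
have [mu [L [M [_ _ hL hM]]]] := hu3 i.
move=> c0; exact: (oscillating_slice_bmeas mu hL hM x y c0).
Qed.

Let T0 : 0 < T. Proof. by have [] := hu4. Qed.

Let prim i s t := leb_int 0 t (u i s).

Let prim_bound (M : R) i s t : 0 <= M -> (forall i t theta, `|u i t theta| <= M) ->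
  0 <= t <= T -> `|prim i s t| <= T * M.
Proof.
move=> M0 hM /andP[t0 tT].
apply: le_trans (norm_leb_int_cst t0 (input_slice_bmeas i s 0 t) (M := M) _) _.
  by move=> r _; exact: hM.
by rewrite subr0 mulrC ler_wpM2r.
Qed.

Let prim_bmeas i s : bmeas 0 T (prim i s).
Proof.
have [L [M [_ _ _ hM]]] := input_bounds.
apply: (bmeas_lip (L := M)) => r t r0 rt tT.
rewrite /prim (leb_int_chasles r0 rt (input_slice_bmeas i s 0 t)) addrC addKr.
apply: (norm_leb_int_cst rt (input_slice_bmeas i s r t)) => q _; exact: hM.
Qed.

Lemma nu_regularity : exists2 N, 0 <= N & forall j i t s,
  `|nu T u j i t| <= N /\ `|nu T u j i t - nu T u j i s| <= N * `|t - s|.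
Proof.
have [L [M [L0 M0 hL hM]]] := input_bounds; have T00 := ltW T0.
have TM0 : 0 <= T * M by exact: mulr_ge0.
have mI j i s : bmeas 0 T (fun theta => u j s theta * prim i s theta).
  by apply: bmeasM; [exact: input_slice_bmeas|exact: prim_bmeas].
have c1 : 0 <= M * (T * M) by exact: mulr_ge0.
have c2 : 0 <= L * (T * M) + M * (T * L) by rewrite addr_ge0 ?mulr_ge0.
exists (M * (T * M) + (L * (T * M) + M * (T * L))); first by rewrite addr_ge0.
have Tinv (x y : R) : `|x| <= y * (T - 0) -> `|T^-1 * x| <= y.
  by rewrite subr0 => h; rewrite normrM ger0_norm ?invr_ge0// mulrC ler_pdivrMr.
move=> j i t s; split.
  apply: Tinv; apply: le_trans (_ : M * (T * M) * (T - 0) <= _); last first.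
    by rewrite subr0 ler_wpM2r// lerDl.
  apply: (norm_leb_int_cst T00 (mI j i t)) => r rT; rewrite normrM ler_pM//.
  exact: prim_bound.
rewrite /nu -mulrBr; apply: Tinv.
apply: le_trans (_ : (L * (T * M) + M * (T * L)) * `|t - s| * (T - 0) <= _); last first.
  by rewrite subr0 ler_wpM2r// ler_wpM2r// lerDr.
rewrite -(leb_intB (mI j i t) (mI j i s)).
apply: (norm_leb_int_cst T00 (bmeasB (mI j i t) (mI j i s))) => r rT.
have -> : u j t r * prim i t r - u j s r * prim i s r =
    (u j t r - u j s r) * prim i t r + u j s r * (prim i t r - prim i s r) by ring.
apply: le_trans (ler_normD _ _) _; rewrite !normrM [leRHS]mulrDl; apply: lerD.
  by rewrite mulrAC; apply: ler_pM => //; exact: prim_bound.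
rewrite -mulrA; apply: ler_pM => //; have /andP[r0 r1] := rT.
rewrite /prim -(leb_intB (input_slice_bmeas i t 0 r) (input_slice_bmeas i s 0 r)).
apply: le_trans (norm_leb_int_cst r0 (M := L * `|t - s|) _ _) _.
- exact: bmeasB (input_slice_bmeas i t 0 r) (input_slice_bmeas i s 0 r).
- by move=> q _; exact: hL.
- by rewrite subr0 mulrC -mulrA ler_wpM2r// mulr_ge0.
Qed.

Lemma lie_bracket_system_regularity rho : exists2 V, 0 <= V & [/\
  forall t x, `|x| <= rho -> `|lie_bracket_system T b u t x| <= V,
  forall t s x, `|x| <= rho ->
    `|lie_bracket_system T b u t x - lie_bracket_system T b u s x| <= V * `|t - s| &
  forall t x y, `|x| <= rho -> `|y| <= rho ->
    `|lie_bracket_system T b u t x - lie_bracket_system T b u t y| <= V * `|x - y|].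
Proof.
have [A [A' [A0 A'0 [bA bt bD bx] lx lt]]] := field_regularity hb1 hb2 rho.
have [N N0 hN] := nu_regularity.
have lA i j t x : `|x| <= rho -> `|lie_bracket (inp b i) (inp b j) t x| <= 2 * A * A.
  move=> xr; rewrite lie_bracketE; apply: le_trans (ler_normB _ _) _.
  have h k l : `|'d (inp b k t) x (inp b l t x)| <= A * A.
    apply: le_trans (bD _ _ _ _ xr) _; rewrite ler_wpM2l//; exact: bA.
  by have := h j i; have := h i j; lra.
have dsum (F : 'I_m -> 'I_m -> rV) (C : R) : 0 <= C -> (forall i j, `|F i j| <= C) ->
    `|\sum_(i < m) \sum_(j < m | (i < j)%N) F i j| <= m%:R * (m%:R * C).
  move=> C0 hF; apply: norm_sum_ord_le => i; rewrite big_mkcond.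
  by apply: norm_sum_ord_le => j; case: ifP => _; rewrite ?normr0.
have scale_diff (k l : R) (p q : rV) : k *: p - l *: q = (k - l) *: p + l *: (p - q).
  by apply/rowP => i; rewrite !mxE; ring.
pose c := m%:R * (m%:R * (N * (2 * A * A))); pose c' := m%:R * (m%:R * (N * A')).
have c0 : 0 <= c by rewrite !mulr_ge0.
have c'0 : 0 <= c' by rewrite !mulr_ge0.
exists (A + c + c'); first by rewrite !addr_ge0.
rewrite /lie_bracket_system; split.
- move=> t x xr; apply: le_trans (_ : A + c <= _); last by rewrite lerDl.
  apply: le_trans (ler_normD _ _) _; apply: lerD; first exact: bA.
  apply: dsum => [|i j]; first by rewrite !mulr_ge0.
  by rewrite normrZ ler_pM//; [have [] := hN j i t t|exact: lA].
- move=> t s x xr; rewrite opprD addrACA; apply: le_trans (ler_normD _ _) _.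
  rewrite -(addrA A) [leRHS]mulrDl; apply: lerD; first exact: bt.
  rewrite -sumrB; under eq_bigr do rewrite -sumrB.
  have -> : (c + c') * `|t - s| =
      m%:R * (m%:R * ((N * (2 * A * A) + N * A') * `|t - s|)) by rewrite /c /c'; ring.
  apply: dsum => [|i j]; first by rewrite mulr_ge0// addr_ge0// !mulr_ge0.
  rewrite scale_diff.
  apply: le_trans (ler_normD _ _) _; rewrite 2!normrZ [leRHS]mulrDl; apply: lerD.
    rewrite [leRHS]mulrAC; apply: ler_pM => //; last exact: lA.
    by have [] := hN j i t s.
  rewrite -[leRHS]mulrA; apply: ler_pM => //; last exact: lt.
  by have [] := hN j i s s.
- move=> t x y xr yr; rewrite opprD addrACA; apply: le_trans (ler_normD _ _) _.
  apply: le_trans (_ : (A + c') * `|x - y| <= _); last first.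
    by rewrite ler_wpM2r// addrAC lerDl.
  rewrite [leRHS]mulrDl; apply: lerD; first exact: bx.
  rewrite -sumrB; under eq_bigr do rewrite -sumrB.
  have -> : c' * `|x - y| = m%:R * (m%:R * (N * A' * `|x - y|)) by rewrite /c'; ring.
  apply: dsum => [|i j]; first by rewrite !mulr_ge0.
  rewrite -scalerBr normrZ -[leRHS]mulrA; apply: ler_pM => //; last exact: lx.
  by have [] := hN j i t t.
Qed.

End InputBounds.

Section Paths.
Context {R : realType} {n : nat}.
Local Notation rV := 'rV[R]_n.
Implicit Types (f : R -> rV -> rV) (x : R -> rV).

(** Solutions in increment form on a bounded interval: such paths can be restricted and restarted at
    any time, whereas [is_solution] is tied to its initial time and to a half-line. *)
Definition integral_path f (a b : R) x :=
  vmeas a b (fun r => f r (x r)) /\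
  forall s t, a <= s -> s <= t -> t <= b ->
    x t - x s = vint s t (fun r => f r (x r)).

Lemma integral_path_sub f a b a' b' x : a <= a' -> b' <= b ->
  integral_path f a b x -> integral_path f a' b' x.
Proof.
move=> aa' bb' [mf xI]; split; first exact: vmeas_sub mf.
by move=> s t a's st tb'; apply: xI => //; [exact: le_trans a's|exact: le_trans bb'].
Qed.

Lemma integral_path_lip f a b x V s t : integral_path f a b x ->
  (forall r, a <= r <= b -> `|f r (x r)| <= V) ->
  a <= s -> s <= t -> t <= b -> `|x t - x s| <= V * (t - s).
Proof.
move=> [mf xI] fV as_ st tb; rewrite (xI _ _ as_ st tb).
apply: (norm_vint_cst st (vmeas_sub as_ tb mf)) => r /andP[sr rt].
by apply: fV; rewrite (le_trans as_)//= (le_trans rt).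
Qed.

Lemma integral_path_rescale f s c (b : R) x : 0 < c -> 
  integral_path f s (s + c * b) x ->
  vmeas 0 b (fun r => c *: f (s + c * r) (x (s + c * r))) /\
  forall p q, 0 <= p -> p <= q -> q <= b -> x (s + c * q) - x (s + c * p) =
    vint p q (fun r => c *: f (s + c * r) (x (s + c * r))).
Proof.
move=> c0 [mf xI].
have m1 p q : 0 <= p -> p <= q -> q <= b ->
    vmeas (s + c * p) (s + c * q) (fun r => f r (x r)).
  move=> p0 pq qb; apply: vmeas_sub mf; first by rewrite lerDl mulr_ge0// ltW.
  by rewrite lerD2l ler_pM2l.
split.
  have [b0|b0] := leP 0 b.
    apply: vmeasZ; first exact: bmeas_cst.
    apply: (@vmeas_affine _ _ s c 0 b (fun r => f r (x r)) c0).
    by rewrite mulr0 addr0; have := m1 0 b (lexx _) b0 (lexx _); rewrite mulr0 addr0.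
  move=> k; apply: (bmeas_lip (L := 0)) => p q p0 pq qb.
  by have := le_lt_trans (le_trans p0 (le_trans pq qb)) b0; rewrite ltxx.
move=> p q p0 pq qb; rewrite xI.
- rewrite (vint_affine c0 pq (m1 _ _ p0 pq qb)) vintZ; first by [].
  exact: (@vmeas_affine _ _ s c p q (fun r => f r (x r)) c0 (m1 _ _ p0 pq qb)).
- by rewrite lerDl mulr_ge0// ltW.
- by rewrite lerD2l ler_pM2l.
- by rewrite lerD2l ler_pM2l.
Qed.

Lemma euler_step f rho V s h x : 0 <= V -> 0 <= h ->
  (forall t (y : rV), `|y| <= rho -> `|f t y| <= V) ->
  (forall t s (y : rV), `|y| <= rho -> `|f t y - f s y| <= V * `|t - s|) ->
  (forall t (y z : rV), `|y| <= rho -> `|z| <= rho -> `|f t y - f t z| <= V * `|y - z|) ->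
  integral_path f s (s + h) x ->
  (forall r, s <= r <= s + h -> `|x r| <= rho) ->
  `|x (s + h) - x s - h *: f s (x s)| <= (V + V * V) * h ^+ 2.
Proof.
move=> V0 h0 fV ft fx px xr.
have sh : s <= s + h by rewrite lerDl.
have [mf xI] := px; rewrite (xI _ _ (lexx s) sh (lexx _)).
have -> : h *: f s (x s) = vint s (s + h) (fun=> f s (x s)).
  by rewrite vint_cst// addrC addKr.
rewrite -(vintB mf (vmeas_cst _ _ _)).
have hs : s + h - s = h by rewrite addrC addKr.
apply: le_trans (norm_vint_cst sh (vmeasB mf (vmeas_cst _ _ _)) (M := (V + V * V) * h) _) _; last first.
  by rewrite hs expr2 mulrA.
move=> r rI; have /andP[sr rsh] := rI.
have s_in : s <= s <= s + h by rewrite lexx.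
have rs : `|r - s| <= h by rewrite ger0_norm ?subr_ge0//; lra.
have -> : f r (x r) - f s (x s) = (f r (x r) - f s (x r)) + (f s (x r) - f s (x s)).
  by rewrite addrA subrK.
apply: le_trans (ler_normD _ _) _; rewrite [leRHS]mulrDl; apply: lerD.
  by apply: le_trans (ft _ _ _ (xr _ rI)) _; rewrite ler_wpM2l.
apply: le_trans (fx _ _ _ (xr _ rI) (xr _ s_in)) _.
rewrite -mulrA ler_wpM2l//; apply: le_trans (integral_path_lip px (V := V) _ _ sr rsh) _ => //.
  by move=> q qI; exact/fV/xr.
by rewrite ler_wpM2l//; lra.
Qed.

End Paths.

Section OnePeriod.
Context {R : realType} {n m : nat}.
Local Notation rV := 'rV[R]_n.
Variables (b : 'I_m.+1 -> R -> rV -> rV) (u : 'I_m -> R -> R -> R) (T rho : R).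
Hypotheses (hb1 : assumption1 b) (hb2 : assumption2 b) (hu3 : assumption3 u)
  (hu4 : assumption4 T u) (rho1 : 1 <= rho).

Lemma input_affine_bound : exists2 V, 0 <= V & forall omega t x, `|x| <= rho ->
  `|input_affine b u omega t x| <= V + V * Num.sqrt omega.
Proof.
have [A [A' [A0 _ [bA _ _ _] _ _]]] := field_regularity hb1 hb2 rho.
have [L [M [_ M0 _ hM]]] := input_bounds hu3.
have c0 : 0 <= m%:R * (M * A) by rewrite !mulr_ge0.
exists (A + m%:R * (M * A)); first by rewrite addr_ge0.
move=> omega t x xr; apply: le_trans (ler_normD _ _) _; apply: lerD.
  by apply: le_trans (bA _ _ _ xr) _; rewrite lerDl.
apply: le_trans (_ : m%:R * (Num.sqrt omega * M * A) <= _).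
  apply: norm_sum_ord_le => i; rewrite normrZ normrM (ger0_norm (sqrtr_ge0 _)).
  apply: ler_pM; [by rewrite mulr_ge0 ?sqrtr_ge0|by []| |exact: bA].
  by rewrite ler_wpM2l ?sqrtr_ge0.
have -> : m%:R * (Num.sqrt omega * M * A) = m%:R * (M * A) * Num.sqrt omega by ring.
by rewrite ler_wpM2r ?sqrtr_ge0// lerDr.
Qed.

Lemma one_period_estimate : exists K e1, [/\ 0 <= K, 0 < e1 &
  forall omega s x, 0 < omega ->
  let e := (Num.sqrt omega)^-1 in e <= e1 ->
  (forall i t r, u i t (omega * (s + e ^+ 2 * r)) = u i t r) ->
  integral_path (input_affine b u omega) s (s + e ^+ 2 * T) x ->
  (forall r, s <= r <= s + e ^+ 2 * T -> `|x r| <= rho) ->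
  `|x s| <= rho - 1 ->
  `|x (s + e ^+ 2 * T) - x s - (e ^+ 2 * T) *: lie_bracket_system T b u s (x s)|
    <= K * e ^+ 3].
Proof.
have [A [A' [A0 A'0 [bA bt bD bx] lx lt]]] := field_regularity hb1 hb2 rho.
have [L [M [L0 M0 hL hM]]] := input_bounds hu3.
have [T0 hu] := hu4; have T00 := ltW T0.
pose N := m%:R * (M * A); have N0 : 0 <= N by rewrite !mulr_ge0.
(* [e ^+ 3 * Q] is the cost of freezing the slow time in the inputs and their fields, at amplitude
   [e] during [e ^+ 2 * T]. [C1 * e ^+ 2] bounds the distance to the loop, [K2] adds the variation
   of [b ord0] to these errors, and [K3] is the constant of [frozen_displacement]. *)
pose Q := m%:R * (L * T * A + M * (A * T)).
have Q0 : 0 <= Q by rewrite mulr_ge0// addr_ge0 ?mulr_ge0.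
pose C1 := 2 * (T * (A + Q)).
have C10 : 0 <= C1 by rewrite mulr_ge0// mulr_ge0// addr_ge0.
pose K2 := A * T + A * (C1 + N * T) + Q + N * C1.
have K20 : 0 <= K2 by rewrite !(addr_ge0, mulr_ge0).
pose K3 := T * T * N * (m%:R * (m%:R * (M * (T * M) * A'))) + 2 * T * T * N * (2 * T * N ^+ 2).
have K30 : 0 <= K3 by rewrite addr_ge0 ?mulr_ge0 ?sqr_ge0.
pose e1 := Num.min 1 ((2 * (T * N + 1))^-1).
have TN1 : 0 < 2 * (T * N + 1) by rewrite mulr_gt0// ltr_wpDl// mulr_ge0.
exists (K2 * T + K3), e1; split; first by rewrite addr_ge0// mulr_ge0.
  by rewrite lt_min ltr01 invr_gt0.
move=> omega s x w0 e ee1 phase px xr x_s.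
have sw0 : 0 < Num.sqrt omega by rewrite sqrtr_gt0.
have e0 : 0 < e by rewrite invr_gt0.
have e00 := ltW e0.
have e_le1 : e <= 1 by apply: le_trans ee1 _; rewrite ge_min lexx.
have e_small : e * (T * N) <= 2^-1.
  have : e <= (2 * (T * N + 1))^-1 by apply: le_trans ee1 _; rewrite ge_min lexx orbT.
  rewrite -[_^-1]mul1r ler_pdivlMr// => h.
  by move: h e00; move: (T * N) => k; lra.
have eN_T S : 0 <= S -> e * N * S * T <= S / 2.
  move=> S0; have -> : e * N * S * T = S * (e * (T * N)) by ring.
  by rewrite ler_wpM2l.
have e2 : 0 < e ^+ 2 by rewrite exprn_gt0.
have e2w : e ^+ 2 * Num.sqrt omega = e by rewrite expr2 -mulrA mulVf ?mulr1// gt_eqF.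
have [mX XI] := integral_path_rescale e2 px.
pose X r := x (s + e ^+ 2 * r).
pose H0 r := e ^+ 2 *: input_affine b u omega (s + e ^+ 2 * r) (X r).
have X0 : X 0 = x s by rewrite /X mulr0 addr0.
have Xr r : 0 <= r <= T -> `|X r| <= rho.
  by move=> /andP[r0 rT]; apply: xr; rewrite lerDl mulr_ge0 ?lerD2l ?ler_wpM2l// ltW.
pose beta (i : 'I_m) := inp b i s.
pose D (i : 'I_m) (z : rV) : {linear rV -> rV} := 'd (inp b i s) z.
pose v (i : 'I_m) := u i s.
(* This [Ks] depends on [s], unlike [K2], [K3] and [e1], which are already fixed. *)
have [Ks [Ks0 hT hD]] : exists Ks, [/\ 0 <= Ks,
    forall i x y, `|x| <= rho -> `|y| <= rho ->
      `|beta i y - beta i x - D i x (y - x)| <= Ks * `|y - x| ^+ 2 &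
    forall i x y w, `|x| <= rho -> `|y| <= rho ->
      `|D i x w - D i y w| <= Ks * `|x - y| * `|w| ].
  have [k hk] := choice (fun i : 'I_m => field_taylor hb1 (lift ord0 i) s rho).
  have k0 i : 0 <= k i by have [] := hk i.
  have ks i : k i <= \sum_j k j by rewrite (bigD1 i)//= lerDl sumr_ge0.
  exists (\sum_j k j); split; first exact: sumr_ge0.
    move=> i y z yr zr; have [_ h _] := hk i; apply: le_trans (h _ _ yr zr) _.
    by rewrite ler_wpM2r ?sqr_ge0.
  move=> i y z w yr zr; have [_ _ h] := hk i; apply: le_trans (h _ _ _ yr zr) _.
  by rewrite ler_wpM2r// ler_wpM2r.
have v_bmeas i p q : bmeas p q (v i) by exact: input_slice_bmeas.
have v_bound i t : `|v i t| <= M by exact: hM.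
have v_mean i : leb_int 0 T (v i) = 0 by have [] := hu i s 0.
have beta_bound i z : `|z| <= rho -> `|beta i z| <= A by exact: bA.
have D_bound i z w : `|z| <= rho -> `|D i z w| <= A * `|w| by exact: bD.
have beta_lip i y z : `|y| <= rho -> `|z| <= rho -> `|beta i y - beta i z| <= A * `|y - z|.
  exact: bx.
have brE l i z : frozen_bracket beta D l i z = lie_bracket (inp b l) (inp b i) s z.
  by rewrite lie_bracketE.
have br_lip l i y z : `|y| <= rho -> `|z| <= rho ->
    `|frozen_bracket beta D l i y - frozen_bracket beta D l i z| <= A' * `|y - z|.
  by rewrite !brE; exact: lx.
have [W [Wr WL W0 WI] hW] := frozen_displacement T0 M0 A0 A'0 Ks0 rho1 v_bmeas
  v_bound v_mean beta_bound D_bound beta_lip hT hD br_lip x_s e00 e_small.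
have drift := frozen_drift_brackets beta D T0 M0 v_bmeas v_bound v_mean (x s).
have mW : vmeas 0 T (fun r => e *: frozen_field beta v r (W r)).
  apply: vmeasZ; first exact: bmeas_cst.
  exact: (frozen_field_vmeas A0 v_bmeas beta_lip Wr WL).
have XW t : 0 <= t -> t <= T ->
    X t - W t = vint 0 t (fun r => H0 r - e *: frozen_field beta v r (W r)).
  move=> t0 tT; rewrite vintB.
  - rewrite -(XI 0 t (lexx _) t0 tT) -(WI 0 t (lexx _) t0 tT).
    rewrite mulr0 addr0 W0 /X; move: (x _) (W t) (x s) => y1 y2 y3.
    by rewrite opprB addrA subrK.
  - exact: (vmeas_sub (lexx 0) tT mX).
  - exact: (vmeas_sub (lexx 0) tT mW).
pose b0 t z := b ord0 t z.
(* Once the drift is removed, three differences remain: the slow time in the inputs, the slow time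
   in the fields, and the positions [X r] and [W r]. *)
have diff_bound r : 0 <= r <= T ->
    `|H0 r - e *: frozen_field beta v r (W r) - e ^+ 2 *: b0 (s + e ^+ 2 * r) (X r)|
      <= e ^+ 3 * Q + e * N * `|X r - W r|.
  move=> rT; have /andP[r0 r1] := rT; pose t := s + e ^+ 2 * r.
  have ts : `|t - s| <= e ^+ 2 * T.
    by rewrite /t addrC addKr ger0_norm ?ler_wpM2l// ?mulr_ge0// ltW.
  have -> : H0 r - e *: frozen_field beta v r (W r) - e ^+ 2 *: b0 t (X r) =
      \sum_(i < m) e *: ((u i t r - v i r) *: inp b i t (X r) +
        (v i r *: (inp b i t (X r) - inp b i s (X r)) +
         v i r *: (beta i (X r) - beta i (W r)))).
    have cancel (c : R) (y1 y2 y3 : rV) : c *: (y1 + y2) - y3 - c *: y1 = c *: y2 - y3.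
      by apply/rowP => k; rewrite !mxE; ring.
    rewrite /H0 /input_affine -/t -/(b0 t (X r)) cancel.
    rewrite /frozen_field !scaler_sumr -sumrB; apply: eq_bigr => i _.
    rewrite phase scalerA mulrA e2w -scalerA -scalerBr; congr (_ *: _).
    rewrite /beta; move: (inp b i t (X r)) (inp b i s (X r)) (inp b i s (W r)) => y1 y2 y3.
    by apply/rowP => k; rewrite !mxE; ring.
  apply: le_trans (_ : m%:R * (e * (L * (e ^+ 2 * T) * A +
      (M * (A * (e ^+ 2 * T)) + M * (A * `|X r - W r|)))) <= _); last first.
    by rewrite le_eqVlt; apply/orP; left; apply/eqP; rewrite /Q /N; ring.
  have e2T : 0 <= e ^+ 2 * T by rewrite mulr_ge0// ltW.
  apply: norm_sum_ord_le => i; rewrite normrZ (ger0_norm e00) ler_wpM2l//.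
  apply: le_trans (ler_normD _ _) _; apply: lerD.
    rewrite normrZ; apply: ler_pM => //; last exact: bA (Xr _ rT).
    by apply: le_trans (hL _ _ _ _) _; rewrite ler_wpM2l.
  apply: le_trans (ler_normD _ _) _; apply: lerD; rewrite normrZ; apply: ler_pM => //.
    by apply: le_trans (bt _ _ _ _ (Xr _ rT)) _; rewrite ler_wpM2l.
  exact: beta_lip (Xr _ rT) (Wr _ rT).
have e3 : e ^+ 3 <= e ^+ 2 by rewrite exprSr ler_piMr// ltW.
have mE : vmeas 0 T (fun r => H0 r - e *: frozen_field beta v r (W r)).
  by apply: vmeasB; [exact: mX|exact: mW].
(* A rough bound that counts the whole drift as an error; [step2] uses it to compare with the drift
   itself. *)
have XW_le t : 0 <= t <= T -> `|X t - W t| <= C1 * e ^+ 2.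
  have -> : C1 * e ^+ 2 = 2 * (T * (A + Q) * e ^+ 2) by rewrite /C1; ring.
  apply: (@half_sup_bound _ 0 T _ (rho + rho) (fun t => `|X t - W t|)).
    move=> r rT; apply: le_trans (ler_normB _ _) _; apply: lerD; [exact: Xr|exact: Wr].
  move=> S hS r rT; have S0 : 0 <= S by apply: le_trans (hS _ rT).
  have /andP[r0 r1] := rT; rewrite (XW _ r0 r1).
  pose c3 := (A + Q) * e ^+ 2 + e * N * S.
  have c30 : 0 <= c3 by rewrite !(addr_ge0, mulr_ge0)// ltW.
  apply: le_trans (_ : c3 * (r - 0) <= _).
    apply: (norm_vint_cst r0 (vmeas_sub (lexx 0) r1 mE)) => q /andP[q0 q1].
    have qT : 0 <= q <= T by rewrite q0 (le_trans q1).
    rewrite -[X in `|X|](subrK (e ^+ 2 *: b0 (s + e ^+ 2 * q) (X q))).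
    apply: le_trans (ler_normD _ _) _; apply: le_trans (lerD (diff_bound _ qT) (lexx _)) _.
    have h1 : `|e ^+ 2 *: b0 (s + e ^+ 2 * q) (X q)| <= e ^+ 2 * A.
      by rewrite normrZ (ger0_norm (ltW e2)) ler_wpM2l ?(ltW e2)//; exact: bA (Xr _ qT).
    have h2 : e * N * `|X q - W q| <= e * N * S by rewrite ler_wpM2l ?mulr_ge0// hS.
    have h3 : e ^+ 3 * Q <= e ^+ 2 * Q by rewrite ler_wpM2r.
    apply: le_trans (lerD (lerD h3 h2) h1) _.
    by rewrite le_eqVlt; apply/orP; left; apply/eqP; rewrite /c3; ring.
  rewrite subr0; apply: le_trans (_ : c3 * T <= _); first by rewrite ler_wpM2l.
  rewrite /c3 mulrDl; apply: lerD; last exact: eN_T.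
  by rewrite le_eqVlt; apply/orP; left; apply/eqP; ring.
have mb0 : vmeas 0 T (fun=> e ^+ 2 *: b0 s (x s)) by exact: vmeas_cst.
have step2 : `|X T - W T - (e ^+ 2 * T) *: b0 s (x s)| <= K2 * e ^+ 3 * T.
  have -> : (e ^+ 2 * T) *: b0 s (x s) = vint 0 T (fun=> e ^+ 2 *: b0 s (x s)).
    by rewrite vint_cst// subr0 scalerA mulrC.
  rewrite (XW _ T00 (lexx _)) -(vintB mE mb0).
  apply: le_trans (norm_vint_cst T00 (vmeasB mE mb0) (M := K2 * e ^+ 3) _) _; last by rewrite subr0.
  move=> r rT; have /andP[r0 r1] := rT.
  have -> : H0 r - e *: frozen_field beta v r (W r) - e ^+ 2 *: b0 s (x s) =
    (H0 r - e *: frozen_field beta v r (W r) - e ^+ 2 *: b0 (s + e ^+ 2 * r) (X r)) +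
    e ^+ 2 *: ((b0 (s + e ^+ 2 * r) (X r) - b0 s (X r)) + (b0 s (X r) - b0 s (x s))).
    by rewrite addrA subrK scalerBr addrA subrK.
  apply: le_trans (ler_normD _ _) _; apply: le_trans (lerD (diff_bound _ rT) (lexx _)) _.
  have xsr : `|x s| <= rho by apply: le_trans x_s _; rewrite gerBl.
  have h1 : `|b0 (s + e ^+ 2 * r) (X r) - b0 s (X r)| <= A * (e * T).
    apply: le_trans (bt _ _ _ _ (Xr _ rT)) _; rewrite ler_wpM2l//.
    rewrite addrC addKr ger0_norm ?mulr_ge0 ?(ltW e2)//; apply: ler_pM => //; first exact: ltW.
    by rewrite expr2 ler_piMl.
  have h4 := XW_le _ rT.
  have h5 : `|X r - x s| <= (C1 + N * T) * e.
    have h6 := WL 0 r (lexx _) r0 r1; rewrite W0 subr0 in h6.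
    have h7 : e * N * r <= e * N * T by rewrite ler_wpM2l// mulr_ge0.
    have h8 : C1 * e ^+ 2 <= C1 * e by rewrite ler_wpM2l// expr2 ler_piMl.
    have h9 := ler_distD (W r) (X r) (x s).
    have -> : (C1 + N * T) * e = C1 * e + e * N * T by ring.
    by apply: le_trans h9 _; apply: lerD; [exact: le_trans h4 h8|exact: le_trans h6 h7].
  have h2 : `|b0 s (X r) - b0 s (x s)| <= A * ((C1 + N * T) * e).
    by apply: le_trans (bx _ _ _ _ (Xr _ rT) xsr) _; rewrite ler_wpM2l.
  have h3 : e * N * `|X r - W r| <= e * N * (C1 * e ^+ 2) by rewrite ler_wpM2l ?mulr_ge0.
  rewrite normrZ (ger0_norm (ltW e2)).
  have h10 := ler_normD (b0 (s + e ^+ 2 * r) (X r) - b0 s (X r)) (b0 s (X r) - b0 s (x s)).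
  have h11 : e ^+ 2 * `|b0 (s + e ^+ 2 * r) (X r) - b0 s (X r) + (b0 s (X r) - b0 s (x s))| <=
      e ^+ 2 * (A * (e * T) + A * ((C1 + N * T) * e)).
    by apply: ler_wpM2l; [exact: ltW|apply: le_trans h10 _; apply: lerD].
  have -> : K2 * e ^+ 3 = e ^+ 3 * Q + e * N * (C1 * e ^+ 2) +
      e ^+ 2 * (A * (e * T) + A * ((C1 + N * T) * e)) by rewrite /K2; ring.
  by apply: lerD => //; apply: lerD.
have LBE : (e ^+ 2 * T) *: lie_bracket_system T b u s (x s) =
    (e ^+ 2 * T) *: b0 s (x s) + (e ^+ 2 / 2) *: frozen_drift beta D v T (x s).
  rewrite /lie_bracket_system scalerDr; congr (_ + _).
  rewrite -[in RHS]scalerA drift !scaler_sumr; apply: eq_bigr => i _.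
  rewrite !scaler_sumr; apply: eq_bigr => j _; rewrite brE !scalerA; congr (_ *: _).
  by rewrite /nu /v; field; rewrite gt_eqF.
rewrite LBE -/(X T).
have -> : X T - x s - ((e ^+ 2 * T) *: b0 s (x s) + (e ^+ 2 / 2) *: frozen_drift beta D v T (x s)) =
  (X T - W T - (e ^+ 2 * T) *: b0 s (x s)) +
  (W T - x s - (e ^+ 2 / 2) *: frozen_drift beta D v T (x s)).
  move: (X T) (W T) (x s) (b0 s (x s)) (frozen_drift _ _ _ _ _) => y1 y2 y3 y4 y5.
  by apply/rowP => k; rewrite !mxE; ring.
apply: le_trans (ler_normD _ _) _; rewrite [leRHS]mulrDl; apply: lerD => //.
by apply: le_trans step2 _; rewrite mulrAC.
Qed.

End OnePeriod.

(** * Closeness of trajectories *)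

Section Approximation.
Context {R : realType} {n m : nat}.
Local Notation rV := 'rV[R]_n.

Lemma vmeas_bounded a b (g : R -> rV) : vmeas a b g ->
  exists2 B, 0 <= B & forall r, a <= r <= b -> `|g r| <= B.
Proof.
move=> mg; have [M hM] := choice (fun k => (mg k).2).
exists (\sum_k `|M k|); first exact: sumr_ge0.
move=> r rab; apply: row_norm_le; first exact: sumr_ge0.
move=> k; apply: le_trans (hM k r rab) _; apply: le_trans (ler_norm _) _.
by rewrite (bigD1 k)//= lerDl sumr_ge0.
Qed.

(* On a subdivision finer than the slack 1 - V * (c - a), the path cannot leave
   the ball within one step. *)
Lemma integral_path_stays (f : R -> rV -> rV) (rho V a c : R) (x : R -> rV) :
  a <= c -> 0 <= V -> (forall t y, `|y| <= rho -> `|f t y| <= V) ->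
  integral_path f a c x -> V * (c - a) < 1 -> `|x a| <= rho - 1 ->
  forall r, a <= r <= c -> `|x r| <= rho.
Proof.
move=> ac V0 fV px Vca xa.
have [B B0 hB] := vmeas_bounded px.1.
have xlip s t : a <= s -> s <= t -> t <= c -> `|x t - x s| <= B * (t - s).
  by move=> as_ st tc; exact: (integral_path_lip px hB).
pose gap := 1 - V * (c - a).
have gap0 : 0 < gap by rewrite subr_gt0.
have ca0 : 0 <= c - a by rewrite subr_ge0.
pose N := Num.trunc (B * (c - a) / gap).
have hN : B * ((c - a) / N.+1%:R) <= gap.
  have /truncn_itv/andP[_] : 0 <= B * (c - a) / gap.
    by rewrite divr_ge0 ?mulr_ge0// ltW.
  rewrite -/N ltr_pdivrMr// => /ltW h.
  by rewrite mulrA ler_pdivrMr ?ltr0n// [leRHS]mulrC.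
pose eta := (c - a) / N.+1%:R.
have eta0 : 0 <= eta by rewrite divr_ge0.
have node k : (k <= N.+1)%N -> forall r, a <= r <= a + eta * k%:R -> r <= c -> `|x r| <= rho.
  elim: k => [|k IH] kN r.
    rewrite mulr0 addr0 => /andP[ar ra] _; have -> : r = a by apply/eqP; rewrite eq_le ra.
    by apply: le_trans xa _; rewrite gerBl.
  move=> /andP[ar rk1] rc; have box := IH (ltnW kN).
  have [rk|/ltW rk] := leP r (a + eta * k%:R); first by apply: box => //; rewrite ar.
  pose s := a + eta * k%:R; have as_ : a <= s by rewrite lerDl mulr_ge0.
  have sc : s <= c by apply: le_trans rc.
  have h1 : `|x s - x a| <= V * (s - a).
    have ps := integral_path_sub (lexx a) sc px.
    apply: (integral_path_lip ps) => // q /andP[aq qs]; apply: fV; apply: box => //.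
      by rewrite aq.
    exact: le_trans sc.
  have h2 := xlip s r as_ rk rc.
  have h3 : V * (s - a) <= V * (c - a) by rewrite ler_wpM2l// lerD2r.
  have h4 : B * (r - s) <= B * eta.
    rewrite ler_wpM2l// /s; move: rk1; rewrite -natr1; lra.
  have h5 := ler_distD (x s) (x r) (x a); have h6 := ler_distD (x a) (x r) 0.
  rewrite !subr0 in h6; rewrite -/eta in hN; rewrite /gap in hN; move: xa; lra.
move=> r /andP[ar rc]; apply: (node N.+1) => //; rewrite ar /=.
by rewrite /eta mulfVK ?pnatr_eq0//; lra.
Qed.

Variables (b : 'I_m.+1 -> R -> rV -> rV) (u : 'I_m -> R -> R -> R) (T rho : R).
Hypotheses (hb1 : assumption1 b) (hb2 : assumption2 b) (hu3 : assumption3 u)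
  (hu4 : assumption4 T u) (rho1 : 1 <= rho).

Lemma input_periodic i t (k : int) r : u i t (k%:~R * T + r) = u i t r.
Proof.
have [_ hu] := hu4.
have per (p : nat) r' : u i t (r' + p%:R * T) = u i t r'.
  elim: p => [|p IH]; first by rewrite mul0r addr0.
  by rewrite -natr1 mulrDl mul1r addrA (hu i t _).1.
case: k => p; first by rewrite addrC -[RHS](per p) pmulrn.
rewrite NegzE -[LHS](per p.+1); congr u.
by rewrite mulrNz mulNr addrAC addNr add0r.
Qed.

(** A period costs O(e^3), and there are at most [tf / (e ^+ 2 * T)] of them; the pieces before the
    first node and after the last one each cost O(e). The radii keep [x] in the box: [z] stays
    within [rho - 2], an error of at most 1 puts [x] within [rho - 1] at the nodes, and during one
    period [x] moves by less than 1. *)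
Lemma trajectory_approximation tf : 0 <= tf -> exists K e1, [/\ 0 <= K, 0 < e1 &
  forall omega t0 t1 x z, 0 < omega ->
  let e := (Num.sqrt omega)^-1 in e <= e1 ->
  t0 <= t1 -> t1 <= t0 + tf ->
  integral_path (input_affine b u omega) t0 t1 x ->
  integral_path (lie_bracket_system T b u) t0 t1 z ->
  x t0 = z t0 -> (forall r, t0 <= r <= t1 -> `|z r| <= rho - 2) ->
  forall r, t0 <= r <= t1 -> `|x r - z r| <= K * e].
Proof.
move=> tf0.
have [T0 _] := hu4; have T00 := ltW T0.
have [V1 V10 fV] := input_affine_bound rho hb1 hb2 hu3.
have [V2 V20 [lV lt lx]] := lie_bracket_system_regularity hb1 hb2 hu3 hu4 rho.
have [Kp [ep [Kp0 ep0 hp]]] := one_period_estimate hb1 hb2 hu3 hu4 rho1.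
(* Within a period [x] moves by at most [2 * V1 * T * e] and [z] by [V2 * T * e], whence [C0]. [K1]
   adds the errors of the averaged step and of the Euler step, [K5] is the Gronwall factor times the
   initial and accumulated errors, and [D] ensures [2 * V1 * T * e < 1] and [K5 * e <= 1]. *)
pose C0 := (2 * V1 + V2) * T.
have C00 : 0 <= C0 by rewrite mulr_ge0// addr_ge0// mulr_ge0.
pose K1 := Kp + (V2 + V2 * V2) * T ^+ 2.
have K10 : 0 <= K1 by rewrite !(addr_ge0, mulr_ge0)// sqr_ge0.
pose K5 := expR (V2 * tf) * (C0 + tf / T * K1).
have K50 : 0 <= K5 by rewrite mulr_ge0 ?expR_ge0// addr_ge0// mulr_ge0// divr_ge0.
pose D := 2 * (2 * V1 * T + K5 + 1).
have D0 : 0 < D by rewrite mulr_gt0// ltr_wpDl// addr_ge0// !mulr_ge0.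
pose e1 := Num.min ep (Num.min 1 D^-1).
exists (K5 + C0), e1; split; first exact: addr_ge0.
  by rewrite !lt_min ep0 ltr01 invr_gt0.
move=> omega t0 t1 x z w0 e ee1 t01 t1tf px pz xz0 zr.
have sw0 : 0 < Num.sqrt omega by rewrite sqrtr_gt0.
have e0 : 0 < e by rewrite invr_gt0.
have e00 := ltW e0.
have e_ep : e <= ep by apply: le_trans ee1 _; rewrite ge_min lexx.
have e_le1 : e <= 1 by apply: le_trans ee1 _; rewrite !ge_min lexx orbT.
have eD : e * D <= 1.
  by rewrite -ler_pdivlMr// mul1r; apply: le_trans ee1 _; rewrite !ge_min lexx !orbT.
have [eV1 eK5] : 2 * V1 * T * e < 1 /\ K5 * e <= 1.
  have h1 : 0 <= 2 * V1 * T * e by rewrite !mulr_ge0.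
  have h2 : 0 <= K5 * e by rewrite mulr_ge0.
  have : e * D = 2 * (2 * V1 * T * e) + 2 * (K5 * e) + 2 * e by rewrite /D; ring.
  move: h1 h2 eD e0; move: (2 * V1 * T * e) (K5 * e) (e * D) => y1 y2 y3.
  by move=> h1 h2 h3 h4 h5; split; lra.
pose h := e ^+ 2 * T.
have h0 : 0 < h by rewrite mulr_gt0 ?exprn_gt0.
have h00 := ltW h0.
have e2w : Num.sqrt omega * e ^+ 2 = e by rewrite expr2 mulrA divff ?mul1r// gt_eqF.
have e2e : e ^+ 2 <= e by rewrite expr2 ler_piMl.
pose Vw := V1 + V1 * Num.sqrt omega.
have Vw0 : 0 <= Vw by rewrite addr_ge0// mulr_ge0// ltW.
have Vwh : Vw * h <= 2 * V1 * T * e.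
  have -> : Vw * h = V1 * T * e ^+ 2 + V1 * T * (Num.sqrt omega * e ^+ 2) by rewrite /Vw /h; ring.
  have : V1 * T * e ^+ 2 <= V1 * T * e by rewrite ler_wpM2l// mulr_ge0.
  rewrite e2w; set y := V1 * T * e; have -> : 2 * V1 * T * e = 2 * y by rewrite /y; ring.
  lra.
have zr' r : t0 <= r <= t1 -> `|z r| <= rho.
  by move=> rI; apply: le_trans (zr r rI) _; rewrite gerBl.
have V2h : V2 * h <= V2 * T * e.
  have -> : V2 * h = V2 * T * e ^+ 2 by rewrite /h; ring.
  by rewrite ler_wpM2l// mulr_ge0.
have short c d : t0 <= c -> c <= d -> d <= t1 -> d <= c + h -> `|x c| <= rho - 1 ->
    (forall r, c <= r <= d -> `|x r| <= rho) /\
    (forall r, c <= r <= d -> `|x r - z r| <= `|x c - z c| + C0 * e).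
  move=> tc cd dt dh xc.
  have pcd := integral_path_sub tc dt px; have zcd := integral_path_sub tc dt pz.
  have Vcd q : c <= q -> q <= d -> Vw * (q - c) <= Vw * h by move=> cq qd; rewrite ler_wpM2l//; lra.
  have xr : forall r, c <= r <= d -> `|x r| <= rho.
    apply: (integral_path_stays cd Vw0 _ pcd) => //; first by move=> t y; exact: fV.
    by apply: le_lt_trans (Vcd d cd (lexx _)) _; exact: le_lt_trans Vwh eV1.
  split=> // r /andP[cr rd].
  have h1 : `|x r - x c| <= Vw * (r - c).
    by apply: (integral_path_lip pcd) => // q qI; exact/fV/xr.
  have h2 : `|z r - z c| <= V2 * (r - c).
    apply: (integral_path_lip zcd) => // q /andP[cq qd]; apply/lV/zr'.
    by rewrite (le_trans tc)//= (le_trans qd).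
  have h3 : V2 * (r - c) <= V2 * h by rewrite ler_wpM2l//; lra.
  have h4 := Vcd r cr rd.
  have -> : x r - z r = (x r - x c) + (x c - z c) - (z r - z c).
    by move: (x r) (x c) (z r) (z c) => *; apply/rowP => k; rewrite !mxE; ring.
  have h5 := ler_normB (x r - x c + (x c - z c)) (z r - z c).
  have h6 := ler_normD (x r - x c) (x c - z c).
  have -> : C0 * e = 2 * V1 * T * e + V2 * T * e by rewrite /C0; ring.
  move: h1 h2 h3 h4 h5 h6 Vwh V2h.
  move: (2 * V1 * T * e) (V2 * T * e) (Vw * h) (Vw * (r - c)) (V2 * h) (V2 * (r - c)) => *.
  lra.
have z0 := zr t0; rewrite lexx t01 in z0.
have x0 : `|x t0| <= rho - 1 by rewrite xz0; apply: le_trans (z0 isT) _; lra.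
(* At the nodes sg j the phase omega * sg j is a multiple of the period. *)
pose k0 := Num.ceil (t0 / h).
pose sg j := (k0%:~R + j%:R) * h.
have sg0 : t0 <= sg 0%N by rewrite /sg addr0 -ler_pdivrMr// ceil_ge.
have sg0h : sg 0%N <= t0 + h.
  have := ceilB1_lt (t0 / h); rewrite ltr_pdivlMr// intrB mulrBl mul1r ltrBlDr => /ltW.
  by rewrite /sg addr0.
have sgE j : sg j = sg 0%N + h * j%:R by rewrite /sg; ring.
have sgS j : sg j.+1 = sg j + h by rewrite /sg -natr1; ring.
have sg_ge j : t0 <= sg j.
  by elim: j => // j IH; rewrite sgS (le_trans IH)// lerDl.
have phase j i t r : u i t (omega * (sg j + e ^+ 2 * r)) = u i t r.
  have we : omega * e ^+ 2 = 1.
    by rewrite -[omega in LHS]sqr_sqrtr ?ltW// -exprMn divff ?expr1n// gt_eqF.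
  have -> : omega * (sg j + e ^+ 2 * r) = (k0 + j%:Z)%:~R * T + r.
    rewrite (_ : omega * _ = (k0%:~R + j%:R) * T * (omega * e ^+ 2) + omega * e ^+ 2 * r).
      by rewrite we mulr1 mul1r intrD.
    by rewrite /sg /h; ring.
  exact: input_periodic.
(* Discrete Gronwall majorant: [C0 * e] is the error allowed at the first node, and each period
   multiplies by at most [1 + V2 * h <= expR (V2 * h)] and adds [K1 * e ^+ 3]. *)
pose E j := expR (V2 * h * j%:R) * (C0 * e + j%:R * (K1 * e ^+ 3)).
have K1e0 : 0 <= K1 * e ^+ 3 by apply: mulr_ge0 => //; exact: exprn_ge0.
have Ej0 j : 0 <= C0 * e + j%:R * (K1 * e ^+ 3).
  by apply: addr_ge0; exact: mulr_ge0.
have EK5 j : sg j <= t1 -> E j <= K5 * e.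
  move=> sj; have jh : h * j%:R <= tf.
    by move: sj sg0 t1tf; rewrite sgE; move: (h * j%:R) (sg 0%N) => *; lra.
  rewrite /E /K5 -[leRHS]mulrA; apply: ler_pM; first exact: expR_ge0.
  - exact: Ej0.
  - by rewrite ler_expR -(mulrA V2) ler_wpM2l.
  - have -> : (C0 + tf / T * K1) * e = C0 * e + tf / T * (K1 * e) by ring.
    rewrite lerD2l (_ : K1 * e ^+ 3 = e ^+ 2 * (K1 * e)); last by ring.
    rewrite mulrA ler_wpM2r ?mulr_ge0// ler_pdivlMr//.
    by move: jh; rewrite /h; lra.
have claim j : sg j <= t1 -> `|x (sg j) - z (sg j)| <= E j.
  elim: j => [|j IH] sj.
    have [_ h1] := short t0 (sg 0%N) (lexx _) sg0 sj sg0h x0.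
    have := h1 (sg 0%N); rewrite lexx sg0 => /(_ isT).
    by rewrite /E xz0 subrr normr0 add0r mulr0 expR0 mul1r mul0r addr0.
  have sjj : sg j <= t1 by apply: le_trans sj; rewrite sgS lerDl.
  have h1 := IH sjj; have h2 := EK5 j sjj.
  have zj := zr (sg j); rewrite sg_ge sjj in zj.
  have xj : `|x (sg j)| <= rho - 1.
    have := ler_distD (z (sg j)) (x (sg j)) 0; rewrite !subr0.
    have := zj isT; move: h1 h2 eK5; lra.
  have jj1 : sg j <= sg j.+1 by rewrite sgS lerDl.
  have jj2 : sg j.+1 <= sg j + h by rewrite sgS.
  have [xr _] := short (sg j) (sg j.+1) (sg_ge j) jj1 sj jj2 xj.
  have px' := integral_path_sub (sg_ge j) sj px.
  have pz' := integral_path_sub (sg_ge j) sj pz.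
  have zbox q : sg j <= q <= sg j + h -> `|z q| <= rho.
    move=> /andP[jq qj]; apply: zr'; rewrite (le_trans (sg_ge j))//=.
    by apply: le_trans sj; rewrite sgS.
  rewrite sgS in xr px' pz' *.
  have g1 := hp omega (sg j) x w0 e_ep (phase j) px' xr xj.
  have g2 := euler_step V20 h00 lV lt lx pz' zbox.
  rewrite -/h in g1.
  have jI : sg j <= sg j <= sg j + h by rewrite lexx lerDl.
  have g3 := lx (sg j) _ _ (xr _ jI) (zbox _ jI).
  set LX := lie_bracket_system T b u (sg j) (x (sg j)) in g1 g3.
  set LZ := lie_bracket_system T b u (sg j) (z (sg j)) in g2 g3.
  have -> : x (sg j + h) - z (sg j + h) =
     (x (sg j + h) - x (sg j) - h *: LX) - (z (sg j + h) - z (sg j) - h *: LZ) +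
     ((x (sg j) - z (sg j)) + h *: (LX - LZ)).
    have reorder (y1 y2 y3 y4 y5 y6 : rV) : y1 - y2 =
      (y1 - y3 - h *: y5) - (y2 - y4 - h *: y6) + ((y3 - y4) + h *: (y5 - y6)).
      by apply/rowP => k; rewrite !mxE; ring.
    exact: reorder.
  have g4 : `|h *: (LX - LZ)| <= V2 * h * `|x (sg j) - z (sg j)|.
    by rewrite normrZ (ger0_norm h00) (mulrC V2) -[leRHS]mulrA ler_wpM2l.
  have g5 : (V2 + V2 * V2) * h ^+ 2 <= (V2 + V2 * V2) * T ^+ 2 * e ^+ 3.
    have -> : h ^+ 2 = T ^+ 2 * (e ^+ 3 * e) by rewrite /h; ring.
    rewrite mulrA; apply: ler_wpM2l; first by rewrite mulr_ge0 ?sqr_ge0 ?addr_ge0 ?mulr_ge0.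
    by rewrite ler_piMr// exprn_ge0.
  have g6 : Kp * e ^+ 3 + (V2 + V2 * V2) * T ^+ 2 * e ^+ 3 = K1 * e ^+ 3.
    by rewrite /K1; ring.
  have g7 : (1 + V2 * h) * E j + K1 * e ^+ 3 <= E j.+1.
    pose a := expR (V2 * h * j%:R); pose g := expR (V2 * h).
    have a1 : 1 <= a by rewrite -[leLHS]expR0 ler_expR !mulr_ge0.
    have g1' : 1 + V2 * h <= g by exact: expR_ge1Dx.
    have g1'' : 1 <= g by apply: le_trans g1'; rewrite lerDl mulr_ge0.
    have -> : E j.+1 = g * E j + a * g * (K1 * e ^+ 3).
      rewrite /E (_ : expR (V2 * h * j.+1%:R) = a * g); last first.
        by rewrite /a /g -expRD; congr expR; rewrite -natr1; ring.
      by rewrite -/a -natr1; ring.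
    have Ej : 0 <= E j by apply: mulr_ge0; [exact: expR_ge0|exact: Ej0].
    apply: lerD; first by rewrite ler_wpM2r.
    by rewrite ler_peMl// -[leLHS]mulr1; apply: ler_pM.
  have g8 : (1 + V2 * h) * `|x (sg j) - z (sg j)| <= (1 + V2 * h) * E j.
    by rewrite ler_wpM2l// addr_ge0// mulr_ge0.
  apply: le_trans g7; apply: le_trans (ler_normD _ _) _; rewrite addrC; apply: lerD.
    apply: le_trans g8; apply: le_trans (ler_normD _ _) _.
    by rewrite mulrDl mul1r lerD2l.
  apply: le_trans (ler_normB _ _) _; rewrite -g6; apply: lerD => //.
  exact: le_trans g2 g5.
move=> r /andP[t0r rt1]; rewrite mulrDl.
have K5e0 : 0 <= K5 * e by exact: mulr_ge0.
have [rs|sr] := leP r (sg 0%N).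
  have [_ h1] := short t0 r (lexx _) t0r rt1 (le_trans rs sg0h) x0.
  have := h1 r; rewrite lexx t0r => /(_ isT) /le_trans; apply.
  by rewrite xz0 subrr normr0 add0r lerDr.
pose j := Num.trunc ((r - sg 0%N) / h).
have /truncn_itv/andP[j1 j2] : 0 <= (r - sg 0%N) / h.
  by rewrite divr_ge0// subr_ge0 ltW.
have sjr : sg j <= r by rewrite sgE -lerBrDl mulrC -ler_pdivlMr.
have rsj : r <= sg j + h.
  by rewrite -sgS sgE -lerBlDl mulrC -ler_pdivrMr// ltW.
have sjt := le_trans sjr rt1.
have zj := zr (sg j); rewrite sg_ge sjt in zj.
have h1 := claim j sjt; have h2 := EK5 j sjt.
have xj : `|x (sg j)| <= rho - 1.
  have := ler_distD (z (sg j)) (x (sg j)) 0; rewrite !subr0.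
  have := zj isT; move: h1 h2 eK5; lra.
have [_ h3] := short (sg j) r (sg_ge j) sjr rt1 rsj xj.
have := h3 r; rewrite lexx sjr => /(_ isT) /le_trans; apply.
by rewrite lerD2r (le_trans h1).
Qed.
End Approximation.

(** * Stability *)

Section Neighbourhoods.
Context {R : realType} {n : nat}.
Local Notation rV := 'rV[R]_n.

Lemma enorm_triangle (x y : rV) : enorm (x + y) <= enorm x + enorm y.
Proof.
have e0 (z : rV) : 0 <= enorm z by exact: sqrtr_ge0.
have sq (z : rV) : enorm z ^+ 2 = \sum_(i < n) z 0 i ^+ 2.
  by rewrite sqr_sqrtr// sumr_ge0// => i _; exact: sqr_ge0.
have zero (z : rV) : enorm z = 0 -> z = 0.
  by move=> z0; apply/eqP; rewrite -normr_le0 -z0 norm_le_enorm.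
have [x0|x0] := eqVneq (enorm x) 0; first by rewrite (zero _ x0) add0r lerDr.
have [y0|y0] := eqVneq (enorm y) 0; first by rewrite (zero _ y0) addr0 lerDl.
have xp : 0 < enorm x by rewrite lt_def x0 e0.
have yp : 0 < enorm y by rewrite lt_def y0 e0.
(* Cauchy-Schwarz from [2 * p * q <= c * p ^+ 2 + c^-1 * q ^+ 2] with [c = enorm y / enorm x], which
   is why the zero vectors were set aside. *)
have CS : \sum_(i < n) 2 * (x 0 i * y 0 i) <= 2 * (enorm x * enorm y).
  apply: (@le_trans _ _ (\sum_(i < n) (enorm y / enorm x * x 0 i ^+ 2 + enorm x / enorm y * y 0 i ^+ 2))).
    apply: ler_sum => i _; rewrite -subr_ge0.
    have -> : enorm y / enorm x * x 0 i ^+ 2 + enorm x / enorm y * y 0 i ^+ 2 - 2 * (x 0 i * y 0 i)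
        = (enorm y * x 0 i - enorm x * y 0 i) ^+ 2 / (enorm x * enorm y).
      by field; rewrite x0 y0.
    by rewrite divr_ge0 ?sqr_ge0 ?mulr_ge0.
  rewrite big_split /= -!mulr_sumr -!sq le_eqVlt; apply/orP; left; apply/eqP.
  by field; rewrite x0 y0.
have s0 : 0 <= enorm x + enorm y by exact: addr_ge0.
rewrite -[leRHS]ger0_norm// -sqrtr_sqr ler_wsqrtr// sqrrD !sq.
have E i : (x + y) 0 i ^+ 2 = x 0 i ^+ 2 + 2 * (x 0 i * y 0 i) + y 0 i ^+ 2.
  by rewrite mxE; ring.
under eq_bigr do rewrite E.
by rewrite big_split /= big_split /= lerD2r lerD2l; apply: le_trans CS _; rewrite mulr_natl.
Qed.

Variable S : set rV.

Lemma UnbhdP a x : Unbhd S a x <-> exists2 y, S y & enorm (x - y) < a.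
Proof.
split.
  by rewrite /Unbhd /= => /ereal_inf_lt[_ [y Sy <-]]; rewrite lte_fin; exists y.
move=> [y Sy xy]; rewrite /Unbhd /=; apply: le_lt_trans (_ : (enorm (x - y))%:E < _)%E.
  by apply: ereal_inf_lbound; exists y.
by rewrite lte_fin.
Qed.

Lemma Unbhd_le a a' x : a <= a' -> Unbhd S a x -> Unbhd S a' x.
Proof.
by move=> aa' /UnbhdP[y Sy xy]; apply/UnbhdP; exists y => //; exact: lt_le_trans aa'.
Qed.

Lemma Unbhd_near a d x z : Unbhd S a z -> enorm (x - z) <= d -> Unbhd S (a + d) x.
Proof.
move=> /UnbhdP[y Sy zy] xz; apply/UnbhdP; exists y => //.
have -> : x - y = (z - y) + (x - z) by rewrite [RHS]addrC addrA subrK.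
by apply: le_lt_trans (enorm_triangle _ _) _; exact: ltr_leD.
Qed.

Lemma Unbhd_norm B a x : (forall y, S y -> `|y| <= B) -> Unbhd S a x -> `|x| <= B + a.
Proof.
move=> SB /UnbhdP[y /SB yB xy].
rewrite -[x](subrK y); apply: le_trans (ler_normD _ _) _; rewrite addrC lerD//.
exact: le_trans (norm_le_enorm _) (ltW xy).
Qed.

End Neighbourhoods.

Section SolutionPaths.
Context {R : realType} {n : nat}.
Local Notation rV := 'rV[R]_n.
Implicit Types (f : R -> rV -> rV) (x : R -> rV).

Lemma abs_continuous_bounded a b x : abs_continuous a b x ->
  exists B, forall r, a <= r <= b -> `|x r| <= B.
Proof.
move=> /(_ 1 ltr01)[d d0 hd].
have close s t : a <= s -> s <= t -> t <= b -> t - s < d -> `|x t - x s| <= 1.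
  move=> as_ st tb std.
  have := hd 1%N (fun=> s) (fun=> t); rewrite !big_ord1 => /(_ _ _ std).
  move=> h; apply: le_trans (norm_le_enorm _) _; apply/ltW/h => //.
  by apply/trivIsetP => i j _ _; rewrite !ord1 eqxx.
pose h := d / 2; have h0 : 0 < h by rewrite divr_gt0.
have node k : forall r, a <= r -> r <= a + h * k%:R -> r <= b -> `|x r| <= `|x a| + k%:R.
  elim: k => [|k IH] r ar rk rb.
    by rewrite mulr0 addr0 in rk; rewrite (_ : r = a) ?addr0//; apply/eqP; rewrite eq_le rk.
  have [rk'|/ltW rk'] := leP r (a + h * k%:R).
    by apply: le_trans (IH r ar rk' rb) _; rewrite lerD2l ler_nat.
  have ak : a <= a + h * k%:R by rewrite lerDl mulr_ge0// ltW.
  have h1 := IH _ ak (lexx _) (le_trans rk' rb).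
  have h2 : `|x r - x (a + h * k%:R)| <= 1.
    apply: close => //; move: rk; rewrite -natr1 /h; move: d0; lra.
  have h3 := ler_distD (x (a + h * k%:R)) (x r) 0; rewrite !subr0 in h3.
  by rewrite -natr1; lra.
exists (`|x a| + (Num.trunc (`|b - a| / h)).+1%:R) => r /andP[ar rb].
apply: node => //; rewrite -lerBlDl mulrC -ler_pdivrMr//.
have /truncn_itv/andP[_ /ltW] : 0 <= `|b - a| / h by rewrite divr_ge0// ltW.
apply: le_trans; rewrite ler_wpM2r ?invr_ge0 ?(ltW h0)//.
by apply: le_trans (ler_norm _); rewrite lerD2r.
Qed.

Definition locally_bounded f :=
  forall rho, exists V, forall t y, `|y| <= rho -> `|f t y| <= V.

(** [is_solution] provides integrability only. Absolute continuity bounds the path on bounded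
    intervals, and local boundedness of the field then upgrades the integrand to [vmeas]. *)
Lemma solution_integral_path f t0 (x0 : rV) x : locally_bounded f ->
  is_solution f t0 x0 x -> x t0 = x0 /\ forall t1, integral_path f t0 t1 x.
Proof.
move=> fb sol.
have mf t1 : t0 <= t1 -> vmeas t0 t1 (fun r => f r (x r)).
  move=> t01; have [ac int _] := sol t1 t01.
  have [B xB] := abs_continuous_bounded ac; have [V fV] := fb B.
  move=> k; split; first by have /measurable_int/measurable_EFinP := int k.
  by exists V => r rI; apply: le_trans (row_entry_norm_le _ _) _; apply: fV; exact: xB.
have xE t1 : t0 <= t1 -> x t1 = x0 + vint t0 t1 (fun r => f r (x r)).
  by move=> t01; have [_ _] := sol t1 t01.
split; first by rewrite xE// vint_point addr0.
move=> t1; have [t01|t10] := leP t0 t1; last first.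
  split; last first.
    by move=> s t t0s st tt1; have := le_lt_trans (le_trans t0s (le_trans st tt1)) t10; rewrite ltxx.
  apply: (vmeas_lip (L := 0)) => s t t0s st tt1.
  by have := le_lt_trans (le_trans t0s (le_trans st tt1)) t10; rewrite ltxx.
split; first exact: mf.
move=> s t t0s st tt1; have t0t := le_trans t0s st.
rewrite (xE _ t0t) (xE _ t0s) (vint_chasles t0s st (mf _ t0t)).
by rewrite opprD addrACA subrr add0r addrAC subrr add0r.
Qed.

Lemma integral_path_solution f t0 (x0 : rV) x : x t0 = x0 ->
  (forall t1, integral_path f t0 t1 x) -> is_solution f t0 x0 x.
Proof.
move=> xt0 px t t0t; have [mf xI] := px t; split.
- have [B B0 hB] := vmeas_bounded mf.
  move=> e e0; pose C := n%:R * B + 1.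
  have C0 : 0 < C by rewrite ltr_wpDl// mulr_ge0.
  exists (e / C); first by rewrite divr_gt0.
  move=> k l r hlr _; rewrite ltr_pdivlMr// => hs.
  apply: le_lt_trans hs; rewrite mulr_suml; apply: ler_sum => i _.
  have [al [lr rt]] := hlr i.
  apply: le_trans (enorm_le_norm _) _.
  have h := integral_path_lip (px t) hB al lr rt.
  have rl : 0 <= r i - l i by rewrite subr_ge0.
  have : n%:R * `|x (r i) - x (l i)| <= n%:R * (B * (r i - l i)) by rewrite ler_wpM2l.
  by move=> /le_trans; apply; rewrite mulrA mulrC ler_wpM2l// lerDl.
- by move=> k; exact: (bmeas_int (mf k)).
- by rewrite -xt0 -[vint _ _ _ as X in _ = _ + X]/(vint _ _ _) -(xI t0 t) ?lexx// addrC subrK.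
Qed.

End SolutionPaths.

Section PracticalStability.
Context {R : realType} {n m : nat}.
Local Notation rV := 'rV[R]_n.
Variables (b : 'I_m.+1 -> R -> rV -> rV) (u : 'I_m -> R -> R -> R) (T : R)
  (S : set rV).
Hypotheses (hb1 : assumption1 b) (hb2 : assumption2 b) (hu3 : assumption3 u)
  (hu4 : assumption4 T u).
Local Notation LB := (lie_bracket_system T b u).
Local Notation IA := (input_affine b u).

(* Clamping the state makes the field bounded and globally Lipschitz; the two
   systems agree as long as the solution stays in the box. *)
Lemma input_affine_truncated_solution rho omega t0 (x0 : rV) : 0 <= rho -> 0 < omega ->
  exists y V, [/\ y t0 = x0, 0 <= V,
    forall s t, t0 <= s -> s <= t -> `|y t - y s| <= V * (t - s) &
    forall t1, (forall r, t0 <= r <= t1 -> `|y r| <= rho) ->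
      integral_path (IA omega) t0 t1 y].
Proof.
move=> rho0 w0.
have [A [A' [A0 _ [bA bt _ bx] _ _]]] := field_regularity hb1 hb2 rho.
have [L [M [_ M0 _ hM]]] := input_bounds hu3.
have [V V0 fV] := input_affine_bound rho hb1 hb2 hu3.
pose sw := Num.sqrt omega; have sw0 : 0 <= sw by exact: sqrtr_ge0.
pose f t (x : rV) := IA omega t (clamp rho x).
pose Vw := V + V * sw; have Vw0 : 0 <= Vw by rewrite addr_ge0// mulr_ge0.
have fVw t x : `|f t x| <= Vw by apply: fV; exact: clamp_norm.
pose Lw := A + m%:R * (sw * M * A) + 1.
have Lw1 : 0 <= A + m%:R * (sw * M * A) by rewrite addr_ge0 ?mulr_ge0.
have Lw0 : 0 < Lw by rewrite ltr_wpDl.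
have fL t x y : `|f t x - f t y| <= Lw * `|x - y|.
  apply: le_trans (_ : (A + m%:R * (sw * M * A)) * `|clamp rho x - clamp rho y| <= _); last first.
    by apply: ler_pM => //; [rewrite lerDl|exact: clamp_lip].
  rewrite /f /input_affine opprD addrACA; apply: le_trans (ler_normD _ _) _.
  rewrite [leRHS]mulrDl; apply: lerD; first by apply: bx; exact: clamp_norm.
  rewrite -sumrB -[leRHS]mulrA; apply: norm_sum_ord_le => i.
  rewrite -scalerBr normrZ; apply: le_trans (_ : (sw * M) * (A * `|clamp rho x - clamp rho y|) <= _).
    apply: ler_pM => //; first by rewrite normrM ger0_norm// ler_wpM2l.
    by apply: bx; exact: clamp_norm.
  by rewrite !mulrA.
have mf (y : R -> rV) c : (forall s t, t0 <= s -> s <= t -> `|y t - y s| <= Vw * (t - s)) ->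
    vmeas t0 c (fun s => f s (y s)).
  move=> yL.
  have mb i : vmeas t0 c (fun s => b i s (clamp rho (y s))).
    apply: (vmeas_lip (L := A + A * Vw)) => s t s0 st _.
    have -> : b i t (clamp rho (y t)) - b i s (clamp rho (y s)) =
      (b i t (clamp rho (y t)) - b i s (clamp rho (y t))) +
      (b i s (clamp rho (y t)) - b i s (clamp rho (y s))) by rewrite addrA subrK.
    apply: le_trans (ler_normD _ _) _; rewrite mulrDl; apply: lerD.
      apply: le_trans (bt _ _ _ _ (clamp_norm _ rho0)) _.
      by rewrite ger0_norm ?subr_ge0.
    apply: le_trans (bx _ _ _ _ (clamp_norm _ rho0) (clamp_norm _ rho0)) _.
    rewrite -mulrA ler_wpM2l//; apply: le_trans (clamp_lip _ _ rho0) _; exact: yL.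
  apply: vmeasD; first exact: mb.
  apply: vmeas_sum => i; apply: vmeasZ; last exact: mb.
  apply: bmeasM; first exact: bmeas_cst.
  exact: (input_oscillating_bmeas hu3 i t0 c w0).
have [y yL yE] := picard Lw0 fVw fL mf x0.
exists y, Vw; split; [by rewrite (yE _ (lexx t0)) vint_point addr0|exact: Vw0|exact: yL|].
move=> t1 ybox.
have fE r : t0 <= r <= t1 -> f r (y r) = IA omega r (y r).
  by move=> rI; rewrite /f clamp_id// ybox.
split; first by apply: (vmeas_eq fE); exact: mf.
move=> s t s0 st tt1; have t0t := le_trans s0 st.
rewrite (yE _ t0t) (yE _ s0) (vint_chasles s0 st (mf y t yL)).
rewrite opprD addrACA subrr add0r addrAC subrr add0r.
apply: eq_vint => r /andP[sr rt]; apply: fE.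
by rewrite (le_trans s0)//= (le_trans rt).
Qed.

Lemma input_affine_locally_bounded omega : locally_bounded (IA omega).
Proof.
move=> rho; have [V _ fV] := input_affine_bound rho hb1 hb2 hu3.
by exists (V + V * Num.sqrt omega) => t y; exact: fV.
Qed.

Lemma lie_bracket_system_locally_bounded : locally_bounded LB.
Proof.
move=> rho; have [V _ [fV _ _]] := lie_bracket_system_regularity hb1 hb2 hu3 hu4 rho.
by exists V.
Qed.

(** Continuation argument: while the truncated solution is in the box it is a genuine path, so the a
    priori estimate confines it to radius [rho - 1]; during the next [h = (V + 1)^-1] it moves by at
    most 1 and is still in the box. The second half applies the same estimate to an arbitrary
    solution. *)
Lemma input_affine_carries rho omega t0 delta t1 eps : 1 <= rho -> 0 < omega -> t0 <= t1 ->
  (forall x0, Unbhd S delta x0 -> `|x0| <= rho) ->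
  (forall x t2, integral_path (IA omega) t0 t2 x -> Unbhd S delta (x t0) ->
     forall r, t0 <= r <= t2 ->
       `|x r| <= rho - 1 /\ (t1 <= r -> Unbhd S eps (x r))) ->
  carries (IA omega) S t0 delta t1 eps.
Proof.
move=> rho1 w0 t01 hx0 H x0 Sx0; split.
  have [y [V [y0 V0 yL yP]]] :=
    input_affine_truncated_solution t0 x0 (le_trans ler01 rho1) w0.
  exists y; apply: (integral_path_solution y0).
  have V10 : 0 < V + 1 by rewrite ltr_wpDl.
  pose h := (V + 1)^-1; have h0 : 0 < h by rewrite invr_gt0.
  have box k : forall r, t0 <= r <= t0 + h * k%:R -> `|y r| <= rho.
    elim: k => [|k IH] r /andP[t0r rk].
      rewrite mulr0 addr0 in rk; rewrite (_ : r = t0); last by apply/eqP; rewrite eq_le rk.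
      by rewrite y0; exact: hx0.
    have [rk'|/ltW rk'] := leP r (t0 + h * k%:R); first by apply: IH; rewrite t0r.
    have tk : t0 <= t0 + h * k%:R by rewrite lerDl mulr_ge0// ltW.
    have [h1 _] := H y _ (yP _ IH) (eq_ind_r (Unbhd S delta) Sx0 y0) (t0 + h * k%:R)
      (introT andP (conj tk (lexx _))).
    have h2 := yL _ _ tk rk'.
    have h3 : V * (r - (t0 + h * k%:R)) <= 1.
      apply: le_trans (_ : (V + 1) * h <= _); last by rewrite mulfV// gt_eqF.
      apply: ler_pM => //; [by rewrite subr_ge0|by rewrite lerDl|].
      by rewrite lerBlDl (le_trans rk)// -natr1 mulrDr mulr1 addrA.
    have h4 := ler_distD (y (t0 + h * k%:R)) (y r) 0; rewrite !subr0 in h4.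
    by apply: le_trans h4 _; rewrite -[leRHS](subrK 1) addrC; apply: lerD => //; exact: le_trans h3.
  move=> t2; apply: yP => r /andP[t0r rt2].
  apply: (box (Num.trunc (`|t2 - t0| / h)).+1); rewrite t0r /= -lerBlDl mulrC -ler_pdivrMr//.
  have /truncn_itv/andP[_ /ltW] : 0 <= `|t2 - t0| / h by rewrite divr_ge0// ltW.
  have hV0 : 0 <= h^-1 by rewrite invr_ge0 ltW.
  apply: le_trans; apply: (ler_wpM2r hV0).
  by apply: le_trans (ler_norm _); rewrite lerD2r.
move=> x sol t t1t.
have [xt0 px] := solution_integral_path (@input_affine_locally_bounded omega) sol.
have t0t := le_trans t01 t1t.
have [_ h] := H x t (px t) (eq_ind_r (Unbhd S delta) Sx0 xt0) t (introT andP (conj t0t (lexx _))).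
exact: h.
Qed.

Variable B : R.
Hypotheses (B0 : 0 <= B) (SB : forall y, S y -> `|y| <= B).
(** The solutions of (LB) used below stay in the 1-neighbourhood of [S], hence within
    [B + 1 = rho - 2], as [trajectory_approximation] requires. *)
Let rho := B + 3.
Let rho1 : 1 <= rho. Proof. rewrite /rho; move: B0; lra. Qed.

(** The hypothesis on (LB) provides both the companion solution [z] and its confinement to the box.
    Taking [omega] above [e2 ^- 2] makes [e] at most [e2], and [C] absorbs the factor [n] between
    the two norms. *)
Lemma Unbhd_approximation delta tf D : 0 <= tf -> 0 < D ->
  (forall t0, carries LB S t0 delta t0 1) ->
  exists2 omega0, 0 < omega0 & forall omega t0 t1 x, omega0 < omega -> t1 <= t0 + tf ->
    integral_path (IA omega) t0 t1 x -> Unbhd S delta (x t0) ->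
    exists2 z, is_solution LB t0 (x t0) z &
      forall r, t0 <= r <= t1 -> enorm (x r - z r) <= D.
Proof.
move=> tf0 D0 hLB.
have [K [e1 [K0 e10 happ]]] := trajectory_approximation hb1 hb2 hu3 hu4 rho1 tf0.
pose C := n%:R * K + 1; have C0 : 0 < C by rewrite ltr_wpDl// mulr_ge0.
pose e2 := Num.min e1 (D / C).
have e20 : 0 < e2 by rewrite lt_min e10 divr_gt0.
exists (e2 ^- 2); first by rewrite invr_gt0 exprn_gt0.
move=> omega t0 t1 x hw t1tf px Sx.
have w0 : 0 < omega by apply: lt_trans hw; rewrite invr_gt0 exprn_gt0.
have ew : (Num.sqrt omega)^-1 <= e2.
  rewrite invf_ple ?posrE ?sqrtr_gt0//.
  have -> : e2^-1 = Num.sqrt (e2 ^- 2).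
    by rewrite -exprVn sqrtr_sqr ger0_norm// invr_ge0 ltW.
  by rewrite ler_wsqrtr// ltW.
have [[z solz] hz] := hLB t0 (x t0) Sx.
exists z => //.
have [zt0 pz] := solution_integral_path lie_bracket_system_locally_bounded solz.
move=> r /andP[t0r rt1]; have t01 := le_trans t0r rt1.
have ee1 : (Num.sqrt omega)^-1 <= e1 by apply: le_trans ew _; rewrite ge_min lexx.
have zr q : t0 <= q <= t1 -> `|z q| <= rho - 2.
  move=> /andP[t0q _]; have := Unbhd_norm SB (hz z solz q t0q).
  by move=> /le_trans; apply; rewrite /rho; lra.
have h := happ omega t0 t1 x z w0 ee1 t01 t1tf px (pz t1) (esym zt0) zr r (introT andP (conj t0r rt1)).
apply: le_trans (enorm_le_norm _) _.
apply: le_trans (_ : n%:R * (K * (D / C)) <= _).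
  rewrite ler_wpM2l//; apply: le_trans h _; rewrite ler_wpM2l//.
  by apply: le_trans ew _; rewrite ge_min lexx orbT.
have -> : n%:R * (K * (D / C)) = D * (n%:R * K / C) by field; rewrite gt_eqF.
by rewrite ler_piMr ?(ltW D0)// ler_pdivrMr// mul1r /C lerDl.
Qed.

Hypothesis LBstable : uniformly_stable LB S.
Variable delta_a : R.
Hypotheses (delta_a0 : 0 < delta_a) (LBattractive : uniformly_attractive delta_a LB S).

Let carries_mono f t0 d d' t1 a a' : d' <= d -> a <= a' ->
  carries f S t0 d t1 a -> carries f S t0 d' t1 a'.
Proof.
move=> dd aa H x0 Sx0; have [h1 h2] := H x0 (Unbhd_le dd Sx0).
by split => // x sol t t1t; apply: Unbhd_le aa _; exact: (h2 x sol).
Qed.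

(** Induction on the number of windows up to [t1], the start being arbitrary: at the end of a window
    the path is back in [U_d], and (LB) is restarted from there. The claim concerns paths on bounded
    intervals so that it can also feed the continuation argument of [input_affine_carries]. *)
Lemma path_stability eps : 0 < eps -> exists delta omega0, [/\ 0 < delta, delta <= 1, 0 < omega0 &
  forall omega t0 t1 x, omega0 < omega -> integral_path (IA omega) t0 t1 x ->
    Unbhd S delta (x t0) -> forall r, t0 <= r <= t1 -> Unbhd S eps (x r)].
Proof.
(* One [a] is for the solution of (LB), the other for the approximation error. *)
move=> eps0; pose a := Num.min eps 1 / 2.
have a0 : 0 < a by rewrite divr_gt0// lt_min eps0 ltr01.
have a1 : a <= 1.
  by rewrite ler_pdivrMr// mul1r; apply: le_trans (_ : 1 <= _); [rewrite ge_min lexx orbT|lra].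
have aeps : a + a <= eps by rewrite /a -splitr ge_min lexx.
have [ds ds0 hs] := LBstable a0.
pose d := Num.min (Num.min ds delta_a) 1.
have d0 : 0 < d by rewrite !lt_min ds0 delta_a0 ltr01.
have [dds dda d1] : [/\ d <= ds, d <= delta_a & d <= 1].
  by rewrite /d !ge_min !lexx !orbT.
have d20 : 0 < d / 2 by rewrite divr_gt0.
have [tf tf0 ha] := LBattractive d20.
(* [tf] may be 0, and windows of positive length are needed to reach [t1] in finitely many steps. *)
pose tp := tf + 1; have tp0 : 0 < tp by rewrite ltr_wpDl.
pose D := Num.min a (d / 2); have D0 : 0 < D by rewrite lt_min a0.
have [Da Dd] : D <= a /\ D <= d / 2 by rewrite /D !ge_min !lexx orbT.
have hLB t0 : carries LB S t0 d t0 1 by exact: carries_mono (hs t0).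
have [w0 w00 happ] := Unbhd_approximation (ltW tp0) D0 hLB.
exists d, w0; split=> // omega t0 t1 x hw.
have claim k : forall t0, t1 <= t0 + tp * k%:R -> integral_path (IA omega) t0 t1 x ->
    Unbhd S d (x t0) -> forall r, t0 <= r <= t1 -> Unbhd S eps (x r).
  elim: k => [|k IH] s0 hk px Sx r /andP[s0r rt1].
    rewrite mulr0 addr0 in hk.
    have -> : r = s0 by apply/eqP; rewrite eq_le s0r (le_trans rt1).
    (* No comparison between [d] and [eps] is available; that the starting point is in [U_eps] is
       read off stability of (LB) at the initial time. *)
    have := Unbhd_le dds Sx => Sx'.
    have [[z solz] hz] := hs s0 (x s0) Sx'.
    have [zs0 _] := solution_integral_path lie_bracket_system_locally_bounded solz.
    have := hz z solz s0 (lexx _); rewrite zs0; apply: Unbhd_le.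
    by apply: le_trans aeps; rewrite lerDl ltW.
  have [rs|sr] := leP r (s0 + tp).
    have pr := integral_path_sub (lexx s0) rt1 px.
    have [z solz hz] := happ omega s0 r x hw rs pr Sx.
    have [_ hS] := hs s0 (x s0) (Unbhd_le dds Sx).
    have := Unbhd_near (hS z solz r s0r) (hz r (introT andP (conj s0r (lexx _)))).
    by apply: Unbhd_le; apply: le_trans aeps; rewrite lerD2l.
  pose s1 := s0 + tp; have s01 : s0 <= s1 by rewrite lerDl ltW.
  have s1t1 : s1 <= t1 by apply: le_trans rt1; exact: ltW.
  have ps := integral_path_sub (lexx s0) s1t1 px.
  have [z solz hz] := happ omega s0 s1 x hw (lexx _) ps Sx.
  have [_ hA] := ha s0 (x s0) (Unbhd_le dda Sx).
  have tfs : s0 + tf <= s1 by rewrite /s1 /tp addrA lerDl.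
  have h1 := Unbhd_near (hA z solz s1 tfs) (hz s1 (introT andP (conj s01 (lexx _)))).
  have hk1 : t1 <= s1 + tp * k%:R.
    by rewrite (_ : s1 + _ = s0 + tp * k.+1%:R)// /s1 -natr1; ring.
  have dd : d / 2 + D <= d by lra.
  have ps1 := integral_path_sub s01 (lexx t1) px.
  exact: (IH s1 hk1 ps1 (Unbhd_le dd h1) r (introT andP (conj (ltW sr) rt1))).
move=> px Sx; apply: (claim (Num.trunc (`|t1 - t0| / tp)).+1 t0 _ px Sx).
rewrite -lerBlDl mulrC -ler_pdivrMr//.
have /truncn_itv/andP[_ /ltW] : 0 <= `|t1 - t0| / tp by rewrite divr_ge0// ltW.
apply: le_trans; rewrite ler_wpM2r ?invr_ge0 ?(ltW tp0)//; exact: ler_norm.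
Qed.

Lemma input_affine_practically_stable : practically_uniformly_stable IA S.
Proof.
move=> eps eps0; pose a := Num.min eps 1.
have a0 : 0 < a by rewrite lt_min eps0 ltr01.
have [aeps a1] : a <= eps /\ a <= 1 by rewrite /a !ge_min !lexx orbT.
have [d [w0 [d0 d1 w00 h]]] := path_stability a0.
exists d, w0; split=> // t0 omega hw.
have w1 := lt_trans w00 hw.
apply: (input_affine_carries rho1 w1 (lexx _)).
  by move=> x0 Sx; apply: le_trans (Unbhd_norm SB Sx) _; rewrite /rho; move: d1; lra.
move=> x t2 px Sx r rI; have hr := h omega t0 t2 x hw px Sx r rI.
split; last by move=> _; exact: Unbhd_le hr.
by apply: le_trans (Unbhd_norm SB hr) _; rewrite /rho; move: a1; lra.
Qed.

(** A single window suffices: at its end the path is in the neighbourhood that [path_stability]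
    attaches to the target accuracy, and it never leaves that accuracy afterwards. *)
Lemma input_affine_practically_attractive :
  exists2 delta, 0 < delta & practically_uniformly_attractive delta IA S.
Proof.
have [db db0 hb] := LBstable ltr01.
(* Fixed before [eps]: [db] keeps (LB) in the 1-neighbourhood of [S], [delta_a] makes it attracted,
   and 1 places the initial points in the box. *)
pose d := Num.min (Num.min db delta_a) 1.
have d0 : 0 < d by rewrite !lt_min db0 delta_a0 ltr01.
have [ddb dda d1] : [/\ d <= db, d <= delta_a & d <= 1].
  by rewrite /d !ge_min !lexx !orbT.
exists d => // eps eps0; pose a := Num.min eps 1.
have a0 : 0 < a by rewrite lt_min eps0 ltr01.
have [aeps a1] : a <= eps /\ a <= 1 by rewrite /a !ge_min !lexx orbT.
have [d' [w1 [d'0 d'1 w10 hst]]] := path_stability a0.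
have d20 : 0 < d' / 2 by rewrite divr_gt0.
have [tf tf0 ha] := LBattractive d20.
have hLB t0 : carries LB S t0 d t0 1 by exact: carries_mono (hb t0).
have [w2 w20 happ] := Unbhd_approximation tf0 d20 hLB.
exists tf, (Num.max w1 w2); split=> //; first by rewrite lt_max w10.
move=> t0 omega; rewrite gt_max => /andP[hw1 hw2].
have w0 := lt_trans w10 hw1.
apply: (input_affine_carries rho1 w0); first by rewrite lerDl.
  by move=> x0 Sx; apply: le_trans (Unbhd_norm SB Sx) _; rewrite /rho; move: d1; lra.
move=> x t2 px Sx r /andP[t0r rt2].
have late : t0 + tf <= r -> Unbhd S a (x r).
  move=> tr; have ttf : t0 <= t0 + tf by rewrite lerDl.
  have ps := integral_path_sub (lexx t0) (le_trans tr rt2) px.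
  have [z solz hz] := happ omega t0 (t0 + tf) x hw2 (lexx _) ps Sx.
  have [_ hA] := ha t0 (x t0) (Unbhd_le dda Sx).
  have h1 := Unbhd_near (hA z solz _ (lexx _)) (hz _ (introT andP (conj ttf (lexx _)))).
  rewrite -splitr in h1.
  have ps2 := integral_path_sub ttf (lexx t2) px.
  by apply: (hst omega (t0 + tf) t2 x hw1 ps2 h1); rewrite tr.
split; last by move=> /late; exact: Unbhd_le.
(* During the first window only the bound [rho - 1], needed for existence, has to be shown: (LB) is
   in [U_1] and the error is at most [d' / 2]. *)
have [tr|/ltW rt] := leP (t0 + tf) r.
  by apply: le_trans (Unbhd_norm SB (late tr)) _; rewrite /rho; move: a1; lra.
have pr := integral_path_sub (lexx t0) rt2 px.
have [z solz hz] := happ omega t0 r x hw2 rt pr Sx.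
have [_ hS] := hb t0 (x t0) (Unbhd_le ddb Sx).
have h1 := Unbhd_near (hS z solz r t0r) (hz r (introT andP (conj t0r (lexx _)))).
by apply: le_trans (Unbhd_norm SB h1) _; rewrite /rho; move: d'1; lra.
Qed.

End PracticalStability.

Theorem theorem2 (R : realType) (n m : nat)
    (b : 'I_m.+1 -> R -> 'rV[R]_n -> 'rV[R]_n) (u : 'I_m -> R -> R -> R)
    (T : R) (S : set 'rV[R]_n) :
  assumption1 b -> assumption2 b -> assumption3 u -> assumption4 T u ->
  compact S ->
  locally_uniformly_asymptotically_stable (lie_bracket_system T b u) S ->
  locally_practically_uniformly_asymptotically_stable (input_affine b u) S.
Proof.
move=> hb1 hb2 hu3 hu4 cS [LBs [da da0 LBa]].
have [B B0 SB] : exists2 B, 0 <= B & forall y, S y -> `|y| <= B.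
  have [M [_ hM]] := compact_bounded cS.
  exists (`|M| + 1); first by rewrite addr_ge0.
  by move=> y Sy; apply: hM => //; rewrite ltr_pwDr// ler_norm.
split.
  exact: (input_affine_practically_stable hb1 hb2 hu3 hu4 B0 SB LBs da0 LBa).
exact: (input_affine_practically_attractive hb1 hb2 hu3 hu4 B0 SB LBs da0 LBa).
Qed.
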